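(* Let $\Omega\subset\mathbb{R}^n$ be an open bounded connected set, and assume that $\Omega$ is convex. There exists a constant $c$ such that the overdetermined boundary value problem $$\begin{cases}-\Delta_\infty u=1&\text{in }\Omega,\\ u=0&\text{on }\partial\Omega,\\ |\nabla u|=c&\text{on }\partial\Omega\end{cases}$$ admits a solution $u\in C^1(\overline\Omega)$ if and only if $\Omega$ is a stadium-like domain. Moreover, whenever such a solution $u$ exists for a constant $c$, one has $u=\phi^\Omega$ and $\rho_\Omega=c^3/3$.
   Context: For $\varphi\in C^2$, the infinity Laplacian is $\Delta_\infty\varphi:=\langle\nabla^2\varphi\,\nabla\varphi,\nabla\varphi\rangle$. For functions $u,v:\Omega\to\mathbb{R}$ and $x\in\Omega$, $u\prec_x v$ means $u(x)=v(x)$ and $u(y)\le v(y)$ for every $y\in\Omega$. An upper semicontinuous function $u$ is a viscosity subsolution of $-\Delta_\infty u=1$ in $\Omega$ if for every $x\in\Omega$ and every $\varphi\in C^2(\Omega)$ with $u\prec_x\varphi$ one has $-\Delta_\infty\varphi(x)\le 1$. A lower semicontinuous function $u$ is a viscosity supersolution if for every $x\in\Omega$ and every $\varphi\in C^2(\Omega)$ with $\varphi\prec_x u$ one has $-\Delta_\infty\varphi(x)\ge 1$. A viscosity solution is a continuous function that is both a sub- and a supersolution. A solution $u\in C^1(\overline\Omega)$ of the overdetermined problem is a viscosity solution of the equation in $\Omega$ which vanishes on $\partial\Omega$, is of class $C^1$ up to the boundary ($u$ and $\nabla u$ extend continuously to $\overline\Omega$), and satisfies $|\nabla u|=c$ pointwise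 on $\partial\Omega$. $d_{\partial\Omega}$ is the distance function to $\partial\Omega$; $\rho_\Omega:=\max_{\overline\Omega}d_{\partial\Omega}$; $\Sigma(\Omega)$ is the set of points of $\Omega$ where $d_{\partial\Omega}$ is not differentiable; the cut locus $\overline\Sigma(\Omega)$ is the closure of $\Sigma(\Omega)$ in $\overline\Omega$; the high ridge is $M(\Omega):=\{x\in\overline\Omega: d_{\partial\Omega}(x)=\rho_\Omega\}$. An open bounded convex subset $\Omega$ of $\mathbb{R}^n$ is a stadium-like domain if $\overline\Sigma(\Omega)=M(\Omega)$. $\phi^\Omega(x):=c_0\big[\rho_\Omega^{4/3}-(\rho_\Omega-d_{\partial\Omega}(x))^{4/3}\big]$ with $c_0:=3^{4/3}/4$. *)

(* Defs.v *)
From mathcomp Require Import all_boot all_order all_algebra.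
From mathcomp Require Import all_classical all_reals all_analysis.

Set Implicit Arguments.
Unset Strict Implicit.
Unset Printing Implicit Defensive.

Import Order.TTheory GRing.Theory Num.Theory.
Import numFieldNormedType.Exports.
Local Open Scope classical_set_scope.
Local Open Scope ring_scope.

(* R^n is ['rV[R]_n].  The library norm on it is the sup norm: it is used only
   for topology, boundedness and differentiability, which do not depend on the
   choice of norm.  Lengths and distances use the Euclidean norm [enorm].

   Functions on [Omega] (or on its closure) are total functions of which only
   the values on that set matter. *)

Section Euclidean.
Context {R : realType} {n : nat}.
Implicit Types (x y : 'rV[R]_n) (A : set 'rV[R]_n).

Definition dot x y : R := \sum_(i < n) x 0 i * y 0 i.

Definition enorm x : R := Num.sqrt (dot x x).

Definition boundary A : set 'rV[R]_n := closure A `\` interior A.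

End Euclidean.

Section Calculus.
Context {R : realType} {n : nat}.
Implicit Types (Omega : set 'rV[R]_n) (f : 'rV[R]_n -> R) (x : 'rV[R]_n).

Definition pderiv (i : 'I_n) f : 'rV[R]_n -> R := 'D_(delta_mx 0 i) f.

Definition grad f x : 'rV[R]_n := \row_i pderiv i f x.

Definition hessian f x : 'M[R]_n := \matrix_(i, j) pderiv j (pderiv i f) x.

(* f is of class C^k in the open set Omega *)
Fixpoint Ck (k : nat) Omega f : Prop :=
  (forall x, Omega x -> {for x, continuous f}) /\
  (if k is k'.+1 then
     forall i : 'I_n,
       (forall x, Omega x -> derivable f x (delta_mx 0 i)) /\
       Ck k' Omega (pderiv i f)
   else True).

(* f is of class C^1 in Omega, and f and its gradient extend continuously to the
   closure of Omega, the extensions being f and g; g is uniquely determined on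
   the closure. *)
Definition C1_closure Omega f (g : 'rV[R]_n -> 'rV[R]_n) : Prop :=
  [/\ Ck 1 Omega f,
      {within closure Omega, continuous f},
      {within closure Omega, continuous g} &
      forall x, Omega x -> g x = grad f x].

(* Transposes because the gradient is a row vector. *)
Definition inf_laplacian f x : R :=
  dot (hessian f x *m (grad f x)^T)^T (grad f x).

End Calculus.

Section Viscosity.
Context {R : realType} {n : nat}.
Implicit Types (Omega : set 'rV[R]_n) (u v phi : 'rV[R]_n -> R) (x : 'rV[R]_n).

Definition touches Omega u v x : Prop :=
  u x = v x /\ forall y, Omega y -> u y <= v y.

Definition usc_on Omega u : Prop :=
  forall x, Omega x -> forall a, u x < a ->
    \forall y \near within Omega (nbhs x), u y < a.

Definition lsc_on Omega u : Prop :=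
  forall x, Omega x -> forall a, a < u x ->
    \forall y \near within Omega (nbhs x), a < u y.

Definition viscosity_subsolution Omega u : Prop :=
  usc_on Omega u /\
  forall x phi, Omega x -> Ck 2 Omega phi -> touches Omega u phi x ->
    - inf_laplacian phi x <= 1.

Definition viscosity_supersolution Omega u : Prop :=
  lsc_on Omega u /\
  forall x phi, Omega x -> Ck 2 Omega phi -> touches Omega phi u x ->
    1 <= - inf_laplacian phi x.

Definition viscosity_solution Omega u : Prop :=
  [/\ {within Omega, continuous u},
      viscosity_subsolution Omega u &
      viscosity_supersolution Omega u].

Definition overdetermined_solution Omega (c : R) u : Prop :=
  [/\ viscosity_solution Omega u,
      (forall x, boundary Omega x -> u x = 0) &
      exists2 g : 'rV[R]_n -> 'rV[R]_n,
        C1_closure Omega u g &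
        forall x, boundary Omega x -> enorm (g x) = c].

End Viscosity.

Section Stadium.
Context {R : realType} {n : nat}.
Implicit Types (Omega : set 'rV[R]_n) (x : 'rV[R]_n).

Definition bdist Omega x : R :=
  inf [set enorm (x - y) | y in boundary Omega].

(* For Omega nonempty and bounded, the supremum is attained. *)
Definition inradius Omega : R :=
  sup [set bdist Omega x | x in closure Omega].

Definition singular_set Omega : set 'rV[R]_n :=
  [set x | Omega x /\ ~ differentiable (bdist Omega) x].

Definition cut_locus Omega : set 'rV[R]_n :=
  closure (singular_set Omega) `&` closure Omega.

Definition high_ridge Omega : set 'rV[R]_n :=
  [set x | closure Omega x /\ bdist Omega x = inradius Omega].

Definition stadium_like Omega : Prop :=
  [/\ open Omega, bounded_set Omega, convex_set Omega &
      cut_locus Omega = high_ridge Omega].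

Definition web_c0 : R := 3 `^ (4 / 3) / 4.

Definition web_phi Omega x : R :=
  web_c0 * (inradius Omega `^ (4 / 3)
            - (inradius Omega - bdist Omega x) `^ (4 / 3)).

End Stadium.

(* Main.v *)
From HB Require Import structures.
Require Import Defs.
From mathcomp Require Import all_boot all_order all_algebra.
From mathcomp Require Import all_classical all_reals all_analysis.
From mathcomp Require Import ring lra.
Import Order.TTheory GRing.Theory Num.Theory.
Import numFieldNormedType.Exports.
Set Implicit Arguments.
Unset Strict Implicit.
Unset Printing Implicit Defensive.
Local Open Scope classical_set_scope.
Local Open Scope ring_scope.

(** Write [d] for the distance to the boundary, [rho] for the inradius, [M] for
    the high ridge, [c0] for [web_c0] and [a] for [c ^ 3 / 3].

    The radial functions [A - k |r - r0| ^ (4 / 3)] have infinity Laplacian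
    [- (64 / 81) k ^ 3], which is [- 1] exactly for [k = c0]. A cone with
    [k < c0] therefore cannot touch a supersolution from below, nor one with
    [k > c0] a subsolution from above, away from its vertex ([super_cone_test],
    [sub_cone_test]). Comparison with these cones on balls replaces any general
    comparison principle.

    Let [u] be a solution. At a boundary point [y] that is the foot of some
    interior point, the gradient of [u] is [c] times the inner normal
    ([sol_foot_grad]), so a cone lying below (above) [u] and touching it at [y]
    has slope at most (at least) [c] there. Three comparisons follow.
    - With the vertex at [z] and the cone vanishing on the sphere of radius
      [d z]: [u x >= c0 (d z ^ (4 / 3) - |x - z| ^ (4 / 3))] ([sol_lower]), hence
      [d <= a].
    - With the vertex at [e] and a cone that is steeper at the boundary than
      [c]: such a cone must exceed [u] at [e], which gives
      [u e <= c0 (a ^ (4 / 3) - (a - d e) ^ (4 / 3))] ([sol_upper]).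
    - With the vertex at the foot [y] and a cone rising with slope less than
      [c]: it cannot stay above [u] up to its maximum, so some point within
      distance [a] of [y] has [u >= c0 a ^ (4 / 3)] ([sol_reach]).
    The last two together say that this point is at distance exactly [a] from the
    boundary; so [rho = a] and the point belongs to [M]. Its inscribed ball and
    that of [x] touch the boundary at the same point [y]; convexity makes the
    normals equal ([tangent_balls]) and aligns the centres. Hence every [x] in
    the domain has a point of [M] at distance [rho - d x], and [sol_lower]
    centred there meets [sol_upper]: [u] is [web_phi]. Inverting the profile
    shows that [d] is differentiable off [M], and no point of [M] is a point of
    differentiability; so the domain is stadium-like.

    Conversely, let [d] be differentiable off [M]. Since [d] is concave, going up
    along its gradient reaches [M] along a straight segment ([ridge_approach],
    [ridge_reach]): [rho - d] is the distance to the convex compact set [M]. Its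
    square is continuously differentiable with gradient [2 (x - P x)], where [P]
    is the nonexpansive projection onto [M], and [web_phi] inherits the required
    regularity up to the boundary. The equation is then a one-dimensional
    statement on the line through [x] and [P x], along which [web_phi] is the
    explicit profile ([touching_off_ridge]); on [M] the gradient vanishes and the
    exponent [4 / 3 < 2] excludes test functions from below
    ([no_touching_on_ridge]). *)

(** * Euclidean norm *)


Section EuclideanFacts.
Context {R : realType} {n : nat}.
Implicit Types (x y z v w h : 'rV[R]_n) (a b t : R).

Lemma dotC x y : dot x y = dot y x.
Proof. by apply: eq_bigr => i _; rewrite mulrC. Qed.

Lemma dotDl x y z : dot (x + y) z = dot x z + dot y z.
Proof. by rewrite -big_split; apply: eq_bigr => i _; rewrite mxE mulrDl. Qed.

Lemma dotZl a x y : dot (a *: x) y = a * dot x y.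
Proof. by rewrite mulr_sumr; apply: eq_bigr => i _; rewrite mxE mulrA. Qed.

Lemma dotDr x y z : dot z (x + y) = dot z x + dot z y.
Proof. by rewrite dotC dotDl !(dotC z). Qed.

Lemma dotZr a x y : dot y (a *: x) = a * dot y x.
Proof. by rewrite dotC dotZl dotC. Qed.

Lemma dotNl x y : dot (- x) y = - dot x y.
Proof. by rewrite -scaleN1r dotZl mulN1r. Qed.

Lemma dotNr x y : dot y (- x) = - dot y x.
Proof. by rewrite dotC dotNl dotC. Qed.

Definition dotE := (dotDl, dotDr, dotNl, dotNr, dotZl, dotZr).

Lemma dot0l x : dot 0 x = 0.
Proof. by rewrite -(scale0r 0) dotZl mul0r. Qed.

Lemma dot_ge0 x : 0 <= dot x x.
Proof. by apply: sumr_ge0 => i _; rewrite -expr2 sqr_ge0. Qed.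

Lemma dot_eq0 x : dot x x = 0 -> x = 0.
Proof.
move=> /eqP; rewrite psumr_eq0; last by move=> i _; rewrite -expr2 sqr_ge0.
move=> /allP x0; apply/rowP => i; apply/eqP; rewrite mxE.
by have := x0 i (mem_index_enum _); rewrite -expr2 sqrf_eq0.
Qed.

Lemma enorm_ge0 x : 0 <= enorm x.
Proof. exact: sqrtr_ge0. Qed.

Lemma enorm_sqr x : enorm x ^+ 2 = dot x x.
Proof. by rewrite sqr_sqrtr ?dot_ge0. Qed.

Lemma enorm0 : enorm (0 : 'rV[R]_n) = 0.
Proof. by rewrite /enorm dot0l sqrtr0. Qed.

Lemma enorm_eq0 x : enorm x = 0 -> x = 0.
Proof. by move=> x0; apply: dot_eq0; rewrite -enorm_sqr x0 expr0n. Qed.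

Lemma enorm_gt0 x : x != 0 -> 0 < enorm x.
Proof.
by move=> x0; rewrite lt_def enorm_ge0 andbT; apply: contra_neq x0 => /enorm_eq0.
Qed.

Lemma enormZ a x : enorm (a *: x) = `|a| * enorm x.
Proof.
rewrite /enorm dotZl dotZr mulrA -expr2 sqrtrM ?sqr_ge0//.
by rewrite sqrtr_sqr.
Qed.

Lemma enormN x : enorm (- x) = enorm x.
Proof. by rewrite -scaleN1r enormZ normrN1 mul1r. Qed.

Lemma edistC x y : enorm (x - y) = enorm (y - x).
Proof. by rewrite -enormN opprB. Qed.

Lemma dot_le x y : dot x y <= enorm x * enorm y.
Proof.
have [->|/enorm_gt0 x0] := eqVneq x 0; first by rewrite dot0l enorm0 mul0r.
have [->|/enorm_gt0 y0] := eqVneq y 0; first by rewrite dotC dot0l enorm0 mulr0.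
have := dot_ge0 (enorm y *: x - enorm x *: y).
rewrite !dotE -!enorm_sqr (dotC y x) => H.
have xy0 : 0 < enorm x * enorm y by exact: mulr_gt0.
rewrite -(ler_pM2l xy0); lra.
Qed.

(** Equality case of the Cauchy-Schwarz inequality. *)
Lemma dot_le_eq x y : enorm x * enorm y <= dot x y ->
  enorm y *: x = enorm x *: y.
Proof.
move=> H; apply/eqP; rewrite -subr_eq0; apply/eqP/dot_eq0/eqP.
rewrite eq_le dot_ge0 andbT !dotE -!enorm_sqr (dotC y x).
have xy0 : 0 <= enorm x * enorm y by rewrite mulr_ge0 ?enorm_ge0.
have := ler_wpM2l xy0 H; lra.
Qed.

Lemma enorm_sqrD x y :
  enorm (x + y) ^+ 2 = enorm x ^+ 2 + 2 * dot x y + enorm y ^+ 2.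
Proof. by rewrite !enorm_sqr !dotE (dotC y x); lra. Qed.

Lemma enorm_sqrB x y :
  enorm (x - y) ^+ 2 = enorm x ^+ 2 - 2 * dot x y + enorm y ^+ 2.
Proof. by rewrite enorm_sqrD enormN dotNr; lra. Qed.

Lemma enormD x y : enorm (x + y) <= enorm x + enorm y.
Proof.
rewrite -ler_sqr ?nnegrE ?addr_ge0 ?enorm_ge0// enorm_sqrD.
by have := dot_le x y; lra.
Qed.


Lemma enormB_trans z x y : enorm (x - y) <= enorm (x - z) + enorm (z - y).
Proof. by rewrite -[x - y](subrKA z) enormD. Qed.

Lemma dot_norm_le x y : `|dot x y| <= enorm x * enorm y.
Proof.
by rewrite ler_norml dot_le andbT lerNl -dotNl -(enormN x) dot_le.
Qed.

Lemma coord_le_enorm x i : `|x 0 i| <= enorm x.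
Proof.
rewrite -ler_sqr ?nnegrE ?enorm_ge0// enorm_sqr real_normK ?num_real//.
rewrite /dot (bigD1 i)//= expr2 lerDl; apply: sumr_ge0 => j _.
by rewrite -expr2 sqr_ge0.
Qed.

Lemma mxnorm_le_enorm x : `|x| <= enorm x.
Proof.
rewrite [leLHS]/Num.Def.normr/= mx_normrE; apply: bigmax_le; first exact: enorm_ge0.
by case=> i j _ /=; rewrite (ord1 i) coord_le_enorm.
Qed.

Lemma coord_le_mxnorm x i : `|x 0 i| <= `|x|.
Proof.
rewrite [leRHS]/Num.Def.normr/= mx_normrE; apply/bigmax_geP; right => /=.
by exists (0, i).
Qed.

Lemma enorm_le_mxnorm x : enorm x <= (n.+1)%:R * `|x|.
Proof.
rewrite -ler_sqr ?nnegrE ?enorm_ge0 ?mulr_ge0// enorm_sqr.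
apply: (@le_trans _ _ (\sum_(i < n) `|x| ^+ 2)).
  apply: ler_sum => i _; rewrite -expr2 -real_normK ?num_real//.
  by rewrite ler_sqr ?nnegrE// coord_le_mxnorm.
rewrite sumr_const card_ord -[leLHS]mulr_natl exprMn; apply: ler_wpM2r.
  exact: sqr_ge0.
rewrite -natrX ler_nat; apply: leq_trans (leqnSn n) _.
by rewrite -{1}(expn1 n.+1) leq_pexp2l.
Qed.

(** The Euclidean balls form a neighbourhood basis of the sup-norm topology, so
    that continuity and closures can be handled with Euclidean estimates. *)
Lemma nbhs_enormP x (A : set 'rV[R]_n) :
  nbhs x A <-> exists2 r : R, 0 < r & forall y, enorm (y - x) < r -> A y.
Proof.
split.
  move=> /nbhs_ballP[r /= r0 rA]; exists r => // y yr; apply: rA.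
  rewrite -ball_normE /ball_/= distrC; exact: le_lt_trans (mxnorm_le_enorm _) yr.
move=> [r r0 rA]; apply/nbhs_ballP; exists (r / n.+1%:R) => /=.
  by rewrite divr_gt0.
move=> y; rewrite -ball_normE /ball_/= distrC ltr_pdivlMr// mulrC => yr.
exact/rA/(le_lt_trans (enorm_le_mxnorm _)).
Qed.

Lemma enorm_delta (i : 'I_n) : enorm (delta_mx 0 i : 'rV[R]_n) = 1.
Proof.
rewrite /enorm /dot (bigD1 i)//= big1 ?addr0; last first.
  by move=> j ji; rewrite mxE (negbTE ji) andbF mul0r.
by rewrite mxE !eqxx mulr1 sqrtr1.
Qed.

Lemma sum_delta x : x = \sum_(i < n) x 0 i *: delta_mx 0 i.
Proof. exact: row_sum_delta. Qed.

Lemma cont_enormP (f : 'rV[R]_n -> R) x :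
  {for x, continuous f} <-> forall e : R, 0 < e -> exists2 r : R, 0 < r &
    forall y, enorm (y - x) < r -> `|f y - f x| < e.
Proof.
split=> [/cvgrPdist_lt fx e e0|fx].
  have /nbhs_enormP[r r0 H] := fx e e0.
  by exists r => // y yr; rewrite distrC; exact: H.
apply/(@cvgrPdist_lt _ _ _ (nbhs x)) => e e0; apply/nbhs_enormP.
by have [r r0 H] := fx e e0; exists r => // y yr; rewrite distrC; exact: H.
Qed.

Lemma within_cont_enormP (A : set 'rV[R]_n) (f : 'rV[R]_n -> R) :
  {within A, continuous f} <-> forall x, A x -> forall e : R, 0 < e ->
    exists2 r : R, 0 < r & forall y, A y -> enorm (y - x) < r -> `|f y - f x| < e.
Proof.
rewrite subspace_continuousP; split=> fA x Ax.
  move=> e e0; have /cvgrPdist_lt /(_ e e0) := fA x Ax.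
  rewrite near_withinE => /nbhs_enormP[r r0 H].
  by exists r => // y Ay yr; rewrite distrC; exact: H.
apply/cvgrPdist_lt => e e0; rewrite near_withinE; apply/nbhs_enormP.
have [r r0 H] := fA x Ax e e0; exists r => // y yr Ay.
by rewrite distrC; exact: H.
Qed.

Lemma within_contD (A : set 'rV[R]_n) (f g : 'rV[R]_n -> R) :
  {within A, continuous f} -> {within A, continuous g} ->
  {within A, continuous (fun x => f x + g x)}.
Proof.
rewrite !subspace_continuousP => cf cg x Ax.
by apply: cvgD; [exact: cf|exact: cg].
Qed.

Lemma closure_enormP (A : set 'rV[R]_n) x :
  closure A x <-> forall e : R, 0 < e -> exists2 y, A y & enorm (y - x) < e.
Proof.
split=> [Ax e e0|Ax B /nbhs_enormP[r r0 rB]].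
  have /Ax[y [Ay yx]] : nbhs x [set y | enorm (y - x) < e].
    by apply/nbhs_enormP; exists e.
  by exists y.
by have [y Ay yx] := Ax r r0; exists y; split=> //; exact: rB.
Qed.

End EuclideanFacts.

(** * Distance to the boundary of a convex domain *)


(** The standing assumptions; positive dimension is what makes the boundary of a
    bounded set nonempty. *)
Definition convex_domain {R : realType} {n : nat} (Om : set 'rV[R]_n) : Prop :=
  [/\ (0 < n)%N, Om !=set0, open Om, bounded_set Om & convex_set Om].

Section Distance.
Context {R : realType} {n : nat} {Om : set 'rV[R]_n}.
Hypothesis HO : convex_domain Om.
Implicit Types (x y z v w h : 'rV[R]_n) (a b t : R).
Local Notation d := (bdist Om).

Lemma domain_ball x : Om x ->
  exists2 r : R, 0 < r & forall y, enorm (y - x) < r -> Om y.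
Proof. by case: HO => _ _ Oo _ _ Ox; apply/nbhs_enormP/open_nbhs_nbhs. Qed.

Lemma domain_convex x y t : Om x -> Om y -> 0 <= t <= 1 ->
  Om (x + t *: (y - x)).
Proof.
case: HO => _ _ _ _ Oc Ox Oy /andP[t0 t1].
have := Oc y x (Itv01 t0 t1) (mem_set Oy) (mem_set Ox).
rewrite inE /conv/= => H.
have -> : x + t *: (y - x) = t *: y + (1 - t) *: x.
  by apply/rowP => i; rewrite !mxE; ring.
exact: H.
Qed.

Lemma boundaryE x : boundary Om x <-> closure Om x /\ ~ Om x.
Proof.
case: HO => _ _ Oo _ _; rewrite /boundary.
by rewrite ((interior_id _).1 Oo).
Qed.

Lemma closure_split x : closure Om x -> Om x \/ boundary Om x.
Proof. by move=> cx; have [Ox|Ox] := pselect (Om x); [left|right; exact/boundaryE]. Qed.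

Lemma domain_closure x : Om x -> closure Om x.
Proof. exact: subset_closure. Qed.

(** The exit point is the supremum of the parameters for which the segment is
    still in the domain. *)
Lemma segment_exit x w : Om x -> ~ Om w ->
  exists2 t, 0 <= t <= 1 & boundary Om (x + t *: (w - x)).
Proof.
move=> Ox Ow.
pose S := [set t : R | 0 <= t <= 1 /\ Om (x + t *: (w - x))].
have S0 : S 0 by split; rewrite ?lexx ?ler01// scale0r addr0.
have Sub : ubound S 1 by move=> t [/andP[]].
have Ssup : has_sup S by split; [exists 0|exists 1].
have T0 : 0 <= sup S by apply: ub_le_sup => //; exists 1.
have T1 : sup S <= 1 by apply: ge_sup => //; exists 0.
exists (sup S); first exact/andP.
have wx0 : 0 < enorm (w - x) + 1 by rewrite ltr_wpDl// enorm_ge0.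
apply/boundaryE; split.
  apply/closure_enormP => e e0.
  have e'0 : 0 < e / (enorm (w - x) + 1) by exact: divr_gt0.
  have [t St tT] := sup_adherent e'0 Ssup.
  have tS : t <= sup S by apply: ub_le_sup => //; exists 1.
  exists (x + t *: (w - x)); first by case: St.
  rewrite opprD addrACA subrr add0r -scalerBl enormZ distrC ger0_norm ?subr_ge0//.
  move: tT; rewrite ltrBlDr -ltrBlDl ltr_pdivlMr// mulrDr mulr1.
  by apply: le_lt_trans; rewrite lerDl subr_ge0.
move=> OT; have [r r0 H] := domain_ball OT.
have {}T1 : sup S < 1.
  rewrite lt_neqAle T1 andbT; apply/eqP => T1'; apply: Ow.
  by move: OT; rewrite T1' scale1r addrC subrK.
pose s := Num.min 1 (sup S + r / (enorm (w - x) + 1) / 2).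
have sS : sup S < s by rewrite lt_min T1 ltrDl divr_gt0// divr_gt0.
suff Ss : S s by have := ub_le_sup (ex_intro _ 1 Sub) Ss; rewrite leNgt sS.
split; first by rewrite (ltW (le_lt_trans T0 sS))/= ge_min lexx.
apply: H; rewrite opprD addrACA subrr add0r -scalerBl enormZ ger0_norm ?subr_ge0 ?(ltW sS)//.
apply: (@le_lt_trans _ _ ((r / (enorm (w - x) + 1) / 2) * (enorm (w - x) + 1))).
  apply: ler_pM; rewrite ?subr_ge0 ?(ltW sS) ?enorm_ge0// ?lerDl//.
  by rewrite lerBlDl ge_min lexx orbT.
by rewrite mulrAC divfK ?gt_eqF// ltr_pdivrMr// ltr_pMr// ltr1n.
Qed.

Lemma domain_bounded : exists2 B : R, 0 < B &
  forall x, closure Om x -> enorm x <= B.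
Proof.
case: HO => _ _ _ Ob _.
have [B B0 OB] := ex_strict_bound_gt0 Ob.
exists (n.+1%:R * B + 1); first by rewrite ltr_wpDl// mulr_ge0// ltW.
move=> x /closure_enormP /(_ 1 ltr01)[y Oy yx].
have -> : x = y - (y - x) by rewrite subKr.
apply: (le_trans (enormD _ _)); rewrite enormN lerD ?(ltW yx)//.
apply: (le_trans (enorm_le_mxnorm _)); rewrite ler_wpM2l//.
exact/ltW/OB.
Qed.

Lemma closed_bounded_compact (A : set 'rV[R]_n) B :
  closed A -> (forall x, A x -> enorm x <= B) -> compact A.
Proof.
move=> Acl AB; apply: bounded_closed_compact => //.
exists B; split; first exact: num_real.
move=> M BM x Ax; apply: (le_trans (mxnorm_le_enorm _)).
exact: le_trans (AB _ Ax) (ltW BM).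
Qed.

Lemma closure_compact : compact (closure Om).
Proof.
have [B _ HB] := domain_bounded.
exact: closed_bounded_compact (@closed_closure _ _) HB.
Qed.

Lemma boundary_compact : compact (boundary Om).
Proof.
have [B _ HB] := domain_bounded.
apply: (@closed_bounded_compact _ B); last by move=> x /boundaryE[/HB].
apply: closedI; first exact: closed_closure.
exact/open_closedC/open_interior.
Qed.

Lemma boundary_nonempty : boundary Om !=set0.
Proof.
have [B B0 HB] := domain_bounded.
case: HO => n0 [x Ox] _ _ _.
pose w := (2 * B) *: delta_mx 0 (Ordinal n0) : 'rV[R]_n.
have Ow : ~ Om w.
  move=> /domain_closure/HB; rewrite enormZ enorm_delta mulr1.
  by rewrite gtr0_norm ?mulr_gt0//; lra.
by have [t _ H] := segment_exit Ox Ow; eexists; exact: H.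
Qed.

Lemma bdist_le x y : boundary Om y -> d x <= enorm (x - y).
Proof.
move=> By; apply: ge_inf; last by exists y.
by exists 0 => _ [z _ <-]; exact: enorm_ge0.
Qed.

Lemma bdist_foot x : exists2 y, boundary Om y & enorm (x - y) = d x.
Proof.
have cf : {within boundary Om, continuous (fun y => enorm (x - y))}.
  apply/within_cont_enormP => y _ e e0; exists e => // z _ zy.
  rewrite ltr_norml; apply/andP; split.
    have := enormB_trans z x y; lra.
  by have := enormB_trans y x z; rewrite (edistC y z); lra.
have [y yB H] := compact_EVT_min boundary_nonempty boundary_compact cf.
exists y; first exact: set_mem.
apply/eqP; rewrite eq_le bdist_le ?andbT; last exact: set_mem.
apply: lb_le_inf.
  by have [z Bz] := boundary_nonempty; exists (enorm (x - z)); exists z.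
by move=> _ [z Bz <-]; exact/H/mem_set.
Qed.

Lemma bdist_ge0 x : 0 <= d x.
Proof. by have [y _ <-] := bdist_foot x; exact: enorm_ge0. Qed.

Lemma bdist_lip x y : d x <= d y + enorm (x - y).
Proof.
have [z Bz <-] := bdist_foot y.
apply: (le_trans (bdist_le _ Bz)).
by have := enormB_trans y x z; lra.
Qed.

Lemma bdist_norm x y : `|d x - d y| <= enorm (x - y).
Proof.
rewrite ler_norml; apply/andP; split.
  by have := bdist_lip y x; rewrite edistC; lra.
by have := bdist_lip x y; lra.
Qed.

Lemma bdist_boundary x : boundary Om x -> d x = 0.
Proof.
move=> Bx; apply/eqP; rewrite eq_le bdist_ge0 andbT.
by have := bdist_le x Bx; rewrite subrr enorm0.
Qed.

Lemma bdist_gt0 x : Om x -> 0 < d x.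
Proof.
move=> Ox; rewrite lt_def bdist_ge0 andbT; apply/eqP => dx0.
have [y /boundaryE[_ By]] := bdist_foot x; rewrite dx0 => /enorm_eq0/eqP.
by rewrite subr_eq0 => /eqP xy; apply: By; rewrite -xy.
Qed.

Lemma bdist_gt0_domain x : closure Om x -> 0 < d x -> Om x.
Proof. by move=> /closure_split[//|/bdist_boundary->]; rewrite ltxx. Qed.

(** The segment from [x] to a point outside the domain crosses the boundary. *)
Lemma bdist_ball x w : Om x -> enorm (w - x) < d x -> Om w.
Proof.
move=> Ox wx; apply: contrapT => Ow.
have [t /andP[t0 t1] By] := segment_exit Ox Ow.
have := bdist_le x By; rewrite leNgt => /negP; apply.
rewrite opprD addrA subrr add0r enormN enormZ ger0_norm//.
by apply: le_lt_trans wx; rewrite ler_piMl// enorm_ge0.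
Qed.

Lemma bdist_ge x r : closure Om x -> (forall w, enorm (w - x) < r -> Om w) ->
  r <= d x.
Proof.
move=> cx H; have [y /boundaryE[_ By] <-] := bdist_foot x.
by rewrite leNgt; apply/negP => yr; apply/By/H; rewrite edistC.
Qed.

Lemma convex_combB x y x' y' t : 0 <= t <= 1 ->
  enorm (x' + t *: (y' - x') - (x + t *: (y - x))) <=
  (1 - t) * enorm (x' - x) + t * enorm (y' - y).
Proof.
move=> /andP[t0 t1].
have -> : x' + t *: (y' - x') - (x + t *: (y - x)) =
   (1 - t) *: (x' - x) + t *: (y' - y).
  by apply/rowP => i; rewrite !mxE; ring.
by apply: (le_trans (enormD _ _)); rewrite !enormZ !ger0_norm ?subr_ge0.
Qed.

Lemma closure_convex x y t : closure Om x -> closure Om y -> 0 <= t <= 1 ->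
  closure Om (x + t *: (y - x)).
Proof.
move=> /closure_enormP cx /closure_enormP cy /[dup] t01 /andP[t0 t1].
apply/closure_enormP => e e0.
have e2 : 0 < e / 2 by exact: divr_gt0.
have [x' Ox' xx] := cx _ e2; have [y' Oy' yy] := cy _ e2.
exists (x' + t *: (y' - x')); first exact: domain_convex.
apply: (le_lt_trans (convex_combB _ _ _ _ t01)).
have : (1 - t) * enorm (x' - x) <= (1 - t) * (e / 2).
  by apply: ler_wpM2l; rewrite ?subr_ge0// ltW.
have : t * enorm (y' - y) <= t * (e / 2) by apply: ler_wpM2l => //; rewrite ltW.
lra.
Qed.

(** The inscribed balls at [x] and [y] combine, by convexity, into a ball of
    radius [(1 - t) d x + t d y] inside the domain. *)
Lemma bdist_concave_in x y t : Om x -> Om y -> 0 <= t <= 1 ->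
  (1 - t) * d x + t * d y <= d (x + t *: (y - x)).
Proof.
move=> Ox Oy t01.
set D := (X in X <= _); set m := x + _.
apply: bdist_ge => [|w wr]; first exact/domain_closure/domain_convex.
have D0 : 0 < D by apply: le_lt_trans wr; exact: enorm_ge0.
pose k := D^-1 *: (w - m).
have kw : w = m + D *: k by rewrite scalerA divff ?gt_eqF// scale1r addrC subrK.
have k1 : enorm k < 1.
  by rewrite enormZ gtr0_norm ?invr_gt0// mulrC ltr_pdivrMr// mul1r.
have -> : w = (x + d x *: k) + t *: ((y + d y *: k) - (x + d x *: k)).
  by rewrite kw /m /D; apply/rowP => i; rewrite !mxE; ring.
have inball z : Om z -> Om (z + d z *: k).
  move=> Oz; apply: (bdist_ball Oz).
  by rewrite addrC addKr enormZ gtr0_norm ?bdist_gt0// gtr_pMr// bdist_gt0.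
by apply: domain_convex => //; exact: inball.
Qed.

Lemma bdist_concave x y t : closure Om x -> closure Om y -> 0 <= t <= 1 ->
  (1 - t) * d x + t * d y <= d (x + t *: (y - x)).
Proof.
move=> /closure_enormP cx /closure_enormP cy /[dup] t01 /andP[t0 t1].
apply/ler_addgt0Pr => e e0.
have e2 : 0 < e / 2 by exact: divr_gt0.
have [x' Ox' xx] := cx _ e2; have [y' Oy' yy] := cy _ e2.
have H := bdist_concave_in Ox' Oy' t01.
have dx := bdist_lip x x'; have dy := bdist_lip y y'.
have {}dx : d x <= d x' + e / 2 by rewrite edistC in xx; lra.
have {}dy : d y <= d y' + e / 2 by rewrite edistC in yy; lra.
have dm := bdist_lip (x' + t *: (y' - x')) (x + t *: (y - x)).
have Hm : enorm (x' + t *: (y' - x') - (x + t *: (y - x))) <= e / 2.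
  apply: (le_trans (convex_combB _ _ _ _ t01)).
  have -> : e / 2 = (1 - t) * (e / 2) + t * (e / 2) by ring.
  by apply: lerD; apply: ler_wpM2l; rewrite ?subr_ge0// ltW.
have : (1 - t) * d x <= (1 - t) * (d x' + e / 2).
  by apply: ler_wpM2l; rewrite ?subr_ge0.
have : t * d y <= t * (d y' + e / 2) by apply: ler_wpM2l.
lra.
Qed.

Local Notation rho := (inradius Om).

Lemma bdist_le_inradius x : closure Om x -> d x <= rho.
Proof.
move=> cx; apply: ub_le_sup; last by exists x.
have [B _ HB] := domain_bounded; have [y0 By0] := boundary_nonempty.
exists (B + enorm y0) => _ [z cz <-].
apply: (le_trans (bdist_le z By0)); apply: (le_trans (enormD _ _)).
by rewrite enormN lerD2r HB.
Qed.

Lemma bdist_cont (A : set 'rV[R]_n) : {within A, continuous d}.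
Proof.
apply/within_cont_enormP => x _ e e0; exists e => // y _.
exact/le_lt_trans/bdist_norm.
Qed.

Lemma ridge_nonempty : exists2 x, closure Om x & d x = rho.
Proof.
have c0 : closure Om !=set0.
  by case: HO => _ [x Ox] _ _ _; exists x; exact: domain_closure.
have [x cx H] := compact_EVT_max c0 closure_compact (@bdist_cont (closure Om)).
exists x; first exact: set_mem.
apply/eqP; rewrite eq_le bdist_le_inradius/=; last exact: set_mem.
apply: ge_sup; first by case: c0 => z cz; exists (d z); exists z.
by move=> _ [z cz <-]; exact/H/mem_set.
Qed.

Lemma inradius_gt0 : 0 < rho.
Proof.
case: HO => _ [x Ox] _ _ _.
by apply: (lt_le_trans (bdist_gt0 Ox)); exact/bdist_le_inradius/domain_closure.
Qed.

Lemma ridge_domain x : closure Om x -> rho <= d x -> Om x.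
Proof.
move=> cx dx; apply: bdist_gt0_domain => //.
exact: lt_le_trans inradius_gt0 dx.
Qed.

(** For small [t] the point [y + t w] lies in the ball inscribed at [x], because
    [|y + t w - x| ^ 2 - d x ^ 2 = t (t |w| ^ 2 - 2 dot w (x - y))]. *)
Lemma foot_cone x y w : Om x -> enorm (x - y) = d x -> 0 < dot w (x - y) ->
  exists2 s : R, 0 < s & forall t : R, 0 < t < s -> Om (y + t *: w).
Proof.
move=> Ox yx wxy.
have w0 : 0 < enorm w ^+ 2.
  rewrite exprn_gt0// enorm_gt0//; apply: contraTneq wxy => ->.
  by rewrite dot0l ltxx.
exists (2 * dot w (x - y) / enorm w ^+ 2); first by rewrite divr_gt0// mulr_gt0.
move=> t /andP[t0]; rewrite ltr_pdivlMr// => ts.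
apply: (bdist_ball Ox).
rewrite -ltr_sqr ?nnegrE ?enorm_ge0 ?bdist_ge0// -yx.
have -> : y + t *: w - x = t *: w - (x - y).
  by apply/rowP => i; rewrite !mxE; ring.
rewrite enorm_sqrB dotZl enormZ exprMn real_normK ?num_real//.
rewrite gtrDr subr_lt0 [X in X * _]expr2 -mulrA [ltRHS]mulrCA ltr_pM2l//.
Qed.

(** Two inscribed balls touching the boundary at the same point have the same
    normal there: otherwise the difference [w] of the normals points inside one
    ball and [- w] inside the other, and convexity puts the contact point in the
    open domain. *)
Lemma tangent_balls x e y : Om x -> Om e -> boundary Om y ->
  enorm (x - y) = d x -> enorm (e - y) = d e ->
  d e *: (x - y) = d x *: (e - y).
Proof.
move=> Ox Oe /boundaryE[_ By] xy ey; rewrite -ey -xy; apply: dot_le_eq.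
have dx := bdist_gt0 Ox; have de := bdist_gt0 Oe.
rewrite leNgt; apply/negP => H; apply: By.
pose w := (d e) *: (x - y) - (d x) *: (e - y).
have wx : 0 < dot w (x - y).
  move: (x - y) (e - y) @w xy ey H => p q w xy ey H.
  rewrite /w !dotE -enorm_sqr xy (dotC q) subr_gt0 expr2 [ltRHS]mulrCA ltr_pM2l//.
  by move: H; rewrite xy ey mulrC.
have we : 0 < dot (- w) (e - y).
  move: (x - y) (e - y) @w xy ey H {wx} => p q w xy ey H.
  rewrite /w opprB !dotE -enorm_sqr ey subr_gt0 expr2 [ltRHS]mulrCA ltr_pM2l//.
  by move: H; rewrite xy ey.
have [s s0 Hs] := foot_cone Ox xy wx; have [r r0 Hr] := foot_cone Oe ey we.
pose t := Num.min s r / 2.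
have m0 : 0 < Num.min s r by rewrite lt_min s0.
have t0 : 0 < t by rewrite divr_gt0.
have tm : t < Num.min s r by rewrite ltr_pdivrMr// ltr_pMr// ltr1n.
have H1 : Om (y + t *: w).
  by apply: Hs; rewrite t0 (lt_le_trans tm)// ge_min lexx.
have H2 : Om (y + t *: - w).
  by apply: Hr; rewrite t0 (lt_le_trans tm)// ge_min lexx orbT.
have -> : y = (y + t *: w) + 2^-1 *: ((y + t *: - w) - (y + t *: w)).
  by apply/rowP => i; rewrite !mxE; field.
by apply: domain_convex => //; rewrite invr_ge0 ler0n/= invf_le1// ler1n.
Qed.

End Distance.

(** * Differential calculus *)


Section Derivatives.
Context {R : realType}.

Lemma is_derive_epsP {V : normedModType R} (f : V -> R) (x v : V) (l : R) :
  is_derive x v f l <-> forall e : R, 0 < e -> exists2 r : R, 0 < r &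
    forall t : R, `|t| < r -> `|f (x + t *: v) - f x - t * l| <= e * `|t|.
Proof.
split.
  move=> [df fl] e e0; have /derivable_nbhsP := df.
  move/eqaddoP => /(_ e e0) /nbhs_ballP[r /= r0 H].
  exists r => // t tr; have := H t; rewrite -ball_normE /ball_/= sub0r normrN.
  move=> /(_ tr); rewrite !fctE/= fl opprD addrA (addrC _ x).
  by congr (`|_| <= _).
move=> H.
have cv : (fun h : R => h^-1 *: ((f \o shift x) (h *: v) - f x)) @ 0^' --> l.
  apply/(@cvgrPdist_le _ _ _ (dnbhs_filter_on (0 : R))) => e e0.
  have [r r0 Hr] := H e e0.
  rewrite /= near_withinE; apply/nbhs_ballP; exists r => //= t.
  rewrite -ball_normE /ball_/= sub0r normrN => tr t0.
  have {}t0 : 0 < `|t| by rewrite normr_gt0.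
  rewrite -(ler_pM2r t0) -normrM mulrBl [_ *: _]mulrC mulfVK -?normr_gt0//.
  by rewrite distrC mulrC (addrC _ x) Hr.
split; first by apply/cvg_ex; exists l.
by apply: cvg_lim => //; exact: norm_hausdorff.
Qed.

Lemma is_derive_line {V : normedModType R} (f : V -> R) (x v : V) (t l : R) :
  is_derive (x + t *: v) v f l <-> is_derive t 1 (fun s : R => f (x + s *: v)) l.
Proof.
have E s : x + t *: v + s *: v = x + (t + s *: (1 : R)) *: v.
  by rewrite -addrA -scalerDl; congr (_ + _ *: _); rewrite /GRing.scale/= mulr1.
split=> /is_derive_epsP H; apply/is_derive_epsP => e e0;
  have [r r0 Hr] := H e e0; exists r => // s sr.
  by rewrite -E Hr.
by rewrite E Hr.
Qed.

Lemma MVT0 (f df : R -> R) (a : R) :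
  (forall s : R, `|s| <= `|a| -> is_derive s 1 f (df s)) ->
  exists2 s : R, `|s| <= `|a| & f a - f 0 = df s * a.
Proof.
move=> H.
have cont lo hi : (forall s, s \in `[lo, hi]%R -> `|s| <= `|a|) ->
    {within `[lo, hi], continuous f}.
  move=> lohi; apply: derivable_within_continuous => s sl.
  by have := H s (lohi s sl) => ?; exact: ex_derive.
have [a0|a0] := leP 0 a.
  have I s : s \in `[0, a]%R -> `|s| <= `|a|.
    by rewrite in_itv/= => /andP[s0 sa]; rewrite !ger0_norm.
  have [|c /I ca E] := @MVT_segment _ f df 0 a a0 _ (cont _ _ I).
    move=> s sI; apply/H/I.
    by move: sI; rewrite !in_itv/= => /andP[/ltW-> /ltW->].
  by exists c => //; rewrite E subr0.
have I s : s \in `[a, 0]%R -> `|s| <= `|a|.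
  by rewrite in_itv/= => /andP[sa s0]; rewrite !ler0_norm ?lerN2// ltW.
have [|c /I ca E] := @MVT_segment _ f df a 0 (ltW a0) _ (cont _ _ I).
  move=> s sI; apply/H/I.
  by move: sI; rewrite !in_itv/= => /andP[/ltW-> /ltW->].
by exists c => //; rewrite -opprB E sub0r mulrN opprK.
Qed.

(** The derivative of the remainder is [o(s)] because [df] is differentiable at
    [0]; the mean value theorem integrates this to [o(t ^ 2)]. *)
Lemma taylor2 (f df : R -> R) (d2 r : R) : 0 < r ->
  (forall s : R, `|s| < r -> is_derive s 1 f (df s)) -> is_derive (0 : R) 1 df d2 ->
  forall e : R, 0 < e -> exists2 q : R, 0 < q & forall t : R, `|t| < q ->
    `|f t - (f 0 + df 0 * t + d2 / 2 * t ^+ 2)| <= e * t ^+ 2.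
Proof.
move=> r0 H1 /is_derive_epsP H2 e e0.
have [q q0 Hq] := H2 e e0.
exists (Num.min r q); first by rewrite lt_min r0.
move=> t; rewrite lt_min => /andP[tr tq].
pose g s := f s - (df 0 * s + d2 / 2 * s ^+ 2).
pose dg s := df s - (df 0 + d2 * s).
have Hg (s : R) : `|s| <= `|t| -> is_derive s 1 g (dg s).
  move=> st; have := H1 s (le_lt_trans st tr) => ?.
  apply: is_deriveB; apply: is_derive_eq.
  by rewrite /GRing.scale/=; lra.
have [s st E] := MVT0 Hg.
have -> : f t - (f 0 + df 0 * t + d2 / 2 * t ^+ 2) = g t - g 0.
  by rewrite /g !expr2; ring.
rewrite E normrM -real_normK ?num_real// expr2 mulrA ler_wpM2r//.
have /= := Hq s (le_lt_trans st tq).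
rewrite add0r /dg [s *: _]mulr1 => Hs.
have -> : df s - (df 0 + d2 * s) = df s - df 0 - s * d2 by ring.
by apply: (le_trans Hs); rewrite ler_wpM2l// ltW.
Qed.

End Derivatives.

Section Gradient.
Context {R : realType} {n : nat}.
Implicit Types (f : 'rV[R]_n -> R) (x y v : 'rV[R]_n) (Om : set 'rV[R]_n).

Lemma dot_linear (g : 'rV[R]_n) : linear (dot g : 'rV[R]_n -> R).
Proof. by move=> a x y; rewrite dotDr dotZr. Qed.

HB.instance Definition _ (g : 'rV[R]_n) :=
  GRing.isLinear.Build R 'rV[R]_n R _ (dot g) (dot_linear g).

Lemma dot_continuous (g : 'rV[R]_n) : continuous (dot g : 'rV[R]_n -> R).
Proof.
move=> x; apply/cont_enormP => e e0.
have g0 : 0 < enorm g + 1 by rewrite ltr_wpDl// enorm_ge0.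
exists (e / (enorm g + 1)); first exact: divr_gt0.
move=> y; rewrite ltr_pdivlMr// => yx.
rewrite -dotNr -dotDr; apply: (le_lt_trans (dot_norm_le _ _)).
apply: le_lt_trans yx; rewrite mulrC ler_wpM2l ?enorm_ge0//.
by rewrite lerDl.
Qed.

Lemma differentiable_eps f x (g : 'rV[R]_n) :
  (forall e : R, 0 < e -> exists2 r : R, 0 < r & forall h, enorm h < r ->
    `|f (x + h) - f x - dot g h| <= e * enorm h) -> differentiable f x.
Proof.
move=> H.
have E : f \o shift x = cst (f x) + dot g +o_ (0 : 'rV[R]_n) id.
  apply/eqaddoP => e e0.
  have N0 : 0 < n.+1%:R :> R by [].
  have [r r0 Hr] := H (e / n.+1%:R) (divr_gt0 e0 N0).
  apply/nbhs_enormP; exists r => // h; rewrite subr0 => hr.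
  rewrite /= !fctE/= opprD addrA (addrC h).
  apply: (le_trans (Hr _ hr)).
  rewrite -mulrA ler_wpM2l ?(ltW e0)// ler_pdivrMl//.
  exact: enorm_le_mxnorm.
apply/diff_locallyP.
have D := diff_unique (@dot_continuous g) E.
by rewrite D; split; [exact: dot_continuous|].
Qed.

Lemma differentiable_epsE f x : differentiable f x ->
  forall e : R, 0 < e -> exists2 r : R, 0 < r & forall h, enorm h < r ->
    `|f (x + h) - f x - 'd f x h| <= e * enorm h.
Proof.
move=> /diff_locally/eqaddoP H e e0.
have /nbhs_enormP[r r0 Hr] := H e e0.
exists r => // h hr; have := Hr h; rewrite subr0 => /(_ hr).
rewrite /= !fctE/= opprD addrA (addrC h) => /le_trans; apply.
apply: ler_wpM2l; first exact: ltW.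
exact: mxnorm_le_enorm.
Qed.

Lemma differentiable_is_derive f x v : differentiable f x ->
  is_derive x v f (dot (grad f x) v).
Proof.
move=> df; split; first exact: diff_derivable.
rewrite deriveE// {1}(sum_delta v) linear_sum; apply: eq_bigr => i _.
by rewrite linearZ/= mxE /pderiv deriveE// mulrC.
Qed.

Lemma enorm_le_coord (x y : 'rV[R]_n) : (forall i, `|x 0 i| <= `|y 0 i|) ->
  enorm x <= enorm y.
Proof.
move=> H; rewrite ler_sqrt ?dot_ge0//; apply: ler_sum => i _.
rewrite -!expr2 -real_normK ?num_real// -[leRHS]real_normK ?num_real//.
by rewrite ler_sqr ?nnegrE.
Qed.

(** Changing one coordinate at a time, the mean value theorem turns continuity
    of the partial derivatives into differentiability. *)
Lemma C1_differentiable Om f x : open Om -> Ck 1 Om f -> Om x ->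
  differentiable f x.
Proof.
move=> Oo [_ Cf] Ox; apply: (@differentiable_eps _ _ (grad f x)) => e e0.
have N0 : 0 < n.+1%:R :> R by [].
have eN : 0 < e / n.+1%:R by exact: divr_gt0.
have [r r0 rO] := (nbhs_enormP _ _).1 (open_nbhs_nbhs (conj Oo Ox)).
have Hq : forall i : 'I_n, exists q, 0 < q /\ forall y, enorm (y - x) < q ->
    `|pderiv i f y - pderiv i f x| < e / n.+1%:R.
  move=> i; have [_ [C _]] := Cf i.
  by have /cont_enormP/(_ _ eN)[q q0 qH] := C x Ox; exists q.
have [q qH] := choice Hq.
pose m := \big[Num.min/r]_(i < n) q i.
have mr : m <= r by exact: bigmin_le_id.
have mq i : m <= q i by exact: bigmin_le_cond.
exists m; first by apply/bigmin_gtP; split=> // i _; case: (qH i).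
move=> h hm.
pose tr k : 'rV[R]_n := \row_i (if (i < k)%N then h 0 i else 0).
have step k : (k <= n)%N ->
    `|f (x + tr k) - f x - \sum_(i < n | (i < k)%N) pderiv i f x * h 0 i|
      <= e / n.+1%:R * \sum_(i < n | (i < k)%N) `|h 0 i|.
  elim: k => [_|k IH kn].
    have -> : tr 0%N = 0 by apply/rowP => i; rewrite !mxE.
    by rewrite addr0 subrr !big_pred0// subr0 normr0 mulr0.
  have {}IH := IH (ltnW kn).
  pose j := Ordinal kn.
  have trS : tr k.+1 = tr k + h 0 j *: delta_mx 0 j.
    apply/rowP => i; rewrite !mxE eqxx/=.
    have [->|ij] := eqVneq i j; first by rewrite ltnS leqnn ltnn mulr1 add0r.
    rewrite mulr0 addr0 ltnS leq_eqVlt.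
    suff /negbTE-> : (i : nat) != k by [].
    by apply: contra_neq ij => ik; exact: val_inj.
  have inb s : `|s| <= `|h 0 j| ->
      enorm (x + tr k + s *: delta_mx 0 j - x) < m.
    move=> sh; apply: le_lt_trans hm; rewrite addrAC (addrC x) addrK.
    apply: enorm_le_coord => i; rewrite !mxE eqxx/=.
    have [->|ij] := eqVneq i j; first by rewrite ltnn mulr1 add0r.
    by rewrite mulr0 addr0; case: ifP => //; rewrite normr0.
  have D (s : R) : `|s| <= `|h 0 j| ->
      is_derive s 1 (fun s : R => f (x + tr k + s *: delta_mx 0 j))
        (pderiv j f (x + tr k + s *: delta_mx 0 j)).
    move=> sh.
    have := (is_derive_line f (x + tr k) (delta_mx 0 j) s (pderiv j f (x + tr k + s *: delta_mx 0 j))).1.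
    apply; split; last by rewrite /pderiv.
    by apply: (Cf j).1; apply: rO; exact: lt_le_trans (inb _ sh) mr.
  have [s sh E] := MVT0 D.
  rewrite trS addrA.
  have sumS (F : 'I_n -> R) : \sum_(i < n | (i < k.+1)%N) F i =
      F j + \sum_(i < n | (i < k)%N) F i.
    rewrite (bigD1 j) ?ltnS//=; congr (_ + _); apply: eq_bigl => i.
    rewrite ltnS leq_eqVlt -val_eqE/= andb_orl andbN/= andbC.
    by case: (ltnP i k) => ik; rewrite ?andbT ?andbF// neq_ltn ik.
  rewrite !sumS mulrDr.
  set S := \sum_(i < n | _) _ in IH *; set T := \sum_(i < n | _) _ in IH *.
  have -> : f (x + tr k + h 0 j *: delta_mx 0 j) - f x -
      (pderiv j f x * h 0 j + S) =
      (f (x + tr k + h 0 j *: delta_mx 0 j) -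
       f (x + tr k + 0 *: delta_mx 0 j) - pderiv j f x * h 0 j) +
      (f (x + tr k) - f x - S).
    by rewrite scale0r addr0; ring.
  apply: (le_trans (ler_normD _ _)); apply: lerD => //.
  rewrite E -mulrBl normrM ler_wpM2r// ltW//.
  by apply: (qH j).2; exact: lt_le_trans (inb _ sh) (mq j).
have := step n (leqnn n).
have -> : tr n = h by apply/rowP => i; rewrite mxE ltn_ord.
have S (F : 'I_n -> R) : \sum_(i < n | (i < n)%N) F i = \sum_i F i.
  by apply: eq_bigl => i; rewrite ltn_ord.
rewrite !S => H.
have -> : dot (grad f x) h = \sum_i pderiv i f x * h 0 i.
  by apply: eq_bigr => i _; rewrite mxE.
apply: (le_trans H); rewrite -mulrA ler_wpM2l ?(ltW e0)// ler_pdivrMl//.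
apply: (@le_trans _ _ (\sum_(i < n) enorm h)).
  by apply: ler_sum => i _; exact: coord_le_enorm.
rewrite sumr_const card_ord -[leLHS]mulr_natl ler_wpM2r ?enorm_ge0//.
by rewrite ler_nat.
Qed.

Lemma C1_is_derive Om f x v : open Om -> Ck 1 Om f -> Om x ->
  is_derive x v f (dot (grad f x) v).
Proof. by move=> Oo Cf Ox; exact/differentiable_is_derive/(C1_differentiable Oo Cf). Qed.

End Gradient.

(** * Polynomial test functions *)


Section TestFunctions.
Context {R : realType} {n : nat}.
Implicit Types (f g : 'rV[R]_n -> R) (x y z v : 'rV[R]_n) (Om : set 'rV[R]_n).

Lemma Ck_le k Om f : Ck k.+1 Om f -> Ck k Om f.
Proof.
elim: k f => [|k IH] f [cf Hf]; split=> // i; have [df Cf] := Hf i.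
by split=> //; exact: IH.
Qed.

Lemma Ck_subset k (A B : set 'rV[R]_n) f : B `<=` A -> Ck k A f -> Ck k B f.
Proof.
move=> BA; elim: k f => [|k IH] f [cf Hf]; split=> //.
- by move=> x /BA; exact: cf.
- by move=> x /BA; exact: cf.
move=> i; have [df Cf] := Hf i; split; last exact: IH.
by move=> x /BA; exact: df.
Qed.

Lemma Ck_cst k (a : R) : Ck k setT (cst a : 'rV[R]_n -> R).
Proof.
elim: k a => [|k IH] a; split=> //.
- by move=> x _; exact: cst_continuous.
- by move=> x _; exact: cst_continuous.
move=> i; split; first by move=> x _; exact: derivable_cst.
have -> : pderiv i (cst a) = cst 0.
  by apply/funext => x; rewrite /pderiv derive_cst.
exact: IH.
Qed.

Lemma coord_derive x v i : is_derive x v (fun x : 'rV[R]_n => x 0 i) (v 0 i).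
Proof.
apply/is_derive_epsP => e e0; exists 1 => // t _.
rewrite !mxE (_ : _ - _ = 0); first by rewrite normr0 mulr_ge0// ltW.
by ring.
Qed.

Lemma Ck_coord k i : Ck k setT (fun x : 'rV[R]_n => x 0 i).
Proof.
have cc : forall x : 'rV[R]_n, setT x -> {for x, continuous (fun x : 'rV[R]_n => x 0 i)}.
  by move=> x _; exact: coord_continuous.
case: k => [|k]; split=> // j; split.
  by move=> x _; have := coord_derive x (delta_mx 0 j) i => ?; exact: ex_derive.
have -> : pderiv j (fun x : 'rV[R]_n => x 0 i) = cst ((delta_mx 0 j : 'rV[R]_n) 0 i).
  apply/funext => x; rewrite /pderiv.
  by have := coord_derive x (delta_mx 0 j) i => ?; rewrite derive_val.
exact: Ck_cst.
Qed.

Lemma Ck_add k f g : Ck k setT f -> Ck k setT g -> Ck k setT (fun x => f x + g x).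
Proof.
elim: k f g => [|k IH] f g [cf Hf] [cg Hg]; split=> //.
- by move=> x Ox; apply: continuousD; [exact: cf|exact: cg].
- by move=> x Ox; apply: continuousD; [exact: cf|exact: cg].
move=> i; have [df Cf] := Hf i; have [dg Cg] := Hg i; split.
  by move=> x Ox; apply: derivableD; [exact: df|exact: dg].
have -> : pderiv i (fun x => f x + g x) = (fun x => pderiv i f x + pderiv i g x).
  by apply/funext => x; rewrite /pderiv deriveD//; [exact: df|exact: dg].
exact: IH.
Qed.

Lemma Ck_mul k f g : Ck k setT f -> Ck k setT g -> Ck k setT (fun x => f x * g x).
Proof.
elim: k f g => [|k IH] f g [cf Hf] [cg Hg]; split=> //.
- by move=> x Ox; apply: continuousM; [exact: cf|exact: cg].
- by move=> x Ox; apply: continuousM; [exact: cf|exact: cg].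
move=> i; have [df Cf] := Hf i; have [dg Cg] := Hg i; split.
  by move=> x Ox; apply: derivableM; [exact: df|exact: dg].
have -> : pderiv i (fun x => f x * g x) =
    (fun x => f x * pderiv i g x + g x * pderiv i f x).
  by apply/funext => x; rewrite /pderiv deriveM//; [exact: df|exact: dg].
by apply: Ck_add; apply: IH => //; apply: Ck_le; split.
Qed.

Definition sqdist z x : R := dot (x - z) (x - z).

Lemma sqdistE z x : sqdist z x = enorm (x - z) ^+ 2.
Proof. by rewrite enorm_sqr. Qed.

Lemma Ck_sqdist k z : Ck k setT (sqdist z).
Proof.
have -> : sqdist z = fun x => \sum_(i < n) (x 0 i + - z 0 i) * (x 0 i + - z 0 i).
  by apply/funext => x; apply: eq_bigr => i _; rewrite !mxE.
elim: (index_enum _) => [|i s IH].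
  have -> : (fun x : 'rV[R]_n =>
     \sum_(i <- [::]) (x 0 i + - z 0 i) * (x 0 i + - z 0 i)) = cst 0.
    by apply/funext => x; rewrite big_nil.
  exact: Ck_cst.
rewrite (_ : (fun x => _) = fun x : 'rV[R]_n => (x 0 i + - z 0 i) * (x 0 i + - z 0 i) +
   \sum_(i <- s) (x 0 i + - z 0 i) * (x 0 i + - z 0 i)); last first.
  by apply/funext => x; rewrite big_cons.
apply: Ck_add => //.
have Ci : Ck k setT (fun x : 'rV[R]_n => x 0 i + - z 0 i).
  by apply: Ck_add; [exact: Ck_coord|exact: Ck_cst].
exact: Ck_mul.
Qed.

Lemma sqdist_derive z x v : is_derive x v (sqdist z) (2 * dot (x - z) v).
Proof.
apply/is_derive_epsP => e e0.
have v0 : 0 < dot v v + 1 by rewrite ltr_wpDl// dot_ge0.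
exists (e / (dot v v + 1)); first exact: divr_gt0.
move=> t; rewrite ltr_pdivlMr// => te.
have -> : sqdist z (x + t *: v) - sqdist z x - t * (2 * dot (x - z) v) =
    t * (t * dot v v).
  rewrite /sqdist (addrAC x); move: (x - z) => w.
  by rewrite !dotE (dotC v w); ring.
rewrite normrM mulrC ler_wpM2r//; apply: ltW; apply: le_lt_trans te.
by rewrite normrM ler_wpM2l// ger0_norm ?dot_ge0// lerDl.
Qed.

(** A quadratic polynomial in the squared distance to [z] is what a radial test
    function looks like to second order; the quartic term in the distance to
    [x0] makes the contact global without changing the second-order jet at
    [x0]. *)
Definition test_poly z x0 (a b c K : R) x : R :=
  a + b * (sqdist z x - sqdist z x0) + c * (sqdist z x - sqdist z x0) ^+ 2
  + K * sqdist x0 x ^+ 2.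

Lemma Ck_test_poly k Om z x0 (a b c K : R) : Ck k Om (test_poly z x0 a b c K).
Proof.
apply: (@Ck_subset _ setT) => //.
pose q := fun x => sqdist z x + cst (- sqdist z x0) x.
have Cq : Ck k setT q by apply: Ck_add; [exact: Ck_sqdist|exact: Ck_cst].
have -> : test_poly z x0 a b c K = fun x =>
    ((cst a x + cst b x * q x) + cst c x * (q x * q x)) +
    cst K x * (sqdist x0 x * sqdist x0 x).
  by apply/funext => x; rewrite /test_poly /q /= !expr2.
have C a' : Ck k setT (cst a' : 'rV[R]_n -> R) by exact: Ck_cst.
have S : Ck k setT (sqdist x0) by exact: Ck_sqdist.
apply: Ck_add; last by apply: Ck_mul; [exact: C|exact: Ck_mul].
apply: Ck_add; last by apply: Ck_mul; [exact: C|exact: Ck_mul].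
by apply: Ck_add; [exact: C|apply: Ck_mul; [exact: C|]].
Qed.

Section PointwiseRules.
Variables (x v : 'rV[R]_n).

Let deriveC (k : R) : is_derive x v (fun _ : 'rV[R]_n => k) 0.
Proof. exact: is_derive_cst. Qed.

Let deriveD f g (df dg : R) : is_derive x v f df -> is_derive x v g dg ->
  is_derive x v (fun y => f y + g y) (df + dg).
Proof. exact: is_deriveD. Qed.

Let deriveM f g (df dg : R) : is_derive x v f df -> is_derive x v g dg ->
  is_derive x v (fun y => f y * g y) (f x * dg + g x * df).
Proof. exact: is_deriveM. Qed.

Lemma test_poly_derive z x0 (a b c K : R) :
  is_derive x v (test_poly z x0 a b c K)
   ((2 * b + 4 * c * (sqdist z x - sqdist z x0)) * dot (x - z) v
    + 4 * K * sqdist x0 x * dot (x - x0) v).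
Proof.
have Dz := deriveD (sqdist_derive z x v) (deriveC (- sqdist z x0)).
have D0 := sqdist_derive x0 x v.
have D := deriveD (deriveD (deriveD (deriveC a) (deriveM (deriveC b) Dz))
  (deriveM (deriveC c) (deriveM Dz Dz))) (deriveM (deriveC K) (deriveM D0 D0)).
have -> : test_poly z x0 a b c K = fun y =>
    a + b * (sqdist z y + - sqdist z x0)
    + c * ((sqdist z y + - sqdist z x0) * (sqdist z y + - sqdist z x0))
    + K * (sqdist x0 y * sqdist x0 y).
  by apply/funext => y; rewrite /test_poly !expr2.
apply: is_derive_eq D _.
by move: (sqdist z x) (sqdist z x0) (sqdist x0 x) (dot _ v) (dot _ v) => *; ring.
Qed.

End PointwiseRules.

Lemma test_poly_hess z x0 (b c K : R) v w :
  is_derive x0 w (fun x => (2 * b + 4 * c * (sqdist z x - sqdist z x0)) * dot (x - z) v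
    + 4 * K * sqdist x0 x * dot (x - x0) v)
   (2 * b * dot w v + 8 * c * dot (x0 - z) w * dot (x0 - z) v).
Proof.
have Dz := sqdist_derive z x0 w; have D0 := sqdist_derive x0 x0 w.
have Ddot y : is_derive x0 w (fun x => dot (x - y) v) (dot w v).
  apply/is_derive_epsP => e e0; exists 1 => // t _.
  rewrite (addrAC x0) (dotDl (x0 - y)) dotZl (_ : _ - _ = 0); last by ring.
  by rewrite normr0 mulr_ge0// ltW.
have C (k : R) : is_derive x0 w (fun _ : 'rV[R]_n => k) 0 by exact: is_derive_cst.
have D1 := is_deriveD (C (2 * b)) (is_deriveM (C (4 * c)) (is_deriveB Dz (C (sqdist z x0)))).
have D := is_deriveD (is_deriveM D1 (Ddot z)) (is_deriveM (is_deriveM (C (4 * K)) D0) (Ddot x0)).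
apply: is_derive_eq D _.
rewrite /GRing.scale/= !fctE subrr /sqdist subrr !dot0l.
by move: (dot (x0 - z) v) (dot (x0 - z) w) (dot w v) (dot (x0 - z) (x0 - z)) => *; ring.
Qed.

Lemma dot_delta x i : dot x (delta_mx 0 i) = x 0 i.
Proof.
rewrite /dot (bigD1 i)//= big1 ?addr0 ?mxE ?eqxx ?mulr1// => j ji.
by rewrite mxE (negbTE ji) andbF mulr0.
Qed.

Lemma inf_laplacianE f x : inf_laplacian f x =
  \sum_i \sum_j pderiv j (pderiv i f) x * grad f x 0 j * grad f x 0 i.
Proof.
apply: eq_bigr => i _; rewrite !mxE mulr_suml; apply: eq_bigr => j _.
by rewrite !mxE.
Qed.

Lemma test_poly_inf_laplacian z x0 (a b c K : R) (t0 := sqdist z x0) :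
  inf_laplacian (test_poly z x0 a b c K) x0 = 8 * b ^+ 2 * t0 * (b + 4 * c * t0).
Proof.
set f := test_poly _ _ _ _ _ _.
have P i : pderiv i f = fun x =>
   (2 * b + 4 * c * (sqdist z x - sqdist z x0)) * dot (x - z) (delta_mx 0 i)
    + 4 * K * sqdist x0 x * dot (x - x0) (delta_mx 0 i).
  apply/funext => x; rewrite /pderiv.
  by have := test_poly_derive x (delta_mx 0 i) z x0 a b c K => ?; rewrite derive_val.
have G i : grad f x0 0 i = 2 * b * (x0 - z) 0 i.
  by rewrite mxE P !subrr /sqdist subrr dot0l !dot_delta; ring.
have H i j : pderiv j (pderiv i f) x0 = 2 * b * (i == j)%:R +
    8 * c * (x0 - z) 0 j * (x0 - z) 0 i.
  rewrite P /pderiv.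
  have := test_poly_hess z x0 b c K (delta_mx 0 i) (delta_mx 0 j) => ?.
  by rewrite derive_val !dot_delta !mxE eqxx.
rewrite inf_laplacianE.
under eq_bigr => i _ do under eq_bigr => j _ do rewrite H !G.
rewrite /t0 /sqdist; move: (x0 - z) => w.
have -> : 8 * b ^+ 2 * dot w w * (b + 4 * c * dot w w) =
   8 * b ^+ 3 * dot w w + 32 * c * b ^+ 2 * dot w w * dot w w by ring.
have E i : \sum_j (2 * b * (i == j)%:R + 8 * c * w 0 j * w 0 i) * (2 * b * w 0 j) *
     (2 * b * w 0 i) =
   8 * b ^+ 3 * (w 0 i * w 0 i) + 32 * c * b ^+ 2 * dot w w * (w 0 i * w 0 i).
  transitivity (\sum_j (8 * b ^+ 3 * w 0 i * ((i == j)%:R * w 0 j) +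
      32 * c * b ^+ 2 * (w 0 i * w 0 i) * (w 0 j * w 0 j))).
    by apply: eq_bigr => j _; ring.
  rewrite big_split/= -!mulr_sumr -/(dot w w).
  rewrite (bigD1 i)//= eqxx mul1r big1 ?addr0; first by ring.
  by move=> j ji; rewrite eq_sym (negbTE ji) mul0r.
by rewrite (eq_bigr _ (fun i _ => E i)) big_split/= -!mulr_sumr.
Qed.

End TestFunctions.

(** * Radial test functions *)


Section RadialTests.
Context {R : realType} {n : nat}.
Implicit Types (x y z v : 'rV[R]_n) (Om : set 'rV[R]_n) (u : 'rV[R]_n -> R).

Lemma sqdist_continuous z : continuous (sqdist z : 'rV[R]_n -> R).
Proof. by move=> x; have [] := Ck_sqdist 0 z => + _; exact. Qed.

Lemma sqdist_near z x0 (e : R) : 0 < e -> exists2 r : R, 0 < r &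
  forall y, enorm (y - x0) < r -> `|sqdist z y - sqdist z x0| < e.
Proof. by move=> e0; exact: (cont_enormP _ _).1 (@sqdist_continuous z x0) _ e0. Qed.

(** Used to choose the quartic coefficient of a test polynomial so large that a
    local contact becomes a contact on the whole bounded domain. *)
Lemma test_poly_bounded Om z x0 (b c : R) : convex_domain Om ->
  exists T : R, forall x, Om x ->
    `|b * (sqdist z x - sqdist z x0) + c * (sqdist z x - sqdist z x0) ^+ 2| <= T.
Proof.
move=> HO; have [B B0 HB] := domain_bounded HO.
pose S := (B + enorm z) ^+ 2 + sqdist z x0.
exists (`|b| * S + `|c| * S ^+ 2) => x /domain_closure/HB xB.
have qS : `|sqdist z x - sqdist z x0| <= S.
  apply: (le_trans (ler_normB _ _)).
  rewrite !ger0_norm ?dot_ge0// lerD2r sqdistE ler_sqr ?nnegrE ?enorm_ge0//.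
    by apply: (le_trans (enormD _ _)); rewrite enormN lerD2r.
  by rewrite addr_ge0 ?enorm_ge0// ltW.
apply: (le_trans (ler_normD _ _)); apply: lerD.
  by rewrite normrM ler_wpM2l.
rewrite normrM normrX ler_wpM2l// ler_sqr// nnegrE.
exact: le_trans (normr_ge0 _) qS.
Qed.

(** The test polynomial touches a function that is bounded below on the domain
    as soon as its quadratic part does so near [x0]. *)
Lemma super_poly_test Om u z x0 (b c r m : R) (t0 := sqdist z x0) :
  convex_domain Om -> viscosity_supersolution Om u ->
  (forall x, Om x -> m <= u x) -> Om x0 -> 0 < r ->
  (forall x, Om x -> enorm (x - x0) < r ->
     u x0 + b * (sqdist z x - t0) + c * (sqdist z x - t0) ^+ 2 <= u x) ->
  8 * b ^+ 2 * t0 * (b + 4 * c * t0) <= -1.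
Proof.
move=> HO [_ Hu] um Ox0 r0 H.
have [T HT] := test_poly_bounded z x0 b c HO.
pose L := (`|u x0| + T + `|m|) / r ^+ 4.
have T0 : 0 <= T by exact: le_trans (normr_ge0 _) (HT _ Ox0).
have r4 : 0 < r ^+ 4 by rewrite exprn_gt0.
have L0 : 0 <= L by rewrite divr_ge0 ?(ltW r4)// !addr_ge0.
have := Hu x0 (test_poly z x0 (u x0) b c (- L)) Ox0 (Ck_test_poly _ _ _ _ _ _ _ _).
rewrite test_poly_inf_laplacian lerNr; apply; split.
  by rewrite /test_poly !subrr /sqdist subrr dot0l expr0n !mulr0 !addr0.
move=> y Oy; rewrite /test_poly.
have [yr|yr] := ltP (enorm (y - x0)) r.
  apply: le_trans (H y Oy yr); rewrite gerDl mulNr oppr_le0 mulr_ge0// sqr_ge0//.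
have Hq : r ^+ 4 <= sqdist x0 y ^+ 2.
  by rewrite sqdistE -exprM lerXn2r ?nnegrE ?enorm_ge0// ltW.
have : L * r ^+ 4 <= L * sqdist x0 y ^+ 2 by rewrite ler_wpM2l.
rewrite {1}/L divfK ?gt_eqF// => HL.
have := um y Oy; have := ler_norm (u x0); have := ler_norm (- m).
have := le_trans (ler_norm _) (HT y Oy); rewrite normrN; lra.
Qed.

Lemma sub_poly_test Om u z x0 (b c r m : R) (t0 := sqdist z x0) :
  convex_domain Om -> viscosity_subsolution Om u ->
  (forall x, Om x -> u x <= m) -> Om x0 -> 0 < r ->
  (forall x, Om x -> enorm (x - x0) < r ->
     u x <= u x0 + b * (sqdist z x - t0) + c * (sqdist z x - t0) ^+ 2) ->
  -1 <= 8 * b ^+ 2 * t0 * (b + 4 * c * t0).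
Proof.
move=> HO [_ Hu] um Ox0 r0 H.
have [T HT] := test_poly_bounded z x0 b c HO.
pose L := (`|u x0| + T + `|m|) / r ^+ 4.
have T0 : 0 <= T by exact: le_trans (normr_ge0 _) (HT _ Ox0).
have r4 : 0 < r ^+ 4 by rewrite exprn_gt0.
have L0 : 0 <= L by rewrite divr_ge0 ?(ltW r4)// !addr_ge0.
have := Hu x0 (test_poly z x0 (u x0) b c L) Ox0 (Ck_test_poly _ _ _ _ _ _ _ _).
rewrite test_poly_inf_laplacian lerNl; apply; split.
  by rewrite /test_poly !subrr /sqdist subrr dot0l expr0n !mulr0 !addr0.
move=> y Oy; rewrite /test_poly.
have [yr|yr] := ltP (enorm (y - x0)) r.
  apply: (le_trans (H y Oy yr)); rewrite lerDl mulr_ge0// sqr_ge0//.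
have Hq : r ^+ 4 <= sqdist x0 y ^+ 2.
  by rewrite sqdistE -exprM lerXn2r ?nnegrE ?enorm_ge0// ltW.
have : L * r ^+ 4 <= L * sqdist x0 y ^+ 2 by rewrite ler_wpM2l.
rewrite {1}/L divfK ?gt_eqF// => HL.
have := um y Oy; have := ler_norm (- u x0); have := ler_norm m.
have := HT y Oy; rewrite ler_norml => /andP[]; rewrite normrN; lra.
Qed.

(** In the variable [t = r ^ 2], a radial profile [G r] is matched to second
    order by a quadratic whose [inf_laplacian] is [G' ^ 2 * G'']. *)
Lemma radial_taylor (G dG : R -> R) (r1 q G2 : R) : 0 < r1 -> 0 < q ->
  (forall s : R, `|s - r1| < q -> is_derive s 1 G (dG s)) ->
  is_derive r1 1 dG G2 ->
  exists b c : R, 8 * b ^+ 2 * r1 ^+ 2 * (b + 4 * c * r1 ^+ 2) = dG r1 ^+ 2 * G2 /\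
    forall e : R, 0 < e -> exists2 p : R, 0 < p & forall s : R, 0 <= s -> `|s ^+ 2 - r1 ^+ 2| < p ->
      `|G s - (G r1 + b * (s ^+ 2 - r1 ^+ 2) + c * (s ^+ 2 - r1 ^+ 2) ^+ 2)|
         <= e * (s ^+ 2 - r1 ^+ 2) ^+ 2.
Proof.
move=> r0 q0 H1 H2.
(* half of the second and the first derivative of [G (sqrt t)] at [r1 ^ 2] *)
exists (dG r1 / (2 * r1)), ((G2 / (2 * r1) * (2 * r1)^-1 - dG r1 / (4 * r1 ^+ 3)) / 2).
split; first by field; rewrite gt_eqF.
move=> e e0.
pose S : R -> R := fun t : R => Num.sqrt (t + r1 ^+ 2).
have r2 : 0 < r1 ^+ 2 by rewrite exprn_gt0.
have S0 : S 0 = r1 by rewrite /S add0r sqrtr_sqr gtr0_norm.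
have dS (t : R) : - r1 ^+ 2 < t -> is_derive t 1 S (2 * S t)^-1.
  move=> t0; have t1 : 0 < t + r1 ^+ 2 by rewrite -ltrBlDr sub0r.
  have := is_derive1_sqrt t1 => D.
  have E : is_derive t 1 (fun t : R => t + r1 ^+ 2) 1.
    by apply: is_derive_eq; rewrite addr0.
  have := @is_derive1_comp _ Num.sqrt (fun t => t + r1 ^+ 2) t _ _ D E.
  by rewrite mulr1.
have Sc : exists2 p : R, 0 < p & forall t : R, `|t| < p -> - r1 ^+ 2 < t /\ `|S t - r1| < q.
  have : {for 0, continuous S}.
    have := dS 0; rewrite oppr_lt0 => /(_ r2) D.
    by apply/differentiable_continuous/derivable1_diffP; exact: ex_derive.
  move=> /(@cvgrPdist_lt _ _ _ (nbhs (0 : R))) /(_ q q0) /nbhs_ballP[p /= p0 Hp].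
  exists (Num.min p (r1 ^+ 2)); first by rewrite lt_min p0.
  move=> t; rewrite lt_min => /andP[tp tr]; split.
    by move: tr; rewrite ltr_norml => /andP[].
  have := Hp t; rewrite -ball_normE /ball_/= sub0r normrN => /(_ tp).
  by rewrite S0 distrC.
have [p p0 Hp] := Sc.
have T1 (t : R) : `|t| < p -> is_derive t 1 (G \o S) (dG (S t) / (2 * S t)).
  move=> /Hp[t1 t2]; have D1 := dS t t1; have D2 := H1 _ t2.
  exact: is_derive1_comp.
have T2 : is_derive (0 : R) 1 (fun t => dG (S t) / (2 * S t))
   (G2 / (2 * r1) * (2 * r1)^-1 - dG r1 / (4 * r1 ^+ 3)).
  have D1 : is_derive (0 : R) 1 S (2 * r1)^-1.
    by have := dS 0; rewrite S0 oppr_lt0; exact.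
  rewrite -{1}S0 in H2.
  have D2 := @is_derive1_comp _ dG S 0 _ _ H2 D1.
  have D3 : is_derive (0 : R) 1 (fun t => (2 * S t)) (2 * (2 * r1)^-1).
    exact: (@is_deriveZ _ _ _ S 2).
  have N : 2 * S 0 != 0 by rewrite S0 mulf_neq0// gt_eqF.
  have D4 := @is_deriveV _ (fun t : R => 2 * S t) 0 _ _ N D3.
  have := is_deriveM D2 D4; rewrite fctE => D5.
  apply: (@is_derive_eq _ _ _ _ _ _ _ _ D5).
  rewrite /= S0 /GRing.scale/=; field; rewrite gt_eqF//.
have [p' p'0 Hp'] := taylor2 p0 T1 T2 e0.
exists p' => // s s0 sp; have := Hp' _ sp.
by rewrite /= S0 /S subrK sqrtr_sqr (ger0_norm s0).
Qed.

(** The Taylor error [e] perturbs the quadratic coefficient, and the infinity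
    Laplacian is continuous in that coefficient. *)
Lemma super_radial_test Om u z x0 (G dG : R -> R) (q G2 r m : R)
    (r1 := enorm (x0 - z)) :
  convex_domain Om -> viscosity_supersolution Om u ->
  (forall x, Om x -> m <= u x) -> Om x0 -> 0 < r1 -> 0 < q -> 0 < r ->
  (forall s : R, `|s - r1| < q -> is_derive s 1 G (dG s)) ->
  is_derive r1 1 dG G2 ->
  (forall x, Om x -> enorm (x - x0) < r -> u x0 + G (enorm (x - z)) - G r1 <= u x) ->
  dG r1 ^+ 2 * G2 <= -1.
Proof.
move=> HO Hu um Ox0 r10 q0 r0 D1 D2 H.
have [b [c [<- T]]] := radial_taylor r10 q0 D1 D2.
apply/ler_addgt0Pl => e e0.
have K0 : 0 < 32 * b ^+ 2 * r1 ^+ 4 + 1 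
  by apply: ltr_wpDl => //; rewrite mulr_ge0 ?exprn_even_ge0// mulr_ge0 ?sqr_ge0.
have [p p0 Hp] := T _ (divr_gt0 e0 K0).
have [r' r'0 Hr'] := sqdist_near z x0 p0.
have := @super_poly_test Om u z x0 b (c - e / (32 * b ^+ 2 * r1 ^+ 4 + 1)) (Num.min r r') m HO Hu um Ox0.
rewrite lt_min r0 r'0 => /(_ isT) HH.
have {HH} : 8 * b ^+ 2 * sqdist z x0 *
    (b + 4 * (c - e / (32 * b ^+ 2 * r1 ^+ 4 + 1)) * sqdist z x0) <= -1.
  apply: HH => x Ox; rewrite lt_min => /andP[xr xr'].
  apply: le_trans (H x Ox xr).
  have := Hr' x xr'; rewrite !sqdistE -/r1 => /(Hp _ (enorm_ge0 _)).
  rewrite ler_norml => /andP[]; lra.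
rewrite sqdistE -/r1 => HH.
have : 32 * b ^+ 2 * r1 ^+ 4 * (e / (32 * b ^+ 2 * r1 ^+ 4 + 1)) <= e.
  by rewrite mulrA ler_pdivrMr// mulrC ler_pM2l// lerDl.
move: HH; set k := e / _; lra.
Qed.

Lemma sub_radial_test Om u z x0 (G dG : R -> R) (q G2 r m : R)
    (r1 := enorm (x0 - z)) :
  convex_domain Om -> viscosity_subsolution Om u ->
  (forall x, Om x -> u x <= m) -> Om x0 -> 0 < r1 -> 0 < q -> 0 < r ->
  (forall s : R, `|s - r1| < q -> is_derive s 1 G (dG s)) ->
  is_derive r1 1 dG G2 ->
  (forall x, Om x -> enorm (x - x0) < r -> u x <= u x0 + G (enorm (x - z)) - G r1) ->
  -1 <= dG r1 ^+ 2 * G2.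
Proof.
move=> HO Hu um Ox0 r10 q0 r0 D1 D2 H.
have [b [c [<- T]]] := radial_taylor r10 q0 D1 D2.
apply/ler_addgt0Pl => e e0.
have K0 : 0 < 32 * b ^+ 2 * r1 ^+ 4 + 1 
  by apply: ltr_wpDl => //; rewrite mulr_ge0 ?exprn_even_ge0// mulr_ge0 ?sqr_ge0.
have [p p0 Hp] := T _ (divr_gt0 e0 K0).
have [r' r'0 Hr'] := sqdist_near z x0 p0.
have := @sub_poly_test Om u z x0 b (c + e / (32 * b ^+ 2 * r1 ^+ 4 + 1)) (Num.min r r') m HO Hu um Ox0.
rewrite lt_min r0 r'0 => /(_ isT) HH.
have {HH} : -1 <= 8 * b ^+ 2 * sqdist z x0 *
    (b + 4 * (c + e / (32 * b ^+ 2 * r1 ^+ 4 + 1)) * sqdist z x0).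
  apply: HH => x Ox; rewrite lt_min => /andP[xr xr'].
  apply: (le_trans (H x Ox xr)).
  have := Hr' x xr'; rewrite !sqdistE -/r1 => /(Hp _ (enorm_ge0 _)).
  rewrite ler_norml => /andP[]; lra.
rewrite sqdistE -/r1 => HH.
have : 32 * b ^+ 2 * r1 ^+ 4 * (e / (32 * b ^+ 2 * r1 ^+ 4 + 1)) <= e.
  by rewrite mulrA ler_pdivrMr// mulrC ler_pM2l// lerDl.
move: HH; set k := e / _; lra.
Qed.

End RadialTests.

(** * The cones of exponent 4 / 3 *)


(** The powers 4 / 3 and 1 / 3 are locked: only their algebra is used, and
    unfolding them would expose exponentials and logarithms. *)
HB.lock Definition p43 {R : realType} (s : R) : R := s `^ (4 / 3).
HB.lock Definition cbrt {R : realType} (s : R) : R := s `^ 3^-1.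

Section FourThirds.
Context {R : realType}.
Implicit Types (s t k q : R).

Lemma p43_powR s : p43 s = s `^ (4 / 3). Proof. by rewrite p43.unlock. Qed.

Lemma cbrt_powR s : cbrt s = s `^ 3^-1. Proof. by rewrite cbrt.unlock. Qed.


Lemma cbrt_ge0 s : 0 <= cbrt s. Proof. by rewrite cbrt_powR powR_ge0. Qed.

Lemma cbrt_gt0 s : 0 < s -> 0 < cbrt s.
Proof. by rewrite cbrt_powR; exact: powR_gt0. Qed.

Lemma cbrtK s : 0 <= s -> cbrt s ^+ 3 = s.
Proof.
move=> s0; rewrite -powR_mulrn ?cbrt_ge0// cbrt_powR -powRrM mulVf//.
by rewrite powRr1.
Qed.

Lemma p43E s : p43 s = cbrt s ^+ 4.
Proof.
by rewrite -powR_mulrn ?cbrt_ge0// cbrt_powR -powRrM p43_powR mulrC.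
Qed.

Lemma p43_ge0 s : 0 <= p43 s. Proof. by rewrite p43_powR powR_ge0. Qed.

Lemma p43_0 : p43 (0 : R) = 0.
Proof. by rewrite p43_powR powR0// mulf_neq0// invr_neq0. Qed.

Lemma cbrt0 : cbrt (0 : R) = 0.
Proof. by rewrite cbrt_powR powR0// invr_neq0. Qed.

Lemma cbrt_le s t : 0 <= s -> s <= t -> cbrt s <= cbrt t.
Proof.
by move=> s0 st; rewrite !cbrt_powR; apply: ge0_ler_powR; rewrite ?invr_ge0// nnegrE// (le_trans s0).
Qed.

Lemma cbrt_lt s t : 0 <= s -> s < t -> cbrt s < cbrt t.
Proof.
move=> s0 st; rewrite !cbrt_powR; apply: gt0_ltr_powR; rewrite ?invr_gt0// nnegrE//.
exact: le_trans s0 (ltW st).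
Qed.

Lemma cbrt_cube s : 0 <= s -> cbrt (s ^+ 3) = s.
Proof.
move=> s0; apply: (@pexpIrn _ 3) => //; rewrite ?nnegrE ?cbrt_ge0//.
by rewrite cbrtK// exprn_ge0.
Qed.

Lemma p43_le s t : 0 <= s -> s <= t -> p43 s <= p43 t.
Proof. by move=> s0 st; rewrite !p43E lerXn2r ?nnegrE ?cbrt_ge0// cbrt_le. Qed.


Lemma p43M s t : 0 <= s -> 0 <= t -> p43 (s * t) = p43 s * p43 t.
Proof. by move=> s0 t0; rewrite !p43_powR powRM. Qed.

Lemma p43_gt0 s : 0 < s -> 0 < p43 s.
Proof. by rewrite p43_powR; exact: powR_gt0. Qed.

(** Convexity of [p43]; in terms of the cube roots [a] and [b] the defect is
    [(b - a) ^ 2 (3 b ^ 2 + 2 a b + a ^ 2) / 3]. *)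
Lemma p43_tangent s t : 0 <= s -> 0 <= t ->
  p43 s + 4 / 3 * cbrt s * (t - s) <= p43 t.
Proof.
move=> s0 t0; rewrite !p43E -{3}(cbrtK s0) -{1}(cbrtK t0).
have := cbrt_ge0 s; have := cbrt_ge0 t; set a := cbrt s; set b := cbrt t => b0 a0.
have : 0 <= (b - a) ^+ 2 * (3 * b ^+ 2 + 2 * a * b + a ^+ 2).
  by rewrite mulr_ge0 ?sqr_ge0// !addr_ge0 ?mulr_ge0 ?sqr_ge0.
lra.
Qed.

Lemma p43_dist s t b : 0 <= s -> 0 <= t -> s <= b -> t <= b ->
  `|p43 s - p43 t| <= 4 / 3 * cbrt b * `|s - t|.
Proof.
wlog st : s t / t <= s.
  move=> H s0 t0 sb tb; have [st|/ltW st] := leP t s; first exact: H.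
  by rewrite distrC [`|s - t|]distrC; exact: H.
move=> s0 t0 sb tb; rewrite !ger0_norm ?subr_ge0//; last exact: p43_le.
have := p43_tangent s0 t0.
have : 4 / 3 * cbrt s * (s - t) <= 4 / 3 * cbrt b * (s - t).
  by rewrite ler_wpM2r ?subr_ge0// ler_wpM2l// cbrt_le.
lra.
Qed.

Lemma p43_cont s e : 0 <= s -> 0 < e -> exists2 r : R, 0 < r &
  forall t, 0 <= t -> `|t - s| < r -> `|p43 t - p43 s| < e.
Proof.
move=> s0 e0; pose K := 4 / 3 * cbrt (s + 1).
have K0 : 0 < K by rewrite mulr_gt0// cbrt_gt0// ltr_wpDl.
exists (Num.min 1 (e / K)); first by rewrite lt_min ltr01 divr_gt0.
move=> t t0; rewrite lt_min => /andP[t1 te].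
apply: (@le_lt_trans _ _ (K * `|t - s|)).
  apply: p43_dist => //; last by rewrite lerDl.
  by rewrite -lerBlDl (le_trans (ler_norm _))// ltW.
by rewrite mulrC -ltr_pdivlMr.
Qed.

Lemma cbrt_scale l s t : 0 <= l <= 1 -> 0 <= s -> l * s <= t ->
  l * cbrt s <= cbrt t.
Proof.
move=> /andP[l0 l1] s0 st.
have ls0 : 0 <= l * s by exact: mulr_ge0.
apply: le_trans (cbrt_le ls0 st).
rewrite -(@ler_pXn2r _ 3) ?nnegrE ?cbrt_ge0 ?mulr_ge0 ?cbrt_ge0//.
rewrite exprMn !cbrtK// ler_wpM2r// -[leRHS]expr1 ler_wiXn2l//.
Qed.

(** Chord estimate for the cone [p43 (s + q) - p43 (r + q)] near [r = s], where
    its slope is [4 / 3 * cbrt (s + q)]; the loss [t ^ 2] comes from replacing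
    the cube root at [r] by the one at [s]. *)
Lemma p43_slope s q t : 0 <= s -> 0 <= q -> 0 < t < 1 ->
  4 / 3 * cbrt (s + q) * s * (t - t ^+ 2) <=
  p43 (s + q) - p43 ((1 - t) * s + q).
Proof.
move=> s0 q0 /andP[t0 t1].
have t1' : 0 <= 1 - t <= 1 by rewrite subr_ge0 (ltW t1)/= gerBl ltW.
have ts0 : 0 <= (1 - t) * s + q.
  by rewrite addr_ge0// mulr_ge0//; case/andP: t1'.
have sq0 : 0 <= s + q by exact: addr_ge0.
have T := p43_tangent ts0 sq0.
have S : (1 - t) * cbrt (s + q) <= cbrt ((1 - t) * s + q).
  by apply: cbrt_scale => //; rewrite mulrDr lerD2l ler_piMl//; case/andP: t1'.
have st0 : 0 <= s * t by rewrite mulr_ge0// ltW.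
have := ler_wpM2r st0 S; lra.
Qed.

Lemma p43_derive s : 0 < s -> is_derive s 1 p43 (4 / 3 * cbrt s).
Proof.
move=> s0; rewrite (_ : p43 = fun s => s `^ (4 / 3)); last first.
  by apply/funext => x; exact: p43_powR.
apply: is_derive_eq (is_derive1_powR (4 / 3) s0) _.
by rewrite cbrt_powR; congr (_ * _ `^ _); field.
Qed.

Lemma cbrt_derive s : 0 < s -> is_derive s 1 cbrt (3^-1 / cbrt s ^+ 2).
Proof.
move=> s0; rewrite [X in is_derive _ _ X](_ : _ = fun s => s `^ 3^-1); last first.
  by apply/funext => x; exact: cbrt_powR.
apply: is_derive_eq (is_derive1_powR (3^-1) s0) _.
congr (_ * _); rewrite powRB ?(gt_eqF s0) ?implybT// powRr1 ?(ltW s0)//.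
rewrite -cbrt_powR -{2}(cbrtK (ltW s0)).
by have := cbrt_gt0 s0 => c0; field; rewrite gt_eqF.
Qed.

Lemma web_c0_gt0 : 0 < (web_c0 : R).
Proof. by rewrite divr_gt0// powR_gt0. Qed.

Lemma web_c0_cube : (web_c0 : R) ^+ 3 = 81 / 64.
Proof.
rewrite /web_c0 -p43_powR p43E exprMn -exprM.
have -> : cbrt 3 ^+ (4 * 3) = (cbrt 3 ^+ 3 : R) ^+ 4 by rewrite -exprM.
rewrite cbrtK// ; lra.
Qed.

Lemma web_c0_slope : 4 / 3 * (web_c0 : R) = cbrt 3.
Proof.
rewrite /web_c0 -p43_powR p43E.
have E : cbrt 3 ^+ 4 = cbrt 3 * 3 :> R by rewrite exprS cbrtK.
rewrite E; lra.
Qed.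

(** The profile [A - k (sg r + q)^(4/3)], with [sg = 1] or [sg = -1], satisfies
    [G' ^ 2 * G'' = - (64 / 81) k ^ 3], which is [- 1] for [k = web_c0]. *)
Section Cone.
Variables (k sg q : R).
Hypothesis sg2 : sg ^+ 2 = 1.
Let G r := - (k * p43 (sg * r + q)).
Let dG r := - (k * (4 / 3 * cbrt (sg * r + q) * sg)).

Lemma cone_lin s : is_derive s (1 : R) (fun r => sg * r + q) sg.
Proof.
apply/is_derive_epsP => e e0; exists 1 => // t _.
rewrite (_ : _ - _ = 0) ?normr0 ?mulr_ge0 ?(ltW e0)//.
by rewrite /GRing.scale/=; ring.
Qed.

Lemma cone_derive s : 0 < sg * s + q -> is_derive s 1 G (dG s).
Proof.
move=> s0; have D1 := p43_derive s0; have D2 := cone_lin s.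
have D3 := @is_derive1_comp _ p43 (fun r => sg * r + q) s _ _ D1 D2.
exact: (@is_deriveN _ _ _ _ _ _ _ (@is_deriveZ _ _ _ _ k _ _ _ D3)).
Qed.

Lemma cone_derive2 s : 0 < sg * s + q ->
  is_derive s 1 dG (- (k * (4 / 3 * (3^-1 / cbrt (sg * s + q) ^+ 2 * sg) * sg))).
Proof.
move=> s0; have D1 := cbrt_derive s0; have D2 := cone_lin s.
have D3 := @is_derive1_comp _ cbrt (fun r => sg * r + q) s _ _ D1 D2.
have -> : dG = - ((k * (4 / 3) * sg) *: (cbrt \o (fun r => sg * r + q))).
  by apply/funext => r; rewrite /dG !fctE /GRing.scale/=; ring.
apply: is_derive_eq.
by rewrite /GRing.scale/=; ring.
Qed.

Lemma cone_value s : 0 < sg * s + q ->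
  dG s ^+ 2 * - (k * (4 / 3 * (3^-1 / cbrt (sg * s + q) ^+ 2 * sg) * sg)) =
  - (64 / 81 * k ^+ 3).
Proof.
move=> /cbrt_gt0 s0; rewrite /dG; set X := cbrt _ in s0 *.
have -> : - (64 / 81 * k ^+ 3) = - (64 / 81 * k ^+ 3) * (sg ^+ 2) ^+ 2.
  by rewrite sg2 expr1n mulr1.
field; rewrite gt_eqF//.
Qed.

Lemma cone_near s : 0 < sg * s + q -> exists2 p : R, 0 < p &
  forall t : R, `|t - s| < p -> is_derive t 1 G (dG t).
Proof.
move=> s0; exists (sg * s + q) => // t ts; apply: cone_derive.
have : `|sg * (t - s)| < sg * s + q.
  by rewrite normrM (_ : `|sg| = 1) ?mul1r// -sqrtr_sqr sg2 sqrtr1.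
rewrite ltr_norml; lra.
Qed.

End Cone.

Lemma web_c0_le k : 1 <= 64 / 81 * k ^+ 3 -> web_c0 <= k.
Proof.
move=> H; have := web_c0_cube; have := web_c0_gt0; set c := web_c0 => c0 c3.
rewrite leNgt; apply/negP => kc.
have [k0|k0] := leP 0 k.
  have : k ^+ 3 < c ^+ 3 by rewrite ltrXn2r.
  lra.
have : k ^+ 3 < 0 by rewrite exprn_odd_lt0.
lra.
Qed.

Lemma web_c0_ge k : 64 / 81 * k ^+ 3 <= 1 -> k <= web_c0.
Proof.
move=> H; have := web_c0_cube; have := web_c0_gt0; set c := web_c0 => c0 c3.
rewrite leNgt; apply/negP => kc.
have : c ^+ 3 < k ^+ 3 by rewrite ltrXn2r// ltW.
lra.
Qed.

End FourThirds.

Section ConeTests.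
Context {R : realType} {n : nat}.
Implicit Types (x y z v : 'rV[R]_n) (Om : set 'rV[R]_n) (u : 'rV[R]_n -> R).

(** By [cone_value], the radial test at [x0] reads [64 / 81 * k ^ 3 >= 1]. *)
Lemma super_cone_test Om u z x0 (k sg q r m : R) :
  convex_domain Om -> viscosity_supersolution Om u ->
  (forall x, Om x -> m <= u x) -> Om x0 -> 0 < enorm (x0 - z) -> 0 < r ->
  sg ^+ 2 = 1 -> 0 < sg * enorm (x0 - z) + q ->
  (forall x, Om x -> enorm (x - x0) < r ->
    u x0 - k * p43 (sg * enorm (x - z) + q) + k * p43 (sg * enorm (x0 - z) + q)
     <= u x) ->
  web_c0 <= k.
Proof.
move=> HO Hu um Ox0 r10 r0 sg2 s0 H; apply: web_c0_le.
have [p p0 Hp] := cone_near k sg2 s0.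
have := super_radial_test HO Hu um Ox0 r10 p0 r0 Hp (cone_derive2 k s0).
rewrite cone_value// lerN2; apply => x Ox xr.
by have := H x Ox xr; rewrite opprK.
Qed.

Lemma sub_cone_test Om u z x0 (k sg q r m : R) :
  convex_domain Om -> viscosity_subsolution Om u ->
  (forall x, Om x -> u x <= m) -> Om x0 -> 0 < enorm (x0 - z) -> 0 < r ->
  sg ^+ 2 = 1 -> 0 < sg * enorm (x0 - z) + q ->
  (forall x, Om x -> enorm (x - x0) < r ->
    u x <=
    u x0 - k * p43 (sg * enorm (x - z) + q) + k * p43 (sg * enorm (x0 - z) + q)) ->
  k <= web_c0.
Proof.
move=> HO Hu um Ox0 r10 r0 sg2 s0 H; apply: web_c0_ge.
have [p p0 Hp] := cone_near k sg2 s0.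
have := sub_radial_test HO Hu um Ox0 r10 p0 r0 Hp (cone_derive2 k s0).
rewrite cone_value// lerN2; apply => x Ox xr.
by have := H x Ox xr; rewrite opprK.
Qed.

End ConeTests.

(** * Comparison with cones *)


Section CompactPieces.
Context {R : realType} {n : nat} {Om : set 'rV[R]_n}.
Hypothesis HO : convex_domain Om.
Implicit Types (x y z v w : 'rV[R]_n).

Definition closure_ball z (r : R) : set 'rV[R]_n :=
  [set x | closure Om x /\ enorm (x - z) <= r].

Lemma closure_ball_compact z r : compact (closure_ball z r).
Proof.
have [B _ HB] := domain_bounded HO.
apply: (@closed_bounded_compact _ _ _ B); last by move=> x [/HB].
move=> x /closure_enormP Hx; split.
  apply/closure_enormP => e e0; have e2 : 0 < e / 2 by exact: divr_gt0.
  have [y [/closure_enormP cy _] yx] := Hx _ e2; have [y' Oy' yy'] := cy _ e2.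
  by exists y' => //; have := enormB_trans y y' x; lra.
apply/ler_addgt0Pr => e e0.
have [y [_ yz] yx] := Hx _ e0.
by have := enormB_trans y x z; rewrite (edistC x y); lra.
Qed.

Lemma closure_ball_max z r (f : 'rV[R]_n -> R) : closure_ball z r !=set0 ->
  {within closure Om, continuous f} ->
  exists2 x, closure_ball z r x & forall y, closure_ball z r y -> f y <= f x.
Proof.
move=> K0 /within_cont_enormP cf.
have cK : {within closure_ball z r, continuous f}.
  apply/within_cont_enormP => x [cx _] e e0; have [q q0 H] := cf x cx e e0.
  by exists q => // y [cy _]; exact: H.
have [x xK H] := compact_EVT_max K0 (@closure_ball_compact z r) cK.
by exists x; [exact: set_mem|move=> y Ky; exact/H/mem_set].
Qed.

Lemma closure_ball_min z r (f : 'rV[R]_n -> R) : closure_ball z r !=set0 ->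
  {within closure Om, continuous f} ->
  exists2 x, closure_ball z r x & forall y, closure_ball z r y -> f x <= f y.
Proof.
move=> K0 cf.
have [|x Kx H] := @closure_ball_max z r (fun x => - f x) K0.
  by move=> x; apply: continuousN; exact: cf.
by exists x => // y Ky; have := H y Ky; rewrite lerN2.
Qed.

Lemma radial_continuous (A : set 'rV[R]_n) z (h : R -> R) :
  (forall s e : R, 0 <= s -> 0 < e -> exists2 r : R, 0 < r &
    forall t, 0 <= t -> `|t - s| < r -> `|h t - h s| < e) ->
  {within A, continuous (fun x => h (enorm (x - z)))}.
Proof.
move=> ch; apply/within_cont_enormP => x _ e e0.
have [r r0 H] := ch _ e (enorm_ge0 (x - z)) e0.
exists r => // y _ yx; apply: H; first exact: enorm_ge0.
apply: le_lt_trans yx; rewrite ler_norml; apply/andP; split.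
  by have := enormB_trans y x z; rewrite (edistC x y); lra.
by have := enormB_trans x y z; lra.
Qed.

End CompactPieces.

Section Solution.
Context {R : realType} {n : nat} {Om : set 'rV[R]_n}.
Hypothesis HO : convex_domain Om.
Variables (c : R) (u : 'rV[R]_n -> R) (g : 'rV[R]_n -> 'rV[R]_n).
Hypothesis Hsub : viscosity_subsolution Om u.
Hypothesis Hsup : viscosity_supersolution Om u.
Hypothesis ub : forall x, boundary Om x -> u x = 0.
Hypothesis HC : C1_closure Om u g.
Hypothesis gc : forall x, boundary Om x -> enorm (g x) = c.
Implicit Types (x y z v w : 'rV[R]_n).
Local Notation d := (bdist Om).
Local Notation c0 := (web_c0 : R).

Lemma sol_cont : {within closure Om, continuous u}.
Proof. by case: HC. Qed.

Lemma sol_derive x v : Om x -> is_derive x v u (dot (g x) v).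
Proof.
case: HC => C1 _ _ gE Ox; rewrite gE//; apply: C1_is_derive Ox => //.
by case: HO.
Qed.

Lemma closure_nonempty : closure Om !=set0.
Proof. by case: HO => _ [x Ox] _ _ _; exists x; exact: domain_closure. Qed.

Lemma sol_le_max : exists m, forall x, closure Om x -> u x <= m.
Proof.
have [x _ H] := compact_EVT_max closure_nonempty (closure_compact HO) sol_cont.
by exists (u x) => y cy; exact/H/mem_set.
Qed.

(** A constant touching from below at an interior minimum has vanishing infinity
    Laplacian, which a supersolution forbids. *)
Lemma sol_ge0 x : closure Om x -> 0 <= u x.
Proof.
move=> cx.
have [y /set_mem cy H] := compact_EVT_min closure_nonempty (closure_compact HO) sol_cont.
apply: le_trans (H x (mem_set cx)).
have [Oy|/ub ->//] := closure_split HO cy.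
have := @super_poly_test _ _ Om u y y 0 0 1 (u y) HO Hsup _ Oy ltr01.
rewrite expr0n !(mulr0, mul0r) => /(_ _ _) H'.
have : (0 : R) <= -1.
  by apply: H' => z Oz *; rewrite ?mul0r ?addr0; apply/H/mem_set/domain_closure.
by rewrite ler0N1.
Qed.

Lemma sol_grad_cont w : {within closure Om, continuous (fun x => dot w (g x))}.
Proof.
case: HC => _ _ cg _ => x.
apply: (@continuous_comp (subspace (closure Om)) _ _ g (dot w) x); first exact: cg.
exact: dot_continuous.
Qed.

(** The mean value theorem on the segment from [y] into the inscribed ball, with
    the gradient continuous up to the boundary. *)
Lemma sol_foot_expand x y w e : Om x -> boundary Om y -> enorm (x - y) = d x ->
  0 < dot w (x - y) -> 0 < e -> exists2 s : R, 0 < s &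
  forall t : R, 0 < t < s -> `|u (y + t *: w) - t * dot w (g y)| <= e * t.
Proof.
move=> Ox By xy wxy e0; have [s s0 Hs] := foot_cone HO Ox xy wxy.
have cy : closure Om y by case/(boundaryE HO): By.
have [r r0 Hr] := (within_cont_enormP _ _).1 (@sol_grad_cont w) y cy e e0.
have w0 : 0 < enorm w + 1 by rewrite ltr_wpDl// enorm_ge0.
exists (Num.min s (r / (enorm w + 1))); first by rewrite lt_min s0 divr_gt0.
move=> t; rewrite lt_min ltr_pdivlMr// => /andP[t0 /andP[ts tr]].
pose f a := u (y + a *: w).
have Of a : 0 < a <= t -> Om (y + a *: w).
  by move=> /andP[a0 at']; apply: Hs; rewrite a0 (le_lt_trans at' ts).
have D (a : R) : a \in `]0, t[%R -> is_derive a 1 f (dot w (g (y + a *: w))).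
  rewrite in_itv/= => /andP[a0 at']; rewrite dotC.
  have := (is_derive_line u y w a (dot (g (y + a *: w)) w)).1; apply.
  by apply: sol_derive; apply: Of; rewrite a0 ltW.
have cf : {within `[0, t], continuous f}.
  have dist a b : enorm (y + a *: w - (y + b *: w)) = `|a - b| * enorm w.
    by rewrite opprD addrACA subrr add0r -scalerBl enormZ.
  apply/subspace_continuousP => a /=; rewrite in_itv/= => /andP[a0 at'].
  have ca b : 0 <= b <= t -> closure Om (y + b *: w).
    move=> /andP[]; rewrite le_eqVlt => /orP[/eqP <- _|b0 bt].
      by rewrite scale0r addr0.
    by apply/domain_closure/Of; rewrite b0.
  apply/cvgrPdist_lt => q q0; rewrite near_withinE.
  have [|p p0 Hp] := (within_cont_enormP _ _).1 sol_cont (y + a *: w) _ q q0.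
    by apply: ca; rewrite a0.
  apply/nbhs_ballP; exists (p / (enorm w + 1)); first exact: divr_gt0.
  move=> b; rewrite -ball_normE /ball_/= ltr_pdivlMr// => bp.
  rewrite in_itv/= => b0; rewrite distrC; apply: Hp; first exact: ca.
  by rewrite dist distrC; apply: le_lt_trans bp; rewrite ler_wpM2l// lerDl.
have [a /[dup] aI] := MVT t0 D cf.
rewrite in_itv/= subr0 => /andP[a0 at'].
rewrite {2}/f scale0r addr0 ub// subr0 /f => ->.
rewrite (mulrC t) -mulrBl normrM (gtr0_norm t0) ler_wpM2r ?(ltW t0)// ltW//.
apply: Hr; first by apply/domain_closure/Of; rewrite a0 ltW.
rewrite addrC addKr enormZ gtr0_norm//.
apply: lt_trans tr; apply: (@le_lt_trans _ _ (t * enorm w)).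
  by rewrite ler_wpM2r ?enorm_ge0// ltW.
by rewrite ltr_pM2l// ltrDl.
Qed.

(** As [u >= 0] on the inscribed ball and [u] vanishes at [y], the gradient at
    [y] has nonnegative products with all directions entering the ball, so it is
    a nonnegative multiple of the inner normal. *)
Lemma sol_foot_grad x y : Om x -> boundary Om y -> enorm (x - y) = d x ->
  dot (x - y) (g y) = c * d x.
Proof.
move=> Ox By xy; have dx := bdist_gt0 HO Ox.
have pos w : 0 < dot w (x - y) -> 0 <= dot w (g y).
  move=> wxy; rewrite leNgt; apply/negP => neg.
  have e0 : 0 < - dot w (g y) / 2 by rewrite divr_gt0// oppr_gt0.
  have [s s0 Hs] := sol_foot_expand Ox By xy wxy e0.
  have [r r0 Hr] := foot_cone HO Ox xy wxy.
  pose t := Num.min s r / 2.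
  have m0 : 0 < Num.min s r by rewrite lt_min s0.
  have t0 : 0 < t by rewrite divr_gt0.
  have tm : t < Num.min s r by rewrite ltr_pdivrMr// ltr_pMr// ltr1n.
  have ts : 0 < t < s by rewrite t0 (lt_le_trans tm)// ge_min lexx.
  have tr : 0 < t < r by rewrite t0 (lt_le_trans tm)// ge_min lexx orbT.
  have := Hs t ts; have := sol_ge0 (domain_closure (Hr t tr)).
  rewrite ler_norml => u0 /andP[_].
  have : t * dot w (g y) < 0 by rewrite pmulr_rlt0.
  lra.
pose p := x - y; pose G := g y.
have pp : 0 < dot p p by rewrite -enorm_sqr /p xy exprn_gt0.
have G0 : 0 <= dot p G by apply: pos.
(* the part of the gradient orthogonal to the normal *)
pose w := (dot p G / dot p p) *: p - G.
have wp : dot w p = 0.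
  by rewrite /w dotDl dotNl dotZl divfK ?gt_eqF// (dotC G) subrr.
have wG : 0 <= dot w G.
  apply/ler_addgt0Pr => e e0.
  have k0 : 0 < e / (dot p G + 1) by rewrite divr_gt0// ltr_wpDl.
  have := pos (w + (e / (dot p G + 1)) *: p).
  rewrite -/p dotDl dotZl wp add0r mulr_gt0// => /(_ isT).
  rewrite dotDl dotZl -/G => H; apply: (le_trans H); rewrite lerD2l.
  by rewrite mulrAC ler_pdivrMr ?ltr_wpDl// ler_wpM2l ?(ltW e0)// lerDl.
have w0 : w = 0.
  apply: dot_eq0; apply/eqP; rewrite eq_le dot_ge0 andbT.
  have -> : dot w w = - dot w G.
    by rewrite {2}/w dotDr dotNr dotZr wp mulr0 add0r.
  by rewrite oppr_le0.
have GE : G = (dot p G / dot p p) *: p.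
  by apply/eqP; rewrite eq_sym -subr_eq0 -/w w0.
have NG : enorm G = dot p G / dot p p * enorm p.
  by rewrite {1}GE enormZ ger0_norm// divr_ge0// dot_ge0.
rewrite -xy -(gc By) -/p -/G NG -mulrA -expr2 enorm_sqr divfK// gt_eqF//.
Qed.

(** By [sol_foot_grad], [u] leaves the foot [y] of [x] with slope [c] along the
    inner normal, so that a barrier below [u] has slope at most [c] there. The
    term [t ^ 2] leaves room for the curvature of the barrier, see
    [p43_slope]. *)
Lemma slope_lower x y (L s : R) : Om x -> boundary Om y -> enorm (x - y) = d x ->
  0 < s -> (forall t : R, 0 < t < s -> L * (t - t ^+ 2) <= u (y + t *: (x - y))) ->
  L <= c * d x.
Proof.
move=> Ox By xy s0 H; rewrite leNgt; apply/negP => cL.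
have pp : 0 < dot (x - y) (x - y).
  by rewrite -enorm_sqr xy exprn_gt0// bdist_gt0.
pose e := (L - c * d x) / 2; have e0 : 0 < e by rewrite divr_gt0// subr_gt0.
have [r r0 Hr] := sol_foot_expand Ox By xy pp e0.
have L0 : 0 < `|L| + 1 by rewrite ltr_wpDl.
pose m := Num.min (Num.min s r) (e / (`|L| + 1)).
have m0 : 0 < m by rewrite !lt_min s0 r0 divr_gt0.
pose t := m / 2.
have t0 : 0 < t by rewrite divr_gt0.
have : t < m by rewrite ltr_pdivrMr// ltr_pMr// ltr1n.
rewrite !lt_min ltr_pdivlMr// => /andP[/andP[ts tr] te].
have := H t; rewrite t0 ts => /(_ isT).
have := Hr t; rewrite t0 tr => /(_ isT).
rewrite sol_foot_grad// ler_norml => /andP[_ H1] H2.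
have H3 : t * (L - t * L) <= t * (c * d x + e) by lra.
rewrite ler_pM2l// in H3.
have : t * L <= t * (`|L| + 1).
  by rewrite ler_pM2l// (le_trans (ler_norm L))// lerDl.
move: H3 te; rewrite /e; lra.
Qed.

Lemma slope_upper x y (L s : R) : Om x -> boundary Om y -> enorm (x - y) = d x ->
  0 < s -> (forall t : R, 0 < t < s -> u (y + t *: (x - y)) <= L * t) ->
  c * d x <= L.
Proof.
move=> Ox By xy s0 H; apply/ler_addgt0Pr => e e0.
have pp : 0 < dot (x - y) (x - y).
  by rewrite -enorm_sqr xy exprn_gt0// bdist_gt0.
have [r r0 Hr] := sol_foot_expand Ox By xy pp e0.
have m0 : 0 < Num.min s r by rewrite lt_min s0.
pose t := Num.min s r / 2.
have t0 : 0 < t by rewrite divr_gt0.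
have : t < Num.min s r by rewrite ltr_pdivrMr// ltr_pMr// ltr1n.
rewrite lt_min => /andP[ts tr].
have := H t; rewrite t0 ts => /(_ isT).
have := Hr t; rewrite t0 tr => /(_ isT).
rewrite sol_foot_grad// ler_norml => /andP[H1 _] H2.
have H3 : t * (c * d x) <= t * (L + e) by lra.
by rewrite ler_pM2l// in H3.
Qed.

Lemma foot_line x y (t : R) : enorm (x - y) = d x -> 0 <= t <= 1 ->
  enorm (y + t *: (x - y) - x) = (1 - t) * d x /\
  enorm (y + t *: (x - y) - y) = t * d x.
Proof.
move=> xy /andP[t0 t1]; split.
  have -> : y + t *: (x - y) - x = - ((1 - t) *: (x - y)).
    by apply/rowP => i; rewrite !mxE; ring.
  by rewrite enormN enormZ ger0_norm ?subr_ge0// xy.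
by rewrite addrC addKr enormZ ger0_norm// xy.
Qed.

(** A negative minimum of the difference would be an interior contact point, and
    the vertex [z] is ruled out either because the cone lies below [u] there or,
    for a cone with horizontal tangent at its vertex, by a nonzero gradient of
    [u]. *)
Lemma super_compare z (k q : R) : Om z -> 0 < k -> k < c0 -> 0 <= q ->
  (q = 0 /\ exists v, dot (g z) v != 0) \/ k * (p43 (d z + q) - p43 q) <= u z ->
  forall x, closure Om x -> enorm (x - z) <= d z ->
    k * (p43 (d z + q) - p43 (enorm (x - z) + q)) <= u x.
Proof.
move=> Oz k0 kc q0 center.
pose A := k * p43 (d z + q).
pose f x := u x + k * p43 (enorm (x - z) + q).
have cf : {within closure Om, continuous f}.
  apply: within_contD; first exact: sol_cont.
  apply: (@radial_continuous _ _ (closure Om) z (fun s => k * p43 (s + q))) => s e s0 e0.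
  have [r r0 Hr] := p43_cont (addr_ge0 s0 q0) (divr_gt0 e0 k0).
  exists r => // t t0 ts; rewrite -mulrBr normrM gtr0_norm// mulrC -ltr_pdivlMr//.
  by apply: Hr; [exact: addr_ge0|rewrite opprD addrACA subrr addr0].
have K0 : closure_ball (Om := Om) z (d z) !=set0.
  by exists z; split; [exact: domain_closure|rewrite subrr enorm0 bdist_ge0].
have [x0 [cx0 x0z] Hmin] := closure_ball_min HO K0 cf.
suff fx0 : A <= f x0.
  move=> x cx xz; have := Hmin x (conj cx xz); rewrite mulrBr -/A /f.
  by move: fx0; rewrite /f; lra.
move: x0z; rewrite le_eqVlt => /orP[/eqP x0z|x0z].
  by rewrite /f x0z lerDr sol_ge0.
have Ox0 : Om x0 by apply: bdist_ball x0z.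
rewrite leNgt; apply/negP => neg.
have near x : Om x -> enorm (x - x0) < d z - enorm (x0 - z) -> f x0 <= f x.
  move=> Ox xr; apply: Hmin; split; first exact: domain_closure.
  by have := enormB_trans x0 x z; lra.
have rho0 : 0 < d z - enorm (x0 - z) by rewrite subr_gt0.
have [x0z0|x0z0] := eqVneq x0 z; last first.
  have r0 : 0 < enorm (x0 - z) by rewrite enorm_gt0// subr_eq0.
  suff : c0 <= k by rewrite leNgt kc.
  apply: (@super_cone_test _ _ Om u z x0 k 1 q (d z - enorm (x0 - z)) 0) => //.
  - by move=> x Ox; exact/sol_ge0/domain_closure.
  - by rewrite expr1n.
  - by rewrite mul1r ltr_pwDl.
  by move=> x Ox xr; have := near x Ox xr; rewrite /f !mul1r; lra.
case: center => [[q00 [v gv]]|].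
  have [w gw] : exists w, dot (g z) w < 0.
    have [lt|] := ltP (dot (g z) v) 0; first by exists v.
    by rewrite le_eqVlt eq_sym (negbTE gv)/= => gt; exists (- v); rewrite dotNr oppr_lt0.
  have e0 : 0 < - dot (g z) w / 2 by rewrite divr_gt0// oppr_gt0.
  have [r r0 Hr] := (is_derive_epsP _ _ _ _).1 (sol_derive w Oz) _ e0.
  have w0 : 0 < enorm w + 1 by rewrite ltr_wpDl// enorm_ge0.
  (* at distance t |w| from its vertex the cone has descended by o(t) only,
     whereas u descends linearly in the direction w *)
  have b0 : 0 < k * (enorm w + 1) by exact: mulr_gt0.
  pose l := - dot (g z) w / 2 / (k * (enorm w + 1)) / 2.
  have l0 : 0 < l by do 2 (apply: divr_gt0 => //).
  have [s s0 Hs] : exists2 s, 0 < s & cbrt (s * (enorm w + 1)) <= l.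
    exists (l ^+ 3 / (enorm w + 1)); first by rewrite divr_gt0// exprn_gt0.
    by rewrite divfK ?gt_eqF// cbrt_cube// ltW.
  pose m := Num.min (Num.min r s) (d z / (enorm w + 1)).
  have dz := bdist_gt0 HO Oz.
  have m0 : 0 < m by rewrite !lt_min r0 s0 divr_gt0.
  have t0 : 0 < m / 2 by rewrite divr_gt0.
  have : m / 2 < m by rewrite ltr_pdivrMr// ltr_pMr// ltr1n.
  move: (m / 2) t0 => t t0.
  rewrite !lt_min ltr_pdivlMr// => /andP[/andP[tr ts] td].
  have tw : t * enorm w <= t * (enorm w + 1) by rewrite ler_pM2l// lerDl.
  have E : enorm (z + t *: w - z) = t * enorm w.
    by rewrite addrC addKr enormZ gtr0_norm.
  have Ot : Om (z + t *: w).
    by apply: (bdist_ball HO Oz); rewrite E; exact: le_lt_trans td.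
  have := near (z + t *: w) Ot; rewrite x0z0 subrr enorm0 E subr0.
  rewrite (le_lt_trans tw td) => /(_ isT); rewrite /f subrr enorm0 E q00 !addr0 p43_0.
  have : p43 (t * enorm w) <= t * (enorm w + 1) * cbrt (s * (enorm w + 1)).
    apply: (@le_trans _ _ (p43 (t * (enorm w + 1)))).
      by apply: p43_le => //; rewrite mulr_ge0 ?enorm_ge0// ltW.
    rewrite p43E exprSr cbrtK; last by rewrite ltW// mulr_gt0.
    rewrite ler_pM2l ?mulr_gt0//; apply: cbrt_le.
      by rewrite ltW// mulr_gt0.
    by rewrite ler_pM2r// ltW.
  have := Hr t; rewrite gtr0_norm// => /(_ tr); rewrite ler_norml => /andP[_ H1] H2.
  have H3 : k * p43 (t * enorm w) <= - dot (g z) w / 2 / 2 * t.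
    apply: (@le_trans _ _ (k * (t * (enorm w + 1) * l))).
      rewrite ler_pM2l//; apply: (le_trans H2); rewrite ler_pM2l//.
      exact: mulr_gt0.
    by rewrite le_eqVlt; apply/orP; left; apply/eqP; rewrite /l; field; rewrite !gt_eqF.
  have : t * dot (g z) w < 0 by rewrite pmulr_rlt0.
  rewrite mulr0 addr0; lra.
move: neg; rewrite x0z0 /f /A subrr enorm0 add0r; lra.
Qed.

Lemma bdist_near z (e : R) : 0 < e -> exists2 r : R, 0 < r &
  forall x, enorm (x - z) < r -> `|p43 (d x) - p43 (d z)| < e.
Proof.
move=> e0; have [r r0 Hr] := p43_cont (bdist_ge0 HO z) e0.
exists r => // x xz; apply: Hr; first exact: bdist_ge0.
exact: le_lt_trans (bdist_norm HO _ _) xz.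
Qed.

Lemma edist_near x z (e : R) : 0 < e -> exists2 r : R, 0 < r &
  forall y, enorm (y - z) < r -> `|p43 (enorm (x - y)) - p43 (enorm (x - z))| < e.
Proof.
move=> e0; have [r r0 Hr] := p43_cont (enorm_ge0 (x - z)) e0.
exists r => // y yz; apply: Hr; first exact: enorm_ge0.
apply: le_lt_trans yz; rewrite ler_norml; apply/andP; split.
  by have := enormB_trans y x z; lra.
by have := enormB_trans z x y; rewrite (edistC z y); lra.
Qed.

(** If the bound failed at [z] it would fail for all nearby centres; the
    gradient of [u] would vanish at all of them, and a locally constant function
    is not a supersolution. *)
Lemma sol_lower z x : Om z -> closure Om x ->
  c0 * (p43 (d z) - p43 (enorm (x - z))) <= u x.
Proof.
move=> Oz cx; rewrite leNgt; apply/negP => neg.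
have ux := sol_ge0 cx; have c0p : 0 < c0 := web_c0_gt0.
set P := p43 (d z) - p43 (enorm (x - z)) in neg.
have P0 : 0 < P by rewrite -(pmulr_rgt0 _ c0p); exact: le_lt_trans neg.
pose k := (c0 + u x / P) / 2.
have kc : k < c0.
  by rewrite /k ltr_pdivrMr// mulr_natr mulr2n ltrD2l ltr_pdivrMr.
have k0 : 0 < k by rewrite divr_gt0// ltr_pwDl// divr_ge0// ltW.
have kP : u x < k * P.
  have : u x / P * P = u x by rewrite divfK// gt_eqF.
  by rewrite /k; lra.
pose e := (k * P - u x) / (k * 2).
have k2 : 0 < k * 2 by rewrite mulr_gt0.
have e0 : 0 < e by rewrite divr_gt0// subr_gt0.
have ek : k * (2 * e) = k * P - u x by rewrite /e; field; rewrite gt_eqF.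
have [r1 r10 H1] := bdist_near z e0; have [r2 r20 H2] := edist_near x z e0.
have [r3 r30 H3] := domain_ball HO Oz.
pose r := Num.min (Num.min r1 r2) r3.
have r0 : 0 < r by rewrite !lt_min r10 r20.
have grad0 y v : enorm (y - z) < r -> dot (g y) v = 0.
  rewrite !lt_min => /andP[/andP[y1 y2] y3]; apply/eqP; apply: contrapT => /negP gv.
  have Oy := H3 y y3.
  have lt : u x < k * (p43 (d y) - p43 (enorm (x - y))).
    have A : P - 2 * e < p43 (d y) - p43 (enorm (x - y)).
      have := H1 y y1; have := H2 y y2.
      by rewrite !ltr_norml /P => /andP[_ ?] /andP[? _]; lra.
    by have := A; rewrite -(ltr_pM2l k0) mulrBr ek; lra.
  have [xy|/ltW xy] := leP (enorm (x - y)) (d y).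
    have := super_compare Oy k0 kc (lexx 0) (or_introl (conj erefl (ex_intro _ v gv))) cx xy.
    by rewrite !addr0; lra.
  have := p43_le (bdist_ge0 HO y) xy.
  rewrite -subr_le0 -(pmulr_rle0 _ k0); lra.
have cst y : enorm (y - z) < r -> u y = u z.
  move=> yz.
  have D (s : R) : `|s| <= `|1 : R| ->
      is_derive s 1 (fun s : R => u (z + s *: (y - z))) (dot (g (z + s *: (y - z))) (y - z)).
    rewrite normr1 => s1.
    have sr : enorm (z + s *: (y - z) - z) < r.
      rewrite addrC addKr enormZ; apply: le_lt_trans yz.
      by rewrite ler_piMl// enorm_ge0.
    have := (is_derive_line u z (y - z) s (dot (g (z + s *: (y - z))) (y - z))).1.
    apply; apply: sol_derive; apply: H3; apply: (lt_le_trans sr).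
    by rewrite !ge_min lexx orbT.
  have [s s1] := MVT0 D.
  rewrite scale1r scale0r addr0 (addrC z) subrK grad0 ?mul0r.
    by move/eqP; rewrite subr_eq0 => /eqP.
  rewrite addrC addKr enormZ; apply: le_lt_trans yz.
  by rewrite ler_piMl ?enorm_ge0//; rewrite normr1 in s1.
have u0 y : Om y -> 0 <= u y by move=> Oy; exact/sol_ge0/domain_closure.
have := @super_poly_test _ _ Om u z z 0 0 r 0 HO Hsup u0 Oz r0.
rewrite !(mulr0, mul0r, expr0n) => H.
have : (0 : R) <= -1.
  by apply: H => y Oy yz; rewrite !mul0r !addr0 cst.
by rewrite ler0N1.
Qed.

Lemma sol_const_ge0 : 0 <= c.
Proof. by have [y By] := boundary_nonempty HO; rewrite -(gc By) enorm_ge0. Qed.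

Local Notation a := (c ^+ 3 / 3).

(** The critical cone vanishing at distance [a] from its vertex has slope [c]
    there. *)
Lemma cbrt_a : 4 / 3 * c0 * cbrt a = c.
Proof.
have a0 : 0 <= a by rewrite divr_ge0// exprn_ge0// sol_const_ge0.
rewrite web_c0_slope; apply: (@pexpIrn _ 3) => //.
- by rewrite nnegrE mulr_ge0// cbrt_ge0.
- by rewrite nnegrE sol_const_ge0.
by rewrite exprMn !cbrtK// mulrC divfK.
Qed.

(** The cone of [sol_lower] centred at [z] would otherwise be steeper than [c] at
    the foot of [z]. *)
Lemma sol_bdist_le z : Om z -> d z <= a.
Proof.
move=> Oz; have [y By zy] := bdist_foot HO z.
have dz := bdist_gt0 HO Oz; have c0p : 0 < c0 := web_c0_gt0.
have cc := sol_const_ge0.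
have : c0 * (4 / 3 * cbrt (d z) * d z) <= c * d z.
  apply: (slope_lower Oz By zy ltr01) => t /[dup] t01 /andP[t0 t1].
  have cx : closure Om (y + t *: (z - y)).
    apply: closure_convex => //; last by rewrite !ltW.
      by case/(boundaryE HO): By.
    exact: domain_closure.
  apply: le_trans (sol_lower Oz cx).
  have [|-> _] := @foot_line z y t zy; first by rewrite !ltW.
  rewrite -mulrA ler_pM2l//.
  by have := p43_slope (ltW dz) (lexx 0) t01; rewrite !addr0.
rewrite mulrA ler_pM2r// => H.
have : (cbrt 3 * cbrt (d z)) ^+ 3 <= c ^+ 3.
  rewrite lerXn2r ?nnegrE ?mulr_ge0 ?cbrt_ge0//.
  by apply: le_trans H; rewrite mulrA (mulrC c0) web_c0_slope.
by rewrite exprMn !cbrtK ?(ltW dz)// ler_pdivlMr// mulrC.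
Qed.

Lemma sol_a_gt0 : 0 < a.
Proof.
case: (HO) => _ [z Oz] _ _ _.
exact: lt_le_trans (bdist_gt0 HO Oz) (sol_bdist_le Oz).
Qed.


(** If [u] exceeded the bound at [e], a cone with vertex [e], vanishing on the
    inscribed sphere and with slope larger than [c] there, would still lie below
    [u] at the vertex, hence on the whole ball: the slope of [u] at the foot of
    [e] would exceed [c]. *)
Lemma sol_upper e : Om e -> u e <= c0 * (p43 a - p43 (a - d e)).
Proof.
move=> Oe; rewrite leNgt; apply/negP => neg.
have [y By ey] := bdist_foot HO e.
have de := bdist_gt0 HO Oe; have da := sol_bdist_le Oe.
have c0p : 0 < c0 := web_c0_gt0; have a0 := sol_a_gt0.
pose h := (u e - c0 * (p43 a - p43 (a - d e))) / c0.
have h0 : 0 < h by rewrite divr_gt0// subr_gt0.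
have [r r0 Hr] := p43_cont (ltW a0) h0.
pose eta := r / 2; have eta0 : 0 < eta by rewrite divr_gt0.
have ha : p43 (a + eta) < p43 a + h.
  have := Hr (a + eta); rewrite addrAC subrr add0r gtr0_norm//.
  rewrite ltr_pdivrMr// ltr_pMr// ltr1n => /(_ _ isT).
  rewrite ltr_norml => /(_ _)/andP[|_]; first by rewrite ltW// addr_gt0.
  by rewrite ltrBlDl.
pose q := a + eta - d e.
have q0 : 0 < q by rewrite subr_gt0 ltr_pwDr.
pose l := cbrt a / cbrt (a + eta).
have ae0 : 0 < cbrt (a + eta) by rewrite cbrt_gt0// addr_gt0.
have l1 : l < 1 by rewrite ltr_pdivrMr// mul1r cbrt_lt ?(ltW a0)// ltrDl.
have l0 : 0 < l by rewrite divr_gt0// cbrt_gt0.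
pose k := c0 * ((1 + l) / 2).
have k0 : 0 < k by rewrite mulr_gt0// divr_gt0// addr_gt0.
have kc : k < c0 by rewrite /k gtr_pMr// ltr_pdivrMr// mul1r -[2]/(1 + 1) ltrD2l.
have dq : d e + q = a + eta by rewrite /q addrC subrK.
have center : k * (p43 (d e + q) - p43 q) <= u e.
  rewrite dq.
  have q1 : p43 (a - d e) <= p43 q.
    by apply: p43_le; rewrite ?subr_ge0// /q lerD2r lerDl ltW.
  have q2 : p43 q <= p43 (a + eta).
    by apply: p43_le; [exact: ltW|rewrite /q gerBl ltW].
  apply: (@le_trans _ _ (c0 * (p43 (a + eta) - p43 q))).
    by rewrite ler_wpM2r ?subr_ge0// ltW.
  apply: (@le_trans _ _ (c0 * (p43 a + h - p43 (a - d e)))).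
    by rewrite ler_pM2l//; lra.
  rewrite le_eqVlt; apply/orP; left; apply/eqP; rewrite /h; field.
  by rewrite gt_eqF.
have Hc := super_compare Oe k0 kc (ltW q0) (or_intror center).
have : k * (4 / 3 * cbrt (d e + q) * d e) <= c * d e.
  apply: (slope_lower Oe By ey ltr01) => t /[dup] t01 /andP[t0 t1].
  have [|E1 _] := @foot_line e y t ey; first by rewrite !ltW.
  have cx : closure Om (y + t *: (e - y)).
    apply: closure_convex => //; last by rewrite !ltW.
      by case/(boundaryE HO): By.
    exact: domain_closure.
  have te : (1 - t) * d e <= d e.
    by rewrite ler_piMl ?gerBl ?(ltW t0)// ltW.
  have := Hc _ cx; rewrite E1 => /(_ te); apply: le_trans; rewrite -mulrA ler_pM2l//.
  exact: p43_slope (ltW de) (ltW q0) t01.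
rewrite mulrA ler_pM2r// dq leNgt => /negP; apply.
rewrite -{1}cbrt_a.
have -> : cbrt a = l * cbrt (a + eta) by rewrite divfK// gt_eqF.
have : c0 * l < k.
  by rewrite /k ltr_pM2l// ltr_pdivlMr// mulr_natr mulr2n ltrD2r.
rewrite -(ltr_pM2r ae0); lra.
Qed.

(** A positive maximum of the difference can lie neither on the sphere, by
    assumption, nor on the boundary, where [u] vanishes and the cone is
    nonnegative, nor inside, by [sub_cone_test]. *)
Lemma sub_compare y (k r0 : R) : boundary Om y -> 0 < r0 -> c0 < k ->
  (forall x, closure Om x -> enorm (x - y) <= r0 -> u x < k * p43 r0) ->
  forall x, closure Om x -> enorm (x - y) <= r0 ->
    u x <= k * (p43 r0 - p43 (r0 - enorm (x - y))).
Proof.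
move=> By r00 kc H.
have k0 : 0 < k := lt_trans web_c0_gt0 kc.
pose f x := u x + k * p43 `|r0 - enorm (x - y)|.
have cf : {within closure Om, continuous f}.
  apply: within_contD; first exact: sol_cont.
  apply: (@radial_continuous _ _ (closure Om) y (fun s => k * p43 `|r0 - s|)) => s e s0 e0.
  have [r r1 Hr] := p43_cont (normr_ge0 (r0 - s)) (divr_gt0 e0 k0).
  exists r => // t t0 ts; rewrite -mulrBr normrM gtr0_norm// mulrC -ltr_pdivlMr//.
  apply: Hr => //; apply: le_lt_trans ts; apply: (le_trans (ler_dist_dist _ _)).
  by rewrite opprD addrACA subrr add0r opprK addrC distrC.
have K0 : closure_ball (Om := Om) y r0 !=set0.
  exists y; split; first by case/(boundaryE HO): By.
  by rewrite subrr enorm0 ltW.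
have [x0 [cx0 x0y] Hmax] := closure_ball_max HO K0 cf.
suff fx0 : f x0 <= k * p43 r0.
  move=> x cx xy; have := Hmax x (conj cx xy); rewrite /f.
  by rewrite (@ger0_norm _ (r0 - enorm (x - y))) ?subr_ge0//; move: fx0; rewrite /f; lra.
have fE : f x0 = u x0 + k * p43 (r0 - enorm (x0 - y)).
  by rewrite /f ger0_norm// subr_ge0.
rewrite leNgt; apply/negP => neg.
have lt : enorm (x0 - y) < r0.
  rewrite lt_neqAle x0y andbT; apply/eqP => E.
  by move: neg; rewrite fE E subrr p43_0 mulr0 addr0 ltNge ltW// H.
have Ox0 : Om x0.
  have [//|Bx0] := closure_split HO cx0.
  move: neg; rewrite fE ub// add0r ltr_pM2l// ltNge p43_le ?subr_ge0//.
  by rewrite gerBl enorm_ge0.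
have pos : 0 < enorm (x0 - y).
  apply: enorm_gt0; rewrite subr_eq0; apply/eqP => E.
  by case/(boundaryE HO): By => _; rewrite -E.
have [m Hm] := sol_le_max.
suff : k <= c0 by rewrite leNgt kc.
apply: (@sub_cone_test _ _ Om u y x0 k (-1) r0 (r0 - enorm (x0 - y)) m) => //.
- by move=> x Ox; exact/Hm/domain_closure.
- by rewrite subr_gt0.
- by rewrite sqrrN expr1n.
- by rewrite mulN1r addrC subr_gt0.
move=> x Ox xr.
have xy : enorm (x - y) <= r0 by have := enormB_trans x0 x y; lra.
have := Hmax x (conj (domain_closure Ox) xy); rewrite fE /f.
rewrite (@ger0_norm _ (r0 - enorm (x - y))) ?subr_ge0// !mulN1r.
by rewrite !(addrC _ r0); lra.
Qed.

(** For every radius less than [a] such a point exists, since otherwise [u] would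
    stay below a cone with slope less than [c] at its vertex [y]; compactness
    yields the radius [a]. *)
Lemma sol_reach x y : Om x -> boundary Om y -> enorm (x - y) = d x ->
  exists e, [/\ closure Om e, enorm (e - y) <= a & c0 * p43 a <= u e].
Proof.
move=> Ox By xy; have c0p : 0 < c0 := web_c0_gt0; have a0 := sol_a_gt0.
have dx := bdist_gt0 HO Ox.
have step r0 : 0 < r0 -> r0 < a ->
    exists x, [/\ closure Om x, enorm (x - y) <= r0 & c0 * p43 r0 <= u x].
  move=> r00 ra; apply: contrapT => no.
  have cr0 : 0 < cbrt r0 by exact: cbrt_gt0.
  pose l := cbrt a / cbrt r0.
  have l1 : 1 < l by rewrite ltr_pdivlMr// mul1r cbrt_lt// ltW.
  pose k := c0 * ((1 + l) / 2).
  have kc : c0 < k by rewrite /k ltr_pMr// ltr_pdivlMr// mul1r -[2]/(1 + 1) ltrD2l.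
  have k0 : 0 < k := lt_trans c0p kc.
  have H : forall x, closure Om x -> enorm (x - y) <= r0 ->
      u x <= k * (p43 r0 - p43 (r0 - enorm (x - y))).
    apply: sub_compare => // z cz zy; rewrite ltNge; apply/negP => h.
    apply: no; exists z; split=> //; apply: le_trans h.
    by rewrite ler_pM2r ?p43_gt0// ltW.
  have s0 : 0 < Num.min 1 (r0 / d x) by rewrite lt_min ltr01 divr_gt0.
  have : c * d x <= k * (4 / 3 * cbrt r0 * d x).
    apply: (slope_upper Ox By xy s0) => t; rewrite lt_min ltr_pdivlMr// => /andP[t0 /andP[t1 tr]].
    have [|_ E2] := @foot_line x y t xy; first by rewrite !ltW.
    have cx : closure Om (y + t *: (x - y)).
      apply: closure_convex => //; last by rewrite !ltW.
        by case/(boundaryE HO): By.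
      exact: domain_closure.
    have := H _ cx; rewrite E2 (ltW tr) => /(_ isT) h; apply: (le_trans h).
    rewrite -mulrA ler_pM2l//.
    have := @p43_tangent _ r0 (r0 - t * d x) (ltW r00).
    rewrite subr_ge0 (ltW tr) => /(_ isT); lra.
  rewrite mulrA ler_pM2r// leNgt => /negP; apply.
  rewrite -{1}cbrt_a.
  have -> : cbrt a = l * cbrt r0 by rewrite divfK// gt_eqF.
  have : k < c0 * l.
    by rewrite /k ltr_pM2l// ltr_pdivrMr// mulr_natr mulr2n ltrD2r.
  rewrite -(ltr_pM2r cr0); lra.
have K0 : closure_ball (Om := Om) y a !=set0.
  exists y; split; first by case/(boundaryE HO): By.
  by rewrite subrr enorm0 ltW.
have [e [ce ey] Hmax] := closure_ball_max HO K0 sol_cont.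
exists e; split=> //; rewrite leNgt; apply/negP => neg.
pose h := (c0 * p43 a - u e) / c0.
have h0 : 0 < h by rewrite divr_gt0// subr_gt0.
have [r r0 Hr] := p43_cont (ltW a0) h0.
pose t := a - Num.min a r / 2.
have m0 : 0 < Num.min a r by rewrite lt_min a0.
have ma : Num.min a r <= a by rewrite ge_min lexx.
have mr : Num.min a r <= r by rewrite ge_min lexx orbT.
have t0 : 0 < t by rewrite /t; lra.
have ta : t < a by rewrite /t; lra.
have [x' [cx' x'y x'u]] := step t t0 ta.
have := Hmax x' (conj cx' (le_trans x'y (ltW ta))).
have := Hr t (ltW t0); rewrite distrC gtr0_norm ?subr_gt0//.
have -> : a - t < r by rewrite /t; lra.
move=> /(_ isT); rewrite ltr_norml => /andP[+ _].
rewrite -(ltr_pM2l c0p) mulrN.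
have -> : c0 * h = c0 * p43 a - u e by rewrite /h mulrC divfK// gt_eqF.
lra.
Qed.

End Solution.

(** * Solvability forces a stadium *)


Section Ridge.
Context {R : realType} {n : nat} {Om : set 'rV[R]_n}.
Hypothesis HO : convex_domain Om.
Implicit Types (x y z v w : 'rV[R]_n).
Local Notation d := (bdist Om).
Local Notation rho := (inradius Om).

Lemma ridge_domainP x : high_ridge Om x -> Om x.
Proof. by case=> cx dx; apply: ridge_domain; rewrite ?dx. Qed.

Lemma bdist_foot_line x y (t : R) : boundary Om y -> enorm (x - y) = d x ->
  0 <= t <= 1 -> d (x + t *: (y - x)) <= d x - t * d x.
Proof.
move=> By xy /andP[t0 t1]; apply: (le_trans (bdist_le _ By)).
have -> : x + t *: (y - x) - y = (1 - t) *: (x - y).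
  by apply/rowP => i; rewrite !mxE; ring.
by rewrite enormZ ger0_norm ?subr_ge0// xy; lra.
Qed.

Lemma diff_foot x y : Om x -> boundary Om y -> enorm (x - y) = d x ->
  differentiable d x -> 'd d x (y - x) <= - d x.
Proof.
move=> Ox By xy df.
apply/ler_addgt0Pr => e e0.
have dx := bdist_gt0 HO Ox.
have [r r0 Hr] := differentiable_epsE df (divr_gt0 e0 dx).
pose t := Num.min 1 (r / d x) / 2.
have m0 : 0 < Num.min 1 (r / d x) by rewrite lt_min ltr01 divr_gt0.
have t0 : 0 < t by rewrite divr_gt0.
have : t < Num.min 1 (r / d x) by rewrite ltr_pdivrMr// ltr_pMr// ltr1n.
rewrite lt_min ltr_pdivlMr// => /andP[t1 tr].
have E : enorm (t *: (y - x)) = t * d x by rewrite enormZ gtr0_norm// edistC xy.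
have := Hr (t *: (y - x)); rewrite E => /(_ tr).
rewrite linearZ/= ler_norml => /andP[+ _].
have -> : e / d x * (t * d x) = e * t by field; rewrite gt_eqF.
have t01 : 0 <= t <= 1 by rewrite (ltW t0) ltW.
have H1 := bdist_foot_line By xy t01; move=> H2.
rewrite -(ler_pM2l t0).
move: H2; rewrite /GRing.scale/=; lra.
Qed.

(** At a maximum point the differential would vanish, whereas [d] decreases at
    unit speed towards a foot point. *)
Lemma ridge_not_differentiable x : high_ridge Om x -> ~ differentiable d x.
Proof.
move=> Mx df; have Ox := ridge_domainP Mx; case: Mx => cx dx.
have [y By xy] := bdist_foot HO x.
have H := diff_foot Ox By xy df.
have dx0 := bdist_gt0 HO Ox.
have [r0 r00 Hr0] := domain_ball HO Ox.
have e0 : 0 < 2^-1 :> R by [].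
have [r rr0 Hr] := differentiable_epsE df e0.
have m0 : 0 < Num.min r0 r by rewrite lt_min r00.
pose t := Num.min r0 r / d x / 2.
have t0 : 0 < t by rewrite !divr_gt0.
have : t * d x < Num.min r0 r.
  by rewrite /t mulrAC divfK ?gt_eqF// ltr_pdivrMr// ltr_pMr// ltr1n.
rewrite lt_min => /andP[tr0 tr]; clearbody t.
have LZ : 'd d x (- t *: (y - x)) = - t * 'd d x (y - x) by rewrite linearZ.
have E : enorm (- t *: (y - x)) = t * d x.
  by rewrite scaleNr enormN enormZ gtr0_norm// edistC xy.
have := Hr (- t *: (y - x)); rewrite E => /(_ tr).
rewrite LZ ler_norml => /andP[+ _].
have : d (x + - t *: (y - x)) <= rho.
  apply: bdist_le_inradius => //; apply/domain_closure/Hr0.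
  by rewrite addrC addKr E.
have : t * ('d d x (y - x)) <= t * - d x by rewrite ler_pM2l.
have : 0 < t * d x by rewrite mulr_gt0.
rewrite -dx; lra.
Qed.

Lemma high_ridge_closed x : closure (high_ridge Om) x -> high_ridge Om x.
Proof.
move=> /closure_enormP Mx.
have cx : closure Om x.
  apply/closure_enormP => e e0; have e2 : 0 < e / 2 by exact: divr_gt0.
  have [y [/closure_enormP cy _] yx] := Mx _ e2; have [y' Oy' yy'] := cy _ e2.
  by exists y' => //; have := enormB_trans y y' x; lra.
split=> //; apply/eqP; rewrite eq_le bdist_le_inradius//=.
apply/ler_addgt0Pr => e e0; have [y [_ <-] yx] := Mx _ e0.
by have := bdist_lip HO y x; lra.
Qed.

(** In every convex domain the high ridge is closed and consists of singular
    points. *)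
Lemma stadium_like_of_differentiable :
  (forall x, Om x -> d x < rho -> differentiable d x) -> stadium_like Om.
Proof.
move=> H; case: (HO) => _ _ Oo Ob Oc; split=> //.
have SM : singular_set Om = high_ridge Om.
  apply/seteqP; split=> x.
    move=> [Ox nd]; split; first exact: domain_closure.
    apply/eqP; rewrite eq_le bdist_le_inradius//=; last exact: domain_closure.
    by rewrite leNgt; apply/negP => lt; exact/nd/H.
  by move=> Mx; split; [exact: ridge_domainP|exact: ridge_not_differentiable].
rewrite /cut_locus SM; apply/seteqP; split=> x; first by case=> /high_ridge_closed.
by move=> Mx; split; [exact: subset_closure|case: Mx].
Qed.

Lemma web_phiE x : web_phi Om x = web_c0 * (p43 rho - p43 (rho - d x)).
Proof. by rewrite !p43_powR. Qed.

End Ridge.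

Section Necessity.
Context {R : realType} {n : nat} {Om : set 'rV[R]_n}.
Hypothesis HO : convex_domain Om.
Variables (c : R) (u : 'rV[R]_n -> R) (g : 'rV[R]_n -> 'rV[R]_n).
Hypothesis Hsub : viscosity_subsolution Om u.
Hypothesis Hsup : viscosity_supersolution Om u.
Hypothesis ub : forall x, boundary Om x -> u x = 0.
Hypothesis HC : C1_closure Om u g.
Hypothesis gc : forall x, boundary Om x -> enorm (g x) = c.
Implicit Types (x y z v w : 'rV[R]_n).
Local Notation d := (bdist Om).
Local Notation rho := (inradius Om).
Local Notation c0 := (web_c0 : R).
Local Notation a := (c ^+ 3 / 3).

(** At the point given by [sol_reach], [u] is so large that [sol_upper] forces
    the distance to the boundary to be [a]. *)
Lemma sol_reach_ridge x y : Om x -> boundary Om y -> enorm (x - y) = d x ->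
  exists e, [/\ Om e, d e = a & enorm (e - y) = a].
Proof.
move=> Ox By xy; have a0 := sol_a_gt0 HO Hsup ub HC gc.
have c0p : 0 < c0 := web_c0_gt0.
have [e [ce ey eu]] := sol_reach HO Hsub Hsup ub HC gc Ox By xy.
have Oe : Om e.
  case: (closure_split HO ce) => // /ub ue; move: eu; rewrite ue.
  by rewrite leNgt mulr_gt0// p43_gt0.
have dea := sol_bdist_le HO Hsup ub HC gc Oe.
have de : d e = a.
  apply/eqP; rewrite eq_le dea/= leNgt; apply/negP => lt.
  have := le_trans eu (sol_upper HO Hsup ub HC gc Oe).
  by rewrite ler_pM2l// leNgt gtrBl p43_gt0// subr_gt0.
exists e; split=> //; apply/eqP; rewrite eq_le ey/= -de.
exact: bdist_le By.
Qed.

Lemma sol_inradius : rho = a.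
Proof.
apply/eqP; rewrite eq_le; apply/andP; split.
  have [x cx <-] := ridge_nonempty HO.
  have [Ox|Bx] := closure_split HO cx.
    exact: (sol_bdist_le HO Hsup ub HC gc Ox).
  by rewrite (bdist_boundary HO Bx) ltW// (sol_a_gt0 HO Hsup ub HC gc).
case: (HO) => _ [x Ox] _ _ _; have [y By xy] := bdist_foot HO x.
have [e [Oe <- _]] := sol_reach_ridge Ox By xy.
exact/bdist_le_inradius/domain_closure.
Qed.

(** The ball inscribed at [x] and the ball of radius [rho] reached from the foot
    of [x] are tangent at that foot, so the three points are aligned. *)
Lemma sol_ridge_dist x : Om x -> exists e,
  [/\ Om e, d e = rho & enorm (x - e) = rho - d x].
Proof.
move=> Ox; have [y By xy] := bdist_foot HO x.
have [e [Oe de ey]] := sol_reach_ridge Ox By xy.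
rewrite -sol_inradius in de ey.
exists e; split=> //; have rho0 := inradius_gt0 HO.
have eye : enorm (e - y) = d e by rewrite ey de.
have T := tangent_balls HO Ox Oe By xy eye.
have E : rho *: (x - e) = (d x - rho) *: (e - y).
  by rewrite scalerBl -T de -scalerBr; congr (_ *: _); rewrite opprB addrA subrK.
have := congr1 enorm E; rewrite !enormZ gtr0_norm// ler0_norm ?subr_le0; last first.
  exact/bdist_le_inradius/domain_closure.
rewrite ey opprB mulrC => /mulIf; apply.
by rewrite gt_eqF.
Qed.

(** The bound [sol_lower], centred at the ridge point aligned with [x], coincides
    with the bound [sol_upper]. *)
Lemma sol_web x : closure Om x -> u x = web_phi Om x.
Proof.
move=> cx; have c0p : 0 < c0 := web_c0_gt0; rewrite web_phiE.
have [Ox|Bx] := closure_split HO cx; last first.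
  by rewrite ub// bdist_boundary// subr0 subrr mulr0.
apply/eqP; rewrite eq_le; apply/andP; split.
  by have := sol_upper HO Hsup ub HC gc Ox; rewrite -sol_inradius.
have [e [Oe de xe]] := sol_ridge_dist Ox.
by have := sol_lower HO Hsup ub HC Oe cx; rewrite de xe.
Qed.

(** Off the high ridge the profile has nonzero slope and can be inverted, which
    makes [d] as differentiable as [u]. *)
Lemma sol_stadium : stadium_like Om.
Proof.
apply: (stadium_like_of_differentiable HO) => x Ox dx.
have c0p : 0 < c0 := web_c0_gt0.
have Oo : open Om by case: HO.
have inv s t : s - c0 * (s - t) / c0 = t by field; rewrite gt_eqF.
pose F y := rho - (p43 rho - u y / c0) `^ (3 / 4).
have Fd y : Om y -> F y = d y.
  move=> Oy; have cy := domain_closure Oy.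
  rewrite /F sol_web// web_phiE inv.
  have ry : 0 <= rho - d y by rewrite subr_ge0 bdist_le_inradius.
  rewrite p43_powR -powRrM (_ : 4 / 3 * (3 / 4) = 1); last by field.
  by rewrite powRr1// opprB addrC subrK.
have base : 0 < p43 rho - u x / c0.
  rewrite sol_web//; last exact: domain_closure.
  by rewrite web_phiE inv p43_gt0// subr_gt0.
have du : differentiable u x by case: HC => C1 _ _ _; exact: C1_differentiable Ox.
have dF : differentiable F x.
  apply: differentiableB; first exact: differentiable_cst.
  apply: (@differentiable_comp _ _ _ _ (fun y => p43 rho - u y / c0) (fun s => s `^ (3 / 4))).
    apply: differentiableB; first exact: differentiable_cst.
    exact: differentiableM.
  by apply/derivable1_diffP; have := is_derive1_powR (3 / 4) base => ?; exact: ex_derive.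
apply: (@differentiable_eps _ _ _ _ (grad F x)) => e e0.
have [r r0 Hr] := differentiable_epsE dF e0.
have [q q0 Hq] := domain_ball HO Ox.
exists (Num.min r q); first by rewrite lt_min r0.
move=> h; rewrite lt_min => /andP[hr hq].
have := Hr h hr; rewrite !Fd//; last by apply: Hq; rewrite addrC addKr.
have D := differentiable_is_derive h dF.
by rewrite -deriveE// derive_val.
Qed.

End Necessity.

(** * Projection onto the high ridge of a stadium *)


Section SmallParameter.
Context {R : realType}.

Lemma small_le0 (A B s0 : R) : 0 < s0 ->
  (forall s, 0 < s < s0 -> A <= s * B) -> A <= 0.
Proof.
move=> s00 H; apply/ler_addgt0Pr => e e0; rewrite add0r.
have B0 : 0 < `|B| + 1 by rewrite ltr_wpDl.
pose m := Num.min s0 (e / (`|B| + 1)).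
have m0 : 0 < m by rewrite lt_min s00 divr_gt0.
have t0 : 0 < m / 2 by rewrite divr_gt0.
have : m / 2 < m by rewrite ltr_pdivrMr// ltr_pMr// ltr1n.
move: (m / 2) t0 => s s_gt0.
rewrite lt_min ltr_pdivlMr// => /andP[ss se].
have := H s; rewrite s_gt0 ss => /(_ isT).
have : s * B <= s * (`|B| + 1).
  by rewrite ler_pM2l// (le_trans (ler_norm B))// lerDl.
lra.
Qed.

End SmallParameter.

Section RidgeProjection.
Context {R : realType} {n : nat} {Om : set 'rV[R]_n}.
Hypothesis HO : convex_domain Om.
Hypothesis Hst : cut_locus Om = high_ridge Om.
Implicit Types (x y z v w p q : 'rV[R]_n).
Local Notation d := (bdist Om).
Local Notation rho := (inradius Om).

Lemma off_ridge_differentiable x : Om x -> d x < rho -> differentiable d x.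
Proof.
move=> Ox dx; apply: contrapT => nd.
have : high_ridge Om x.
  rewrite -Hst; split; last exact: domain_closure.
  by apply: subset_closure; split.
by case=> _ dxr; move: dx; rewrite dxr ltxx.
Qed.

Lemma superlevel_compact s : compact [set x | closure Om x /\ s <= d x].
Proof.
have [B _ HB] := domain_bounded HO.
apply: (@closed_bounded_compact _ _ _ B); last by move=> x [/HB].
move=> x /closure_enormP Hx; split.
  apply/closure_enormP => e e0; have e2 : 0 < e / 2 by exact: divr_gt0.
  have [y [/closure_enormP cy _] yx] := Hx _ e2; have [y' Oy' yy'] := cy _ e2.
  by exists y' => //; have := enormB_trans y y' x; lra.
apply/ler_addgt0Pr => e e0.
have [y [_ sy] yx] := Hx _ e0.
by have := bdist_lip HO y x; lra.
Qed.

(** Let [z] be the point nearest to [x] where [d] has increased by [t]. Since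
    [d] is differentiable at [z] with a gradient of norm one, [z - x] points
    along that gradient (otherwise some direction would increase [d] while
    approaching [x]), and the tangent inequality of the concave function [d]
    then bounds the distance by [t]. *)
Lemma ridge_approach x t : closure Om x -> 0 < t -> d x + t < rho ->
  exists z, [/\ closure Om z, d x + t <= d z & enorm (z - x) <= t].
Proof.
move=> cx t0 tr; pose K := [set z | closure Om z /\ d x + t <= d z].
have K0 : K !=set0.
  by have [m cm dm] := ridge_nonempty HO; exists m; split; rewrite ?dm ?ltW.
have cf : {within K, continuous (fun z => enorm (z - x))}.
  apply: (@radial_continuous _ _ K x id) => s e _ e0; by exists e.
have [z /set_mem[cz dz] Hmin] := compact_EVT_min K0 (@superlevel_compact _) cf.
exists z; split=> //.
have dx0 := bdist_ge0 HO x.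
have Oz : Om z by apply: (bdist_gt0_domain HO cz); lra.
have zx : 0 < enorm (z - x).
  apply: enorm_gt0; rewrite subr_eq0; apply/eqP => E; move: dz; rewrite E; lra.
have dzE : d z = d x + t.
  apply/eqP; rewrite eq_le dz andbT leNgt; apply/negP => gt.
  pose s := Num.min 1 ((d z - d x - t) / enorm (z - x)).
  have s0 : 0 < s by rewrite lt_min ltr01 divr_gt0//; lra.
  have s1 : s <= 1 by rewrite ge_min lexx.
  have ss : s * enorm (z - x) <= d z - d x - t.
    by rewrite -ler_pdivlMr// ge_min lexx orbT.
  have s01 : 0 <= s <= 1 by rewrite (ltW s0).
  have E1 : z - (z + s *: (x - z)) = s *: (z - x).
    by apply/rowP => i; rewrite !mxE; ring.
  have E2 : z + s *: (x - z) - x = (1 - s) *: (z - x).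
    by apply/rowP => i; rewrite !mxE; ring.
  have Ks : K (z + s *: (x - z)).
    split; first exact: closure_convex.
    have := bdist_lip HO z (z + s *: (x - z)).
    by rewrite E1 enormZ gtr0_norm//; lra.
  have := Hmin _ (mem_set Ks); rewrite E2 enormZ ger0_norm ?subr_ge0//.
  by rewrite leNgt gtr_pMl// ltrBlDr ltrDl s0.
have dzr : d z < rho by rewrite dzE.
have dfz := off_ridge_differentiable Oz dzr.
have dz0 := bdist_gt0 HO Oz.
pose L := 'd d z; pose w := z - x.
have [y By zy] := bdist_foot HO z.
pose nu := z - y.
have Lnu : d z <= L nu.
  have := diff_foot HO Oz By zy dfz.
  have -> : L nu = - L (y - z) by rewrite /nu -(opprB y z); exact: linearN.
  by rewrite lerNr.
have Lw : enorm w <= L w.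
  rewrite leNgt; apply/negP => lt.
  pose h := enorm w *: nu - d z *: w.
  have Lh : 0 < L h.
    have -> : L h = enorm w * L nu - d z * L w.
      by rewrite /h [LHS]linearB; congr (_ - _); exact: linearZ.
    rewrite subr_gt0.
    apply: (@lt_le_trans _ _ (d z * enorm w)); first by rewrite ltr_pM2l.
    by rewrite mulrC ler_pM2l.
  have wh : 0 <= dot w h.
    have h1 : 0 < enorm h + 1 by rewrite ltr_wpDl// enorm_ge0.
    have e0 : 0 < L h / (enorm h + 1) by rewrite divr_gt0.
    have [r r0 Hr] := differentiable_epsE dfz e0.
    have [q q0 Hq] := domain_ball HO Oz.
    rewrite -oppr_le0; apply: (@small_le0 _ _ (enorm h ^+ 2) (Num.min r q / (enorm h + 1))).
      by rewrite divr_gt0// lt_min r0.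
    move=> s /andP[s0]; rewrite ltr_pdivlMr// lt_min => /andP[sr sq].
    have sh : enorm (s *: h) = s * enorm h by rewrite enormZ gtr0_norm.
    have shl : s * enorm h < s * (enorm h + 1) by rewrite ltr_pM2l// ltrDl.
    have Ks : K (z + s *: h).
      split.
        by apply/domain_closure/Hq; rewrite addrC addKr sh (lt_trans shl).
      rewrite -dzE.
      have := Hr (s *: h); rewrite sh => /(_ (lt_trans shl sr)).
      have -> : 'd d z (s *: h) = s * L h by exact: linearZ.
      rewrite ler_norml => /andP[+ _].
      have : L h / (enorm h + 1) * (s * enorm h) <= s * L h.
        by rewrite mulrAC ler_pdivrMr// mulrCA -mulrA ler_pM2l// ler_pM2l// lerDl.
      lra.
    have := Hmin _ (mem_set Ks).
    have -> : z + s *: h - x = w + s *: h by rewrite addrAC.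
    rewrite -ler_sqr ?nnegrE ?enorm_ge0// (enorm_sqrD w) dotZr sh exprMn -/w => H.
    have {}H : s * (- (2 * dot w h)) <= s * (s * enorm h ^+ 2) by lra.
    rewrite ler_pM2l// in H.
    have : 0 <= s * enorm h ^+ 2 by rewrite mulr_ge0 ?sqr_ge0// ltW.
    lra.
  have wnu : enorm w * enorm nu <= dot w nu.
    have wh' : dot w h = enorm w * dot w nu - d z * enorm w ^+ 2.
      by rewrite enorm_sqr /h; move: (w : 'rV[R]_n) => w'; rewrite dotDr dotNr !dotZr.
    move: wh; rewrite wh' subr_ge0 expr2 mulrCA ler_pM2l//.
    by rewrite /nu zy mulrC.
  have := dot_le_eq wnu; rewrite /nu zy -/nu => E.
  by move: Lh; rewrite /h E subrr /L linear0 ltxx.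
apply: le_trans Lw _.
apply/ler_addgt0Pr => e e0.
have e'0 : 0 < e / enorm w by rewrite divr_gt0.
have [r r0 Hr] := differentiable_epsE dfz e'0.
pose s := Num.min 1 (r / enorm w) / 2.
have m0 : 0 < Num.min 1 (r / enorm w) by rewrite lt_min ltr01 divr_gt0.
have s0 : 0 < s by rewrite divr_gt0.
have : s < Num.min 1 (r / enorm w) by rewrite ltr_pdivrMr// ltr_pMr// ltr1n.
rewrite lt_min ltr_pdivlMr// => /andP[s1 sr]; clearbody s.
have s01 : 0 <= s <= 1 by rewrite (ltW s0) ltW.
have := bdist_concave HO cz cx s01.
have E : enorm (s *: (x - z)) = s * enorm w.
  by rewrite enormZ gtr0_norm// edistC.
have LE : L (s *: (x - z)) = - (s * L w).
  rewrite -(opprB z x) scalerN; transitivity (- L (s *: w)); first exact: linearN.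
  by congr (- _); exact: linearZ.
have := Hr (s *: (x - z)); rewrite E => /(_ sr); rewrite -/L LE.
have -> : e / enorm w * (s * enorm w) = e * s by field; rewrite gt_eqF.
rewrite ler_norml => /andP[_ H1] H2.
have Es : s * d z = s * (d x + t) by rewrite dzE.
rewrite -(ler_pM2l s0); lra.
Qed.

(** A maximum point of [d] on the ball of radius [rho - d x] around [x] is on the
    high ridge, since [ridge_approach] reaches every smaller level there. *)
Lemma ridge_reach x : closure Om x -> exists p,
  high_ridge Om p /\ enorm (x - p) = rho - d x.
Proof.
move=> cx; have dxr := bdist_le_inradius HO cx.
have K0 : closure_ball (Om := Om) x (rho - d x) !=set0.
  by exists x; split=> //; rewrite subrr enorm0 subr_ge0.
have [p [cp px] Hmax] := closure_ball_max HO K0 (bdist_cont HO (A := closure Om)).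
have dp : d p = rho.
  apply/eqP; rewrite eq_le bdist_le_inradius//= leNgt; apply/negP => lt.
  have dxp : d x <= d p by apply: Hmax; split; rewrite ?subrr ?enorm0 ?subr_ge0.
  pose t := (d p + rho) / 2 - d x.
  have [||z [cz dz zx]] := @ridge_approach x t cx; rewrite /t; [lra|lra|].
  have : d z <= d p by apply: Hmax; split=> //; move: zx; rewrite /t; lra.
  by move: dz; rewrite /t; lra.
exists p; split; first by split.
apply/eqP; rewrite eq_le edistC px /=.
by have := bdist_lip HO p x; rewrite dp; lra.
Qed.

Lemma ridge_proj_exists : exists P : 'rV[R]_n -> 'rV[R]_n, forall x, closure Om x ->
  high_ridge Om (P x) /\ enorm (x - P x) = rho - d x.
Proof.
have H : forall x : 'rV[R]_n, exists p : 'rV[R]_n, closure Om x ->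
    high_ridge Om p /\ enorm (x - p) = rho - d x.
  move=> x; have [cx|ncx] := pselect (closure Om x); last by exists x => /ncx.
  by have [p Hp] := ridge_reach cx; exists p.
by have [P HP] := choice H; exists P.
Qed.

Lemma ridge_edist_ge x q : high_ridge Om q -> rho - d x <= enorm (x - q).
Proof. by case=> _ dq; have := bdist_lip HO q x; rewrite dq edistC; lra. Qed.

Lemma high_ridge_convex p q t : high_ridge Om p -> high_ridge Om q ->
  0 <= t <= 1 -> high_ridge Om (p + t *: (q - p)).
Proof.
move=> [cp dp] [cq dq] t01.
have cm := closure_convex HO cp cq t01; split=> //.
apply/eqP; rewrite eq_le bdist_le_inradius//=.
by have := bdist_concave HO cp cq t01; rewrite dp dq; lra.
Qed.

(** First-order optimality of [p] as the point of the convex high ridge nearest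
    to [x]. *)
Lemma ridge_variational x p q : closure Om x ->
  high_ridge Om p -> enorm (x - p) = rho - d x -> high_ridge Om q ->
  dot (x - p) (q - p) <= 0.
Proof.
move=> cx Mp xp Mq.
apply: (@small_le0 _ _ (enorm (q - p) ^+ 2) 1 ltr01) => s /andP[s0 s1].
have s01 : 0 <= s <= 1 by rewrite (ltW s0) ltW.
have H := ridge_edist_ge x (high_ridge_convex Mp Mq s01).
have xp0 : 0 <= rho - d x by rewrite subr_ge0 bdist_le_inradius.
rewrite -xp -ler_sqr ?nnegrE ?enorm_ge0// opprD addrA (enorm_sqrB (x - p)) in H.
rewrite dotZr enormZ exprMn gtr0_norm// in H.
have {}H : s * (2 * dot (x - p) (q - p)) <= s * (s * enorm (q - p) ^+ 2) by lra.
rewrite ler_pM2l// in H.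
have : 0 <= s * enorm (q - p) ^+ 2 by rewrite mulr_ge0 ?sqr_ge0// ltW.
lra.
Qed.

Variable P : 'rV[R]_n -> 'rV[R]_n.
Hypothesis HP : forall x, closure Om x ->
  high_ridge Om (P x) /\ enorm (x - P x) = rho - d x.

(** The projection onto a convex set is nonexpansive: add the variational
    inequalities at [x] and at [y]. *)
Lemma ridge_proj_lip x y : closure Om x -> closure Om y ->
  enorm (P x - P y) <= enorm (x - y).
Proof.
move=> cx cy; have [Mx xP] := HP cx; have [My yP] := HP cy.
have H1 := ridge_variational cx Mx xP My; have H2 := ridge_variational cy My yP Mx.
have [->|ne] := eqVneq (P x) (P y); first by rewrite subrr enorm0 enorm_ge0.
have pos : 0 < enorm (P x - P y) by rewrite enorm_gt0// subr_eq0.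
rewrite -(ler_pM2l pos) -expr2.
apply: (@le_trans _ _ (dot (P x - P y) (x - y))); last exact: dot_le.
rewrite -subr_ge0; move: H1 H2; rewrite enorm_sqr.
move: (P x) (P y) => p q {pos ne xP yP Mx My}.
rewrite !(dotDl, dotDr, dotNl, dotNr) (dotC p x) (dotC p y) (dotC q x) (dotC q y) (dotC q p).
lra.
Qed.

(** The squared distance to a convex set is differentiable, even on the set: its
    value at [x + h] is at most [|x + h - P x| ^ 2], its value at [x] is at most
    [|x - P (x + h)| ^ 2], and [P] is nonexpansive. *)
Lemma ridge_sqdist_derive x v : Om x ->
  is_derive x v (fun z => (rho - d z) ^+ 2) (2 * dot (x - P x) v).
Proof.
move=> Ox; apply/is_derive_epsP => e e0.
have cx := domain_closure Ox.
have [r r0 Hr] := domain_ball HO Ox.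
have v1 : 0 < enorm v + 1 by rewrite ltr_wpDl// enorm_ge0.
have v2 : 0 < (enorm v + 1) ^+ 2 by rewrite exprn_gt0.
exists (Num.min (r / (enorm v + 1)) (e / (enorm v + 1) ^+ 2)).
  by rewrite lt_min !divr_gt0.
move=> t; rewrite lt_min !ltr_pdivlMr// => /andP[tr te].
pose h := t *: v.
have hn : enorm h = `|t| * enorm v by rewrite enormZ.
have hl : enorm h <= `|t| * (enorm v + 1) by rewrite hn ler_wpM2l// lerDl.
have cxh : closure Om (x + h).
  by apply/domain_closure/Hr; rewrite addrC addKr; exact: le_lt_trans tr.
have [M0 E0] := HP cx; have [M1 E1] := HP cxh.
have ge0 z : closure Om z -> 0 <= rho - d z.
  by move=> cz; rewrite subr_ge0 bdist_le_inradius.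
have U : (rho - d (x + h)) ^+ 2 <= enorm (x + h - P x) ^+ 2.
  by rewrite ler_sqr ?nnegrE ?enorm_ge0 ?ge0//; exact: ridge_edist_ge.
have Lo : (rho - d x) ^+ 2 <= enorm (x - P (x + h)) ^+ 2.
  by rewrite ler_sqr ?nnegrE ?enorm_ge0 ?ge0//; exact: ridge_edist_ge.
have Plip := ridge_proj_lip cxh cx.
rewrite addrAC subrr add0r in Plip.
have PH : dot (P (x + h) - P x) h <= enorm h ^+ 2.
  by apply: (le_trans (dot_le _ _)); rewrite expr2 ler_wpM2r// enorm_ge0.
have EU : enorm (x + h - P x) ^+ 2 = enorm (x - P x) ^+ 2 + 2 * dot (x - P x) h + enorm h ^+ 2.
  by rewrite (addrAC x) (enorm_sqrD (x - P x)).
have EL : enorm (x + h - P (x + h)) ^+ 2 = enorm (x - P (x + h)) ^+ 2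
    + 2 * dot (x - P (x + h)) h + enorm h ^+ 2.
  by rewrite (addrAC x) (enorm_sqrD (x - P (x + h))).
have PD : dot (x - P (x + h)) h = dot (x - P x) h - dot (P (x + h) - P x) h.
  by rewrite !(dotDl, dotNl); ring.
rewrite EU E0 in U; rewrite E1 in EL; rewrite -/h.
have -> : t * (2 * dot (x - P x) v) = 2 * dot (x - P x) h by rewrite /h dotZr; ring.
have small : enorm h ^+ 2 <= e * `|t|.
  apply: (@le_trans _ _ ((`|t| * (enorm v + 1)) ^+ 2)).
    by rewrite ler_sqr ?nnegrE ?enorm_ge0// mulr_ge0// ltW.
  by rewrite exprMn expr2 -mulrA mulrC ler_wpM2r// ltW.
apply: le_trans small; rewrite ler_norml; apply/andP; split; lra.
Qed.

End RidgeProjection.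

(** * The explicit solution on a stadium *)


Section SecondOrderTests.
Context {R : realType}.

Lemma min_derive (h : R -> R) (l r : R) : 0 < r -> is_derive (0 : R) 1 h l ->
  h 0 = 0 -> (forall t, `|t| < r -> 0 <= h t) -> l = 0.
Proof.
move=> r0 /is_derive_epsP D h0 H.
suff small e : 0 < e -> `|l| <= e.
  by apply/normr0_eq0/eqP; rewrite eq_le normr_ge0 andbT; apply/ler_addgt0Pr => e e0; rewrite add0r small.
move=> e0; have [q q0 Hq] := D e e0.
pose t := Num.min r q / 2.
have m0 : 0 < Num.min r q by rewrite lt_min r0.
have t0 : 0 < t by rewrite divr_gt0.
have : t < Num.min r q by rewrite ltr_pdivrMr// ltr_pMr// ltr1n.
rewrite lt_min => /andP[tr tq]; clearbody t.
have := Hq t; have := Hq (- t); have := H t; have := H (- t).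
rewrite !normrN !(gtr0_norm t0) => /(_ tr) H1 /(_ tr) H2 /(_ tq) + /(_ tq).
rewrite !add0r h0 /GRing.scale/= !mulr1 !ler_norml => /andP[_ H3] /andP[_ H4].
by apply/andP; split; rewrite -(ler_pM2l t0); lra.
Qed.

Lemma min_derive2 (h dh : R -> R) (l r : R) : 0 < r ->
  (forall t : R, `|t| < r -> is_derive t 1 h (dh t)) -> is_derive (0 : R) 1 dh l ->
  h 0 = 0 -> (forall t, `|t| < r -> 0 <= h t) -> 0 <= l.
Proof.
move=> r0 D1 D2 h0 H.
have dh0 : dh 0 = 0.
  by apply: (min_derive r0 _ h0 H); apply: D1; rewrite normr0.
apply/ler_addgt0Pr => e e0; have e2 : 0 < e / 2 by rewrite divr_gt0.
have [q q0 Hq] := taylor2 r0 D1 D2 e2.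
pose t := Num.min r q / 2.
have m0 : 0 < Num.min r q by rewrite lt_min r0.
have t0 : 0 < t by rewrite divr_gt0.
have : t < Num.min r q by rewrite ltr_pdivrMr// ltr_pMr// ltr1n.
rewrite lt_min => /andP[tr tq]; clearbody t.
have := Hq t; have := H t; rewrite gtr0_norm// => /(_ tr) H1 /(_ tq).
rewrite h0 dh0 mul0r !add0r ler_norml => /andP[_ H2].
have t2 : 0 < t ^+ 2 by rewrite exprn_gt0.
rewrite -(ler_pM2l t2); lra.
Qed.

End SecondOrderTests.

Section C2Lines.
Context {R : realType} {n : nat} {Om : set 'rV[R]_n}.
Hypothesis HO : convex_domain Om.
Implicit Types (x y z v w : 'rV[R]_n) (psi : 'rV[R]_n -> R).

Definition hess_form psi x v : R :=
  \sum_i \sum_j pderiv j (pderiv i psi) x * v 0 j * v 0 i.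

Lemma hess_formZ psi x (k : R) v : hess_form psi x (k *: v) = k ^+ 2 * hess_form psi x v.
Proof.
rewrite /hess_form mulr_sumr; apply: eq_bigr => i _; rewrite mulr_sumr.
by apply: eq_bigr => j _; rewrite !mxE; ring.
Qed.

Lemma C2_line psi x v : Ck 2 Om psi -> Om x -> exists2 r : R, 0 < r &
  (forall t : R, `|t| < r -> Om (x + t *: v) /\
    is_derive t 1 (fun s : R => psi (x + s *: v)) (dot (grad psi (x + t *: v)) v)) /\
  is_derive (0 : R) 1 (fun t : R => dot (grad psi (x + t *: v)) v) (hess_form psi x v).
Proof.
move=> C2 Ox; have Oo : open Om by case: HO.
have C1 : Ck 1 Om psi by exact: Ck_le.
have [r r0 Hr] := domain_ball HO Ox.
have v1 : 0 < enorm v + 1 by rewrite ltr_wpDl// enorm_ge0.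
exists (r / (enorm v + 1)); first by rewrite divr_gt0.
have Ol (t : R) : `|t| < r / (enorm v + 1) -> Om (x + t *: v).
  rewrite ltr_pdivlMr// => tr; apply: Hr; rewrite addrC addKr enormZ.
  by apply: le_lt_trans tr; rewrite ler_wpM2l// lerDl.
split.
  move=> t /Ol Ot; split=> //.
  have := (is_derive_line psi x v t (dot (grad psi (x + t *: v)) v)).1; apply.
  exact: C1_is_derive Oo C1 Ot.
have -> : (fun t : R => dot (grad psi (x + t *: v)) v) =
    \sum_i (v 0 i *: (fun t : R => pderiv i psi (x + t *: v))).
  apply/funext => t; rewrite fct_sumE; apply: eq_bigr => i _.
  by rewrite mxE mulrC.
have Di (i : 'I_n) : is_derive (0 : R) 1 (fun t : R => pderiv i psi (x + t *: v))
    (dot (grad (pderiv i psi) x) v).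
  have := (is_derive_line (pderiv i psi) x v 0 (dot (grad (pderiv i psi) x) v)).1.
  rewrite scale0r addr0; apply.
  by apply: C1_is_derive Ox => //; case: C2 => _ /(_ i)[].
have := @is_derive_sum _ _ _ n (fun i => v 0 i *: (fun t : R => pderiv i psi (x + t *: v)))
  0 1 (fun i => v 0 i *: dot (grad (pderiv i psi) x) v) (fun i => is_deriveZ (v 0 i) (Di i)).
move=> D; apply: is_derive_eq D _.
apply: eq_bigr => i _; rewrite /GRing.scale/= mulr_sumr; apply: eq_bigr => j _.
by rewrite mxE mulrC.
Qed.

Lemma inf_laplacian_form psi x : inf_laplacian psi x = hess_form psi x (grad psi x).
Proof. exact: inf_laplacianE. Qed.

Lemma grad_unique psi x w : (forall v, dot (grad psi x) v = dot w v) ->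
  grad psi x = w.
Proof.
move=> H; apply/rowP => i.
by rewrite -(dot_delta (grad psi x)) H dot_delta.
Qed.

End C2Lines.

Section WebSolution.
Context {R : realType} {n : nat} {Om : set 'rV[R]_n}.
Hypothesis HO : convex_domain Om.
Hypothesis Hst : cut_locus Om = high_ridge Om.
Variable P : 'rV[R]_n -> 'rV[R]_n.
Hypothesis HP : forall x, closure Om x ->
  high_ridge Om (P x) /\ enorm (x - P x) = inradius Om - bdist Om x.
Implicit Types (x y z v w : 'rV[R]_n) (psi : 'rV[R]_n -> R).
Local Notation d := (bdist Om).
Local Notation rho := (inradius Om).
Local Notation c0 := (web_c0 : R).

(** The absolute value makes the function continuous on the whole space; on the
    closure of the domain it is [web_phi]. *)
Definition web_fun x : R := c0 * (p43 rho - p43 `|rho - d x|).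

(** The derivative [cbrt 3 * cbrt (rho - d x)] of the profile times the unit vector
    [(P x - x) / (rho - d x)], written so as to vanish on the high ridge. *)
Definition web_grad x : 'rV[R]_n :=
  (cbrt 3 / cbrt (rho - d x) ^+ 2) *: (P x - x).

Local Notation u := web_fun.
Local Notation G := web_grad.

Lemma rho_sub_ge0 x : closure Om x -> 0 <= rho - d x.
Proof. by move=> cx; rewrite subr_ge0 bdist_le_inradius. Qed.

Lemma web_fun_near x (e : R) : 0 < e -> exists2 r : R, 0 < r &
  forall y, enorm (y - x) < r -> `|u y - u x| < e.
Proof.
move=> e0; have c0p : 0 < c0 := web_c0_gt0.
have [r r0 Hr] := p43_cont (normr_ge0 (rho - d x)) (divr_gt0 e0 c0p).
exists r => // y yx.
have -> : u y - u x = c0 * (p43 `|rho - d x| - p43 `|rho - d y|).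
  by rewrite /u -mulrBr opprB addrC subrKA.
rewrite normrM gtr0_norm// distrC mulrC -ltr_pdivlMr//; apply: Hr => //.
apply: le_lt_trans yx; apply: (le_trans (ler_dist_dist _ _)).
have -> : rho - d y - (rho - d x) = d x - d y by ring.
by rewrite edistC; exact: bdist_norm.
Qed.

Lemma web_fun_continuous : continuous u.
Proof. by move=> x; apply/cont_enormP => e; exact: web_fun_near. Qed.

Lemma web_grad_norm x : closure Om x -> enorm (G x) = cbrt 3 * cbrt (rho - d x).
Proof.
move=> cx; rewrite /G enormZ edistC (HP cx).2 ger0_norm ?divr_ge0 ?sqr_ge0 ?cbrt_ge0//.
have D0 := rho_sub_ge0 cx.
rewrite -{2}(cbrtK D0).
have [->|ne] := eqVneq (cbrt (rho - d x)) 0; first by rewrite !expr0n/= !mulr0.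
by field.
Qed.

(** On the high ridge the increment of [u] is of order [t ^ (4 / 3)]; off it, [u]
    is a smooth function of the squared distance to the high ridge. *)
Lemma web_fun_derive x v : Om x -> is_derive x v u (dot (G x) v).
Proof.
move=> Ox; have cx := domain_closure Ox; have c0p : 0 < c0 := web_c0_gt0.
have := rho_sub_ge0 cx; rewrite le_eqVlt => /orP[/eqP D0|D0].
  have -> : G x = 0.
    by apply: enorm_eq0; rewrite web_grad_norm// -D0 cbrt0 mulr0.
  rewrite dot0l; apply/is_derive_epsP => e e0.
  have v1 : 0 < enorm v + 1 by rewrite ltr_wpDl// enorm_ge0.
  pose l := e / (c0 * (enorm v + 1)).
  have l0 : 0 < l by rewrite divr_gt0// mulr_gt0.
  exists (l ^+ 3 / (enorm v + 1)); first by rewrite divr_gt0// exprn_gt0.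
  move=> t; rewrite ltr_pdivlMr// => tl.
  have -> : u (x + t *: v) - u x - t * 0 = - (c0 * p43 `|rho - d (x + t *: v)|).
    by rewrite /u -D0 normr0 p43_0 mulr0 subr0 subr0 mulrBr addrAC subrr add0r.
  rewrite normrN normrM (gtr0_norm c0p) ger0_norm ?p43_ge0//.
  set a := `|t| * (enorm v + 1) in tl.
  have a0 : 0 <= a by rewrite mulr_ge0// ltW.
  have : `|rho - d (x + t *: v)| <= a.
    have -> : rho - d (x + t *: v) = d x - d (x + t *: v) by lra.
    apply: (le_trans (bdist_norm HO _ _)).
    have -> : x - (x + t *: v) = - (t *: v) by rewrite opprD addrA subrr add0r.
    by rewrite enormN enormZ ler_wpM2l// lerDl.
  move=> /(p43_le (normr_ge0 _)) H.
  have la : cbrt a <= l by rewrite -(cbrt_cube (ltW l0)); apply: cbrt_le => //; exact: ltW.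
  have H2 : p43 a <= a * l by rewrite p43E exprSr cbrtK// ler_wpM2l.
  apply: (@le_trans _ _ (c0 * (a * l))).
    by rewrite ler_pM2l//; exact: le_trans H2.
  rewrite le_eqVlt; apply/orP; left; apply/eqP; rewrite /a /l; field.
  by rewrite !gt_eqF.
pose F z := (rho - d z) ^+ 2.
have uE : u = fun z => c0 * (p43 rho - (F z) `^ (2 / 3)).
  apply/funext => z; rewrite /u /F -(@real_normK _ (rho - d z)) ?num_real//.
  rewrite -(@powR_mulrn _ `|rho - d z| 2)// -powRrM !p43_powR; congr (_ * (_ - _ `^ _)).
  by field.
have D1 : is_derive (0 : R) 1 (fun t : R => F (x + t *: v)) (2 * dot (x - P x) v).
  have := (is_derive_line F x v 0 (2 * dot (x - P x) v)).1.
  rewrite (_ : x + (0 : R) *: v = x); last by rewrite scale0r addr0.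
  by apply; exact: (ridge_sqdist_derive HO HP).
have Fx0 : 0 < F (x + (0 : R) *: v) by rewrite scale0r addr0 exprn_gt0.
have D2 := @is_derive1_comp _ (fun s => s `^ (2 / 3)) _ 0 _ _ (is_derive1_powR (2 / 3) Fx0) D1.
have D3 := is_deriveZ c0 (is_deriveB (is_derive_cst (p43 rho) (0 : R) 1) D2).
have x0 : x + (0 : R) *: v = x by rewrite scale0r addr0.
suff D : is_derive (0 : R) 1 (fun t : R => u (x + t *: v)) (dot (G x) v).
  by have := (is_derive_line u x v 0 (dot (G x) v)).2 D; rewrite x0.
rewrite uE; apply: is_derive_eq D3 _.
rewrite x0 sub0r /GRing.scale/= /G dotZl.
have -> : F x `^ (2 / 3 - 1) = (cbrt (rho - d x) ^+ 2)^-1.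
  rewrite /F -powR_mulrn ?(ltW D0)// -powRrM.
  rewrite -(@powR_mulrn _ (cbrt _) 2) ?cbrt_ge0// cbrt_powR -powRrM -powRN.
  by congr (_ `^ _); field.
rewrite -web_c0_slope -(opprB x (P x)) dotNl.
by move: (dot _ v) ((_ ^+ 2)^-1) => *; field.
Qed.

Lemma web_grad_near x (e : R) : closure Om x -> 0 < e -> exists2 r : R, 0 < r &
  forall y, closure Om y -> enorm (y - x) < r -> enorm (G y - G x) < e.
Proof.
move=> cx e0.
have c3 : 0 < cbrt 3 :> R by rewrite cbrt_gt0.
have := rho_sub_ge0 cx; rewrite le_eqVlt => /orP[/eqP D0|D0].
  have -> : G x = 0.
    by apply: enorm_eq0; rewrite web_grad_norm// -D0 cbrt0 mulr0.
  exists ((e / cbrt 3) ^+ 3); first by rewrite exprn_gt0// divr_gt0.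
  move=> y cy yx; rewrite subr0 web_grad_norm// mulrC -ltr_pdivlMr//.
  rewrite -(cbrt_cube (ltW (divr_gt0 e0 c3))).
  apply: cbrt_lt; first exact: rho_sub_ge0.
  apply: le_lt_trans yx; have := bdist_lip HO x y; rewrite edistC; lra.
pose h (s : R) := cbrt 3 / cbrt s ^+ 2.
pose k y := h (rho - d y).
have GE z : G z = k z *: (P z - z) by [].
have ck : exists2 r : R, 0 < r & forall y, enorm (y - x) < r ->
    `|k y - k x| < e / (2 * (rho - d x + 1)) /\ `|k y - k x| < 1.
  have ch : {for (rho - d x), continuous h}.
    apply: cvgM; first exact: cvg_cst.
    have cc : {for (rho - d x), continuous (cbrt : R -> R)}.
      apply/differentiable_continuous/derivable1_diffP.
      by have := cbrt_derive D0 => ?; exact: ex_derive.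
    apply: cvgV; first by rewrite expf_neq0// gt_eqF// cbrt_gt0.
    by apply: cvgM; exact: cc.
  pose m := Num.min (e / (2 * (rho - d x + 1))) 1.
  have D1 : 0 < rho - d x + 1 by rewrite ltr_pwDr// ltW.
  have m0 : 0 < m by rewrite lt_min ltr01 divr_gt0// mulr_gt0.
  move/(@cvgrPdist_lt _ _ _ (nbhs (rho - d x))): ch => /(_ m m0) /nbhs_ballP[r /= r0 Hr].
  exists r => // y yx; have := Hr (rho - d y); rewrite -ball_normE /ball_/=.
  have -> : rho - d x - (rho - d y) = d y - d x by ring.
  move=> /(_ (le_lt_trans (bdist_norm HO _ _) yx)).
  move=> Hk; have : `|k y - k x| < m by rewrite distrC.
  by rewrite /m lt_min => /andP[].
have [r r0 Hr] := ck.
have K0 : 0 < 2 * (`|k x| + 1) by rewrite mulr_gt0// ltr_wpDl.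
exists (Num.min r (e / 2 / (2 * (`|k x| + 1)))); first by rewrite lt_min r0 !divr_gt0.
move=> y cy; rewrite lt_min ltr_pdivlMr// => /andP[yr ye].
have [k1 k2] := Hr y yr.
have -> : G y - G x = (k y - k x) *: (P x - x) + k y *: ((P y - P x) - (y - x)).
  rewrite (GE y) (GE x); move: (k y) (k x) (P y) (P x) => a b p q.
  by apply/rowP => i; rewrite !mxE; ring.
apply: (le_lt_trans (enormD _ _)); rewrite !enormZ.
have A1 : `|k y - k x| * enorm (P x - x) < e / 2.
  have D1 : 0 < rho - d x + 1 by rewrite ltr_pwDr// ltW.
  rewrite edistC (HP cx).2.
  apply: (@lt_le_trans _ _ (e / (2 * (rho - d x + 1)) * (rho - d x + 1))).
    apply: (@le_lt_trans _ _ (`|k y - k x| * (rho - d x + 1))).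
      by rewrite ler_wpM2l// lerDl.
    by rewrite ltr_pM2r.
  rewrite le_eqVlt; apply/orP; left; apply/eqP; field.
  by rewrite gt_eqF.
have A2 : `|k y| * enorm (P y - P x - (y - x)) <= e / 2.
  have ky : `|k y| <= `|k x| + 1.
    have := ler_normD (k x) (k y - k x); move: k2; move: (k x) (k y) => a b k2.
    by rewrite addrC subrK; lra.
  have L : enorm (P y - P x - (y - x)) <= 2 * enorm (y - x).
    apply: (le_trans (enormD _ _)); rewrite enormN mulr_natl mulr2n lerD2r.
    exact: (ridge_proj_lip HO HP cy cx).
  apply: (@le_trans _ _ ((`|k x| + 1) * (2 * enorm (y - x)))).
    by apply: ler_pM; rewrite ?enorm_ge0.
  by rewrite mulrCA mulrA mulrC ltW.
by rewrite (splitr e) ltr_leD.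
Qed.

Lemma web_pderiv x i : Om x -> pderiv i u x = G x 0 i.
Proof.
move=> Ox; have := web_fun_derive (delta_mx 0 i) Ox => ?.
by rewrite /pderiv derive_val dot_delta.
Qed.

Lemma web_C1_closure : C1_closure Om u G.
Proof.
split.
- split; first by move=> x _; exact: web_fun_continuous.
  move=> i; split.
    by move=> x Ox; have := web_fun_derive (delta_mx 0 i) Ox => ?; exact: ex_derive.
  split=> // x Ox; apply/cont_enormP => e e0.
  have [r r0 Hr] := web_grad_near (domain_closure Ox) e0.
  have [q q0 Hq] := domain_ball HO Ox.
  exists (Num.min r q); first by rewrite lt_min r0.
  move=> y; rewrite lt_min => /andP[yr yq].
  have Oy := Hq y yq; rewrite !web_pderiv//.
  apply: le_lt_trans (Hr y (domain_closure Oy) yr).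
  by have := coord_le_enorm (G y - G x) i; rewrite !mxE.
- by apply: continuous_subspaceT => x; exact: web_fun_continuous.
- apply/subspace_continuousP => x cx; apply/cvgrPdist_lt => e e0.
  rewrite near_withinE; apply/nbhs_enormP.
  have [r r0 Hr] := web_grad_near cx e0; exists r => // y yr cy.
  apply: le_lt_trans (Hr y cy yr); rewrite edistC.
  exact: mxnorm_le_enorm.
move=> x Ox; apply/rowP => i; by rewrite [RHS]mxE web_pderiv.
Qed.

Lemma web_fun_boundary x : boundary Om x -> u x = 0.
Proof.
move=> Bx; have r0 := inradius_gt0 HO.
by rewrite /u (bdist_boundary HO Bx) subr0 gtr0_norm// subrr mulr0.
Qed.

Lemma web_grad_boundary x : boundary Om x -> enorm (G x) = cbrt 3 * cbrt rho.
Proof.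
move=> Bx; rewrite web_grad_norm; last by case/(boundaryE HO): Bx.
by rewrite (bdist_boundary HO Bx) subr0.
Qed.

(** As [d] is 1-Lipschitz and equal to [rho] at [P x], it must grow at unit speed
    up to [P x]; on the other side of [x] concavity bounds it from above. *)
Lemma bdist_ridge_line x (t : R) : closure Om x -> closure Om (x + t *: (P x - x)) ->
  t <= 1 -> d (x + t *: (P x - x)) = d x + t * (rho - d x).
Proof.
move=> cx cq t1; have [[cP dP] xP] := HP cx.
set q := x + _ in cq *.
have qP : q - P x = - ((1 - t) *: (P x - x)).
  by rewrite /q; apply/rowP => i; rewrite !mxE; ring.
have nq : enorm (q - P x) = (1 - t) * (rho - d x).
  by rewrite qP enormN enormZ edistC xP ger0_norm// subr_ge0.
apply/eqP; rewrite eq_le; apply/andP; split; last first.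
  by have := bdist_lip HO (P x) q; rewrite dP edistC nq; lra.
have [t0|t0] := leP 0 t.
  have := bdist_lip HO q x.
  by rewrite /q (addrC x) addrK enormZ edistC xP ger0_norm//; lra.
have t1' : 0 < 1 - t by lra.
pose s := - t / (1 - t).
have s01 : 0 <= s <= 1.
  rewrite /s divr_ge0 ?oppr_ge0 ?(ltW t0) ?(ltW t1')//= ler_pdivrMr// mul1r; lra.
have := bdist_concave HO cq cP s01.
have -> : q + s *: (P x - q) = x.
  rewrite /q /s; apply/rowP => i; rewrite !mxE; field.
  by rewrite gt_eqF.
rewrite dP -(ler_pM2l t1').
have -> : (1 - t) * ((1 - s) * d q + s * rho) = d q - t * rho.
  by rewrite /s; field; rewrite gt_eqF.
lra.
Qed.

Lemma touching_grad psi x (sg : R) : Ck 2 Om psi -> Om x -> u x = psi x ->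
  sg != 0 -> (forall y, Om y -> 0 <= sg * (psi y - u y)) -> grad psi x = G x.
Proof.
move=> C2 Ox ux sg0 H; apply: grad_unique => v.
have [q q0 [D1 _]] := C2_line HO v C2 Ox.
have x0 : x + (0 : R) *: v = x by rewrite scale0r addr0.
have Dpsi : is_derive (0 : R) 1 (fun t : R => psi (x + t *: v)) (dot (grad psi x) v).
  by have [|_] := D1 0; rewrite ?normr0// x0.
have Du : is_derive (0 : R) 1 (fun t : R => u (x + t *: v)) (dot (G x) v).
  apply: (is_derive_line u x v 0 (dot (G x) v)).1.
  by rewrite x0; exact: web_fun_derive.
have D : is_derive (0 : R) 1 (fun t : R => sg * (psi (x + t *: v) - u (x + t *: v)))
    (sg * (dot (grad psi x) v - dot (G x) v)).
  exact: (is_deriveZ sg (is_deriveB Dpsi Du)).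
have /eqP : sg * (dot (grad psi x) v - dot (G x) v) = 0.
  apply: (min_derive q0 D); first by rewrite x0 ux subrr mulr0.
  by move=> t tq; apply: H; have [] := D1 t tq.
by rewrite mulf_eq0 (negbTE sg0) subr_eq0 => /eqP.
Qed.

(** Along the line through [x] and its projection, [u] is the one-variable
    profile, whose second derivative is compared with that of the test
    function. *)
Lemma touching_off_ridge psi x (sg : R) : Ck 2 Om psi -> Om x -> u x = psi x ->
  sg != 0 -> (forall y, Om y -> 0 <= sg * (psi y - u y)) -> 0 < rho - d x ->
  0 <= sg * (inf_laplacian psi x + 1).
Proof.
move=> C2 Ox ux sg0 H D0; have cx := domain_closure Ox.
have gE := touching_grad C2 Ox ux sg0 H.
rewrite inf_laplacian_form gE /G hess_formZ.
set k := cbrt 3 / _; pose v := P x - x; rewrite -/v.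
have c3 : 0 < cbrt 3 :> R by rewrite cbrt_gt0.
have cD : 0 < cbrt (rho - d x) by rewrite cbrt_gt0.
have k0 : 0 < k by rewrite divr_gt0// exprn_gt0.
have [q q0 [D1 D2]] := C2_line HO v C2 Ox.
pose K := c0 * p43 (rho - d x).
have m1 : (- 1 : R) ^+ 2 = 1 by rewrite sqrrN expr1n.
pose w (t : R) := - (K * p43 (-1 * t + 1)).
pose dw (t : R) := - (K * (4 / 3 * cbrt (-1 * t + 1) * -1)).
have Dw (t : R) : `|t| < 1 -> is_derive t 1 w (dw t).
  move=> t1; apply: (@cone_derive _ K (-1) 1 t).
  by move: t1; rewrite ltr_norml => /andP[_]; lra.
have Dw2 : is_derive (0 : R) 1 dw (- (4 / 9 * K)).
  have := @cone_derive2 _ K (-1) 1 0; rewrite mulr0 add0r ltr01 => /(_ isT) D.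
  apply: is_derive_eq D _.
  by rewrite cbrt_powR powR1 expr1n; field.
have uE (t : R) : `|t| < Num.min q 1 -> u (x + t *: v) = c0 * p43 rho + w t.
  rewrite lt_min => /andP[tq]; rewrite ltr_norml => /andP[_ t1].
  have [Ot _] := D1 t tq.
  have E := bdist_ridge_line cx (domain_closure Ot) (ltW t1).
  rewrite /u E.
  have -> : rho - (d x + t * (rho - d x)) = (-1 * t + 1) * (rho - d x) by ring.
  have t1' : 0 <= -1 * t + 1 by lra.
  rewrite ger0_norm ?mulr_ge0 ?(ltW D0)// p43M ?(ltW D0)// /w /K.
  by move: (p43 _) (p43 _) (p43 _) => *; ring.
have m0 : 0 < Num.min q 1 by rewrite lt_min q0 ltr01.
pose f (t : R) := sg * (psi (x + t *: v) - (c0 * p43 rho + w t)).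
have DA (t : R) : `|t| < Num.min q 1 ->
    is_derive t 1 f (sg * (dot (grad psi (x + t *: v)) v - dw t)).
  rewrite lt_min => /andP[tq t1]; have [_ Dp] := D1 t tq.
  have := is_deriveZ sg (is_deriveB Dp (is_deriveD (is_derive_cst (c0 * p43 rho) t 1) (Dw t t1))).
  by rewrite add0r.
have DB : is_derive (0 : R) 1 (fun t : R => sg * (dot (grad psi (x + t *: v)) v - dw t))
    (sg * (hess_form psi x v - - (4 / 9 * K))).
  exact: (is_deriveZ sg (is_deriveB D2 Dw2)).
have x0 : x + (0 : R) *: v = x by rewrite scale0r addr0.
have E : 0 <= sg * (hess_form psi x v - - (4 / 9 * K)).
  apply: (min_derive2 m0 DA DB).
    by rewrite /f -uE ?normr0// x0 ux subrr mulr0.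
  move=> t tm; rewrite /f -uE//; apply: H.
  by have [] := D1 t; first by move: tm; rewrite lt_min => /andP[].
have kK : k ^+ 2 * (4 / 9 * K) = 1.
  have -> : k ^+ 2 * (4 / 9 * K) = (4 / 3 * c0) * cbrt 3 ^+ 2 / 3.
    rewrite /k /K p43E; field; rewrite gt_eqF//.
  by rewrite web_c0_slope -exprS cbrtK// divff.
have k2 : 0 <= k ^+ 2 by rewrite sqr_ge0.
have := mulr_ge0 k2 E.
have -> : k ^+ 2 * (sg * (hess_form psi x v - - (4 / 9 * K))) =
  sg * (k ^+ 2 * hess_form psi x v + k ^+ 2 * (4 / 9 * K)) by ring.
by rewrite kK.
Qed.

(** On the high ridge [u] behaves like [- t ^ (4 / 3)] in the direction of a
    foot, which no function of class C^2 can touch from below. *)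
Lemma no_touching_on_ridge psi x : Ck 2 Om psi -> Om x -> touches Om psi u x ->
  rho = d x -> False.
Proof.
have alg (A B p S k T h1 h2 : R) : - (1 * T) <= B - (k * p + h2 / 2 * T) ->
    B <= A -> A <= k * (p - S) -> - h2 / 2 * T <= h1 / 2 * T ->
    k * S <= (h1 / 2 + 1) * T by lra.
move=> C2 Ox [ux le] D0; have cx := domain_closure Ox.
have c0p : 0 < c0 := web_c0_gt0; have rho0 := inradius_gt0 HO.
have gE : grad psi x = G x.
  apply: (touching_grad C2 Ox (esym ux) (sg := -1)); first by rewrite oppr_eq0 oner_eq0.
  by move=> y /le ?; rewrite mulN1r opprB subr_ge0.
have G0 : G x = 0.
  by apply: enorm_eq0; rewrite web_grad_norm// -D0 subrr cbrt0 mulr0.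
have [y By xy] := bdist_foot HO x.
have [q q0 [D1 D2]] := C2_line HO (y - x) C2 Ox.
have [r r0 Hr] := taylor2 q0 (fun t tq => (D1 t tq).2) D2 ltr01.
set h2 := hess_form _ _ _ in Hr D2.
pose C := `|h2| / 2 + 1.
have A : c0 * p43 rho <= 0.
  apply: (@small_le0 _ _ C (Num.min 1 (Num.min q r))).
    by rewrite !lt_min ltr01 q0.
  move=> s; rewrite !lt_min => /andP[s0 /andP[s1 /andP[sq sr]]].
  pose t := s ^+ 3.
  have ts : t <= s by rewrite /t -[leRHS]expr1 ler_wiXn2l// ltW.
  have t0 : 0 < t by rewrite exprn_gt0.
  have tq : `|t| < q by rewrite gtr0_norm//; exact: le_lt_trans ts sq.
  have tr : `|t| < r by rewrite gtr0_norm//; exact: le_lt_trans ts sr.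
  have t01 : 0 <= t <= 1 by rewrite (ltW t0) (le_trans ts)// ltW.
  have [Ot _] := D1 t tq.
  have := Hr t tr; rewrite !scale0r !addr0 gE G0 dot0l mul0r addr0 ler_norml.
  move=> /andP[H1 _].
  have dl := bdist_foot_line By xy t01; rewrite -D0 in dl.
  have tr0 : 0 <= t * rho by rewrite mulr_ge0// ltW.
  have p1 : p43 (t * rho) <= p43 `|rho - d (x + t *: (y - x))|.
    by apply: p43_le => //; apply: le_trans (ler_norm _); lra.
  have uE : u (x + t *: (y - x)) <= c0 * (p43 rho - p43 (t * rho)).
    by rewrite /u ler_pM2l//; lra.
  have pE : p43 (t * rho) = s ^+ 4 * p43 rho.
    rewrite p43M ?(ltW t0) ?(ltW rho0)//; congr (_ * _).
    by rewrite p43E /t cbrt_cube// ltW.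
  have ux0 : u x = c0 * p43 rho by rewrite /u -D0 subrr normr0 p43_0 subr0.
  have := le _ Ot; rewrite ux ux0 in H1 => H2.
  have H3 : c0 * (s ^+ 4 * p43 rho) <= C * t ^+ 2.
    have hn : - h2 / 2 * t ^+ 2 <= `|h2| / 2 * t ^+ 2.
      by rewrite ler_wpM2r ?sqr_ge0// ler_wpM2r// -normrN ler_norm.
    by rewrite pE in uE; exact: (alg _ _ _ _ _ _ _ _ H1 H2 uE hn).
  have s4 : 0 < s ^+ 4 by rewrite exprn_gt0.
  rewrite -(ler_pM2l s4).
  have C0 : 0 <= C by rewrite addr_ge0// divr_ge0.
  apply: (@le_trans _ _ (C * t ^+ 2)); first by lra.
  have -> : C * t ^+ 2 = s * (s ^+ 5 * C) by rewrite /t; ring.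
  have -> : s ^+ 4 * (s * C) = s * (s ^+ 4 * C) by ring.
  by rewrite ler_pM2l// ler_wpM2r// ler_wiXn2l// ltW.
have : 0 < c0 * p43 rho by rewrite mulr_gt0// p43_gt0.
by rewrite ltNge A.
Qed.

Lemma web_fun_viscosity : viscosity_solution Om u.
Proof.
have lim x e : 0 < e -> \forall y \near within Om (nbhs x), `|u y - u x| < e.
  move=> e0; rewrite near_withinE; apply/nbhs_enormP.
  by have [r r0 Hr] := web_fun_near x e0; exists r => // y /Hr.
split.
- by apply: continuous_subspaceT => x; exact: web_fun_continuous.
- split.
    move=> x Ox a xa; have a0 : 0 < a - u x by rewrite subr_gt0.
    apply: filterS (lim x _ a0) => y; rewrite ltr_norml => /andP[_]; lra.
  move=> x psi Ox C2 [ux le]; rewrite lerNl.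
  have H y : Om y -> 0 <= 1 * (psi y - u y) by move=> /le; rewrite mul1r subr_ge0.
  have := rho_sub_ge0 (domain_closure Ox); rewrite le_eqVlt => /orP[/eqP D0|D0].
    have gE := touching_grad C2 Ox ux (oner_neq0 R) H.
    have G0 : G x = 0.
      by apply: enorm_eq0; rewrite web_grad_norm -?D0 ?cbrt0 ?mulr0//; exact: domain_closure.
    rewrite inf_laplacian_form gE G0 -(scale0r (0 : 'rV[R]_n)) hess_formZ expr0n mul0r.
    by rewrite lerN10.
  have := touching_off_ridge C2 Ox ux (oner_neq0 R) H D0; rewrite mul1r; lra.
split.
  move=> x Ox a xa; have a0 : 0 < u x - a by rewrite subr_gt0.
  apply: filterS (lim x _ a0) => y; rewrite ltr_norml => /andP[+ _]; lra.
move=> x psi Ox C2 T.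
have := rho_sub_ge0 (domain_closure Ox); rewrite le_eqVlt => /orP[/eqP D0|D0].
  have E : rho = d x by lra.
  by case: (no_touching_on_ridge C2 Ox T E).
case: T => ux le.
have H y : Om y -> 0 <= (- 1) * (psi y - u y).
  by move=> /le; rewrite mulN1r opprB subr_ge0.
have N1 : (- 1 : R) != 0 by rewrite oppr_eq0 oner_eq0.
have := touching_off_ridge C2 Ox (esym ux) N1 H D0; rewrite mulN1r; lra.
Qed.

Lemma web_overdetermined : overdetermined_solution Om (cbrt 3 * cbrt rho) u.
Proof.
split; [exact: web_fun_viscosity|exact: web_fun_boundary|].
by exists G; [exact: web_C1_closure|exact: web_grad_boundary].
Qed.

End WebSolution.

(** * The characterization *)

Theorem theorem2 (R : realType) (n : nat) (n_gt0 : (0 < n)%N)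
    (Omega : set 'rV[R]_n)
    (Omega_nonempty : Omega !=set0)
    (Omega_open : open Omega)
    (Omega_bounded : bounded_set Omega)
    (Omega_connected : connected Omega)
    (Omega_convex : convex_set Omega) :
  ((exists (c : R) (u : 'rV[R]_n -> R), overdetermined_solution Omega c u)
     <-> stadium_like Omega)
  /\
  (forall (c : R) (u : 'rV[R]_n -> R), overdetermined_solution Omega c u ->
     (forall x, closure Omega x -> u x = web_phi Omega x)
     /\ inradius Omega = c ^+ 3 / 3).
Proof.
have HO : convex_domain Omega by [].
split; last first.
  move=> c u [[_ Hsub Hsup] ub [g HC gc]]; split.
    by move=> x; exact: (sol_web HO Hsub Hsup ub HC gc).
  exact: (sol_inradius HO Hsub Hsup ub HC gc).
split=> [[c [u [[_ Hsub Hsup] ub [g HC gc]]]]|[_ _ _ Hst]].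
  exact: (sol_stadium HO Hsub Hsup ub HC gc).
have [P HP] := ridge_proj_exists HO Hst.
exists (cbrt 3 * cbrt (inradius Omega)), (web_fun (Om := Omega)).
exact: (web_overdetermined HO HP).
Qed.
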